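(* Let $\mu$ be a translation bounded measure on $G$. Then $\mu$ is Weyl almost periodic if and only if the following three conditions hold: (a) The autocorrelation $\gamma$ of $\mu$ exists for each van Hove sequence $\mathcal{B}$, and $\widehat{\gamma}$ is a pure point measure. (b) The Fourier--Bohr coefficients $a_\chi^{\mathcal{B}}(\mu)$ exist for all $\chi\in\widehat{G}$ and all van Hove sequences $\mathcal{B}$. (c) For all $\chi\in\widehat{G}$, the consistent phase property $\widehat{\gamma}(\{\chi\})=|a_\chi(\mu)|^2$ holds. (Existence along every van Hove sequence in (a) and (b) forces the autocorrelation and the Fourier--Bohr coefficients to be independent of the van Hove sequence; $\gamma$ and $a_\chi(\mu)$ denote the common values.)
   Context: $G$ is a locally compact (Hausdorff), $\sigma$-compact abelian group with Haar measure $\theta_G$; $|A|=\theta_G(A)$, and $\mathrm{d}t$ denotes integration against $\theta_G$. $\widehat{G}$ is the dual group. $\widetilde g(s)=\overline{g(-s)}$. A measure on $G$ is a (complex) Radon measure; $|\mu|$ is its total variation; $\widetilde\mu(g)=\overline{\mu(\widetilde g)}$. $\mu$ is translation bounded if $\sup_{t\in G}|\mu|(t+V)<\infty$ for one (equivalently every) nonempty open relatively compact $V$. $(\mu*\varphi)(t)=\int_G\varphi(t-s)\,\mathrm{d}\mu(s)$ for $\varphi\in C_c(G)$. A van Hove sequence $\mathcal{A}=(A_n)$ is a sequence of relatively compact open sets (of positive measure) with $|\partial^K A_n|/|A_n|\to 0$ for every compact $K\subseteq G$, where $\partial^K A=\big(\overline{A+K}\cap\overline{A^c}\big)\cup\big(\overline{A^c-K}\cap\overline{A}\big)$.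 The autocorrelation of $\mu$ with respect to $\mathcal{A}$ is the vague limit of $\frac{1}{|A_n|}\,\mu|_{A_n}*\widetilde{\mu}|_{-A_n}$, if it exists. It is positive definite, and its Fourier transform $\widehat\gamma$ is the unique positive measure on $\widehat G$ with $\int_{\widehat G}|\check\varphi|^2\,\mathrm{d}\widehat\gamma=\int_G(\varphi*\widetilde\varphi)\,\mathrm{d}\gamma$ for all $\varphi\in C_c(G)$, where $\check\varphi(\chi)=\int_G\chi(t)\varphi(t)\,\mathrm{d}t$. The Fourier--Bohr coefficient is $a_\chi^{\mathcal{A}}(\mu)=\lim_{n\to\infty}\frac{1}{|A_n|}\int_{A_n}\overline{\chi(t)}\,\mathrm{d}\mu(t)$, if the limit exists. A trigonometric polynomial is a finite linear combination of characters. For $f\in\mathcal{L}^1_{loc}(G)$ put $\|f\|_{\mathsf{W},1,\mathcal{A}}=\limsup_n\sup_{x\in G}\frac{1}{|A_n|}\int_{x+A_n}|f(t)|\,\mathrm{d}t$. A function $f\in\mathcal{L}^1_{loc}(G)$ is Weyl almost periodic with respect to $\mathcal{A}$ if for each $\varepsilon>0$ there is a trigonometric polynomial $P$ with $\|f-P\|_{\mathsf{W},1,\mathcal{A}}<\varepsilon$. A measure $\mu$ is Weyl almost periodic with respect to $\mathcal{A}$ if $\mu*\varphi$ is a Weyl almost periodic function for all $\varphi\in C_c(G)$. For translation bounded measures this property does not depend on the choice of the van Hove sequence, so one simply says that $\mu$ is Weyl almost periodic. *)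

(* Defs.v *)
From HB Require Import structures.
From mathcomp Require Import all_boot all_order all_algebra.
From mathcomp Require Import all_classical all_reals all_analysis.
From mathcomp Require Import complex.

Set Implicit Arguments.
Unset Strict Implicit.
Unset Printing Implicit Defensive.

Import Order.TTheory GRing.Theory Num.Theory.
Import numFieldNormedType.Exports.

Local Open Scope classical_set_scope.
Local Open Scope ring_scope.

(* The library puts a norm topology on abstract number fields only; this makes
   it available on the concrete type R[i]. *)
HB.instance Definition _ (R : realType) :=
  NormedModule.copy R[i] (R[i] : numClosedFieldType)^o.

(* Measurable types are pointed in the library. *)
HB.instance Definition _ (G : topologicalZmodType) := isPointed.Build G 0.

Definition cabs (R : realType) (z : R[i]) : R := complex.Re `|z|.

Definition sigma_compact (T : topologicalType) : Prop :=
  exists K : nat -> set T,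
    (forall n, compact (K n)) /\ \bigcup_n K n = [set: T].

Definition borel (T : ptopologicalType) : Type := g_sigma_algebraType (@open T).
HB.instance Definition _ (T : ptopologicalType) :=
  Measurable.copy (borel T) (g_sigma_algebraType (@open T)).

Section radon.
Context (R : realType) (T : ptopologicalType).
Implicit Types (m : {measure set (borel T) -> \bar R}) (f : T -> R[i]).

Local Open Scope ereal_scope.

Definition is_radon m : Prop :=
  [/\ forall K : set T, compact K -> measurable (K : set (borel T)) ->
        m K < +oo,
      forall B : set (borel T), measurable B ->
        m B = ereal_inf [set m U | U in [set U : set T | open U /\ B `<=` U]] &
      forall U : set T, open U ->
        m U = ereal_sup
          [set m K | K in [set K : set T |
             [/\ compact K, measurable (K : set (borel T)) & K `<=` U]]]].

Record radon_measure : Type := RadonMeasure {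
  radon_val :> {measure set (borel T) -> \bar R};
  radonP : is_radon radon_val }.

Definition cintegral m f : R[i] :=
  Complex (\int[m]_x complex.Re (f x))%R (\int[m]_x complex.Im (f x))%R.

(* Tested on relatively compact sets: without sigma-compactness, an outer
   regular extension of a sum of point masses need not be the sum of the point
   masses on every Borel set. *)
Definition pure_point (nu : radon_measure) : Prop :=
  forall B : set (borel T), measurable B -> precompact (B : set T) ->
    nu B = \esum_(x in B) nu [set x].

(* A complex Radon measure is a linear combination
   (rp - rm) + i (ip - im) of positive ones; on a non-compact space it is not
   a set function on all Borel sets, only on the relatively compact ones. *)
Record cmeasure : Type := CMeasure {
  cm_rp : radon_measure; cm_rm : radon_measure;
  cm_ip : radon_measure; cm_im : radon_measure }.

Definition cm_integral (mu : cmeasure) f : R[i] :=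
  (cintegral (cm_rp mu) f - cintegral (cm_rm mu) f
   + 'i%C * (cintegral (cm_ip mu) f - cintegral (cm_im mu) f))%R.

(* Meaningful for relatively compact Borel sets, where the four values are
   finite. *)
Definition cm_val (mu : cmeasure) (B : set (borel T)) : R[i] :=
  Complex (fine (cm_rp mu B) - fine (cm_rm mu B))%R
          (fine (cm_ip mu B) - fine (cm_im mu B))%R.

Definition total_variation (mu : cmeasure) (B : set (borel T)) : \bar R :=
  ereal_sup [set v : \bar R | exists (n : nat) (F : 'I_n -> set (borel T)),
    [/\ forall i, measurable (F i),
        trivIset [set: 'I_n] F,
        \bigcup_i F i = B &
        v = (\sum_(i < n) cabs (cm_val mu (F i)))%R%:E]].

End radon.

Section continuous_compact_support.
Context (R : realType) (T : topologicalType).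

Definition Cc (phi : T -> R[i]) : Prop :=
  continuous phi /\ compact (closure [set x | phi x != 0]).

End continuous_compact_support.

Section dual_group.
Context (R : realType) (G : topologicalZmodType).

Definition is_character (chi : G -> R[i]) : Prop :=
  [/\ continuous chi,
      forall x y, chi (x + y) = chi x * chi y &
      forall x, `|chi x| = 1].

Definition characters : set {compact-open, G -> R[i]} :=
  [set chi | is_character (chi : G -> R[i])].

Definition dual : Type := set_type characters.

HB.instance Definition _ := Topological.on dual.

Fact trivial_character :
  (fun=> 1 : R[i]) \in (characters : set {compact-open, G -> R[i]}).
Proof.
apply/mem_set; split => [x|x y|x]; first exact: cvg_cst.
- by rewrite mulr1.
- by rewrite normr1.
Qed.

HB.instance Definition _ :=
  isPointed.Build dual (exist _ (fun=> 1 : R[i]) trivial_character).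

Definition dual_fun (chi : dual) : G -> R[i] := set_val chi.

Definition is_trig_poly (P : G -> R[i]) : Prop :=
  exists (n : nat) (c : 'I_n -> R[i]) (chi : 'I_n -> dual),
    P = fun x => \sum_(i < n) c i * dual_fun (chi i) x.

End dual_group.
Coercion dual_fun : dual >-> Funclass.

Section measures_on_group.
Context (R : realType) (G : topologicalZmodType).
Implicit Types (theta : radon_measure R G) (mu gamma : cmeasure R G).
Implicit Types (f g phi : G -> R[i]) (A B K V : set G) (chi : dual R G).

Definition translate (x : G) A : set G := [set x + y | y in A].

Definition is_haar theta : Prop :=
  theta [set: G] != 0%E /\
  forall (x : G) (B : set (borel G)), measurable B ->
    theta (translate x B) = theta B.

Definition vol theta A : R := fine (theta A).

Definition setadd A B : set G := [set x + y | x in A & y in B].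
Definition setsub A B : set G := [set x - y | x in A & y in B].

Definition vh_boundary K A : set G :=
  (closure (setadd A K) `&` closure (~` A))
  `|` (closure (setsub (~` A) K) `&` closure A).

Definition van_hove theta (A : nat -> set G) : Prop :=
  [/\ forall n, open (A n) /\ precompact (A n),
      forall n, (0 < theta (A n))%E &
      forall K, compact K ->
        vol theta (vh_boundary K (A n)) / vol theta (A n) @[n --> \oo] --> 0].

Definition tilde g : G -> R[i] := fun s => ((g (- s))^*)%C.

Definition translation_bounded mu : Prop :=
  exists V, [/\ open V, V !=set0, precompact V &
    (ereal_sup (range (fun t : G => total_variation mu (translate t V)))
      < +oo)%E].

(* Measures as functionals m, to be read as g |-> \int g dm. *)
Local Notation functional := ((G -> R[i]) -> R[i]).
Implicit Type m : functional.

Definition fun_restrict m A : functional := fun g => m (patch (fun=> 0) A g).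
Definition fun_tilde m : functional := fun g => ((m (tilde g))^*)%C.
Definition fun_conv m1 m2 : functional :=
  fun g => m1 (fun s => m2 (fun t => g (s + t))).

Definition conv_meas mu phi : G -> R[i] :=
  fun t => cm_integral mu (fun s => phi (t - s)).

Definition conv theta f g : G -> R[i] :=
  fun t => cintegral theta (fun s => f (t - s) * g s).

Definition autocorrelation theta mu (A : nat -> set G) gamma : Prop :=
  forall phi, Cc phi ->
    ((vol theta (A n))^-1)%:C%C *
      fun_conv (fun_restrict (cm_integral mu) (A n))
               (fun_restrict (fun_tilde (cm_integral mu)) (-%R @` A n)) phi
    @[n --> \oo] --> cm_integral gamma phi.

Definition inverse_fourier theta phi : dual R G -> R[i] :=
  fun chi => cintegral theta (fun t => chi t * phi t).

Definition fourier_transform theta gamma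
    (gammahat : radon_measure R (dual R G)) : Prop :=
  forall phi, Cc phi ->
    gammahat.-integrable setT
      (fun chi => (cabs (inverse_fourier theta phi chi) ^+ 2)%:E) /\
    (\int[gammahat]_chi (cabs (inverse_fourier theta phi chi) ^+ 2))%:C%C
      = cm_integral gamma (conv theta phi (tilde phi)).

Definition fourier_bohr theta mu (A : nat -> set G) chi (a : R[i]) : Prop :=
  ((vol theta (A n))^-1)%:C%C *
    fun_restrict (cm_integral mu) (A n) (fun t => ((chi t)^*)%C)
  @[n --> \oo] --> a.

Definition L1_loc theta f : Prop :=
  [/\ measurable_fun [set: borel G] (fun x : borel G => complex.Re (f x)),
      measurable_fun [set: borel G] (fun x : borel G => complex.Im (f x)) &
      forall K, compact K ->
        (\int[theta]_(t in (K : set (borel G))) (cabs (f t))%:E < +oo)%E].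

Definition weyl_norm theta (A : nat -> set G) f : \bar R :=
  limn_esup (fun n => ereal_sup (range (fun x : G =>
    (((vol theta (A n))^-1)%:E *
     \int[theta]_(t in (translate x (A n) : set (borel G))) (cabs (f t))%:E)%E))).

Definition weyl_ap_fun theta (A : nat -> set G) f : Prop :=
  L1_loc theta f /\
  forall eps : R, 0 < eps ->
    exists P, is_trig_poly P /\
      (weyl_norm theta A (fun t => f t - P t)%R < eps%:E)%E.

Definition weyl_ap theta (A : nat -> set G) mu : Prop :=
  forall phi, Cc phi -> weyl_ap_fun theta A (conv_meas mu phi).

End measures_on_group.

(* Main.v *)
(* Let M denote the mean along van Hove sequences and f = mu * phi(-.), for phi in
   C_c(G).  Up to boundary terms, M|f|^2 is the autocorrelation tested on
   phi * phi~, that is, the integral of |phi^|^2 against the diffraction measure,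
   and the Fourier-Bohr coefficients of f are phi^(chi) a_chi(mu).

   If mu is Weyl almost periodic, then f is approximable by trigonometric
   polynomials in quadratic mean, so all these means exist, the autocorrelation is
   obtained from them by an approximate identity and the Riesz representation
   theorem, and Parseval's identity says that the sum of the point masses
   |a_chi|^2 at chi is the diffraction measure.  A positive measure with the
   prescribed integrals of |phi^|^2 has determined atoms (modulate phi by averages
   of characters), which gives the consistent phase property.

   Conversely, pure pointness and consistent phase turn the identity for M|f|^2
   into Parseval's identity, hence finite Fourier sums of f approximate f in
   quadratic mean along every van Hove sequence.  Since x_n + A_n is again a van
   Hove sequence, the approximation is uniform in the translate, which is the Weyl
   seminorm.  *)

Require Import Defs.
From HB Require Import structures.
From mathcomp Require Import all_boot all_order all_algebra.
From mathcomp Require Import all_classical all_reals all_analysis.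
From mathcomp Require Import measurable_realfun complex zify ring lra.
Import Order.TTheory GRing.Theory Num.Theory.
Import numFieldNormedType.Exports.

Set Implicit Arguments.
Unset Strict Implicit.
Unset Printing Implicit Defensive.

Local Open Scope classical_set_scope.
Local Open Scope ring_scope.

(** * Complex modulus, bounded Borel functions and local functionals *)

(** The Weyl seminorm is an L^1 quantity, uniform over the translates of one set, while Parseval's
    identity is an L^2 statement along one sequence. They are linked by averaging the translates of
    a fixed [A N] over a much larger set, by approximants that stay bounded, so that closeness in
    L^1 yields closeness in L^2, and by Cauchy-Schwarz on the way back.

    Reflecting [phi] is forced by the autocorrelation: tested on [phi * psi~] it integrates
    [phi (s - y)] against [mu] in [s]. Invariance of Haar measure under [x -> - x] brings the
    transform back to that of [phi].

    A complex measure has a meaning on relatively compact sets only, so integrands are cut to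
    bounded Borel sets or have compact support. The error of cutting to [B] sits at the points whose
    compact neighbourhood meets both [B] and its complement; translation boundedness turns it into a
    multiple of a van Hove boundary.

    Limits that exist along all van Hove sequences have a common value, because two such sequences
    can be interleaved into a third. *)

Section complex_modulus.
Context (R : realType).
Implicit Types (z w : R[i]) (x : R).

Lemma normCE z : `|z| = (cabs z)%:C%C.
Proof. by rewrite /cabs normc_def. Qed.

Lemma cReD z w : complex.Re (z + w) = complex.Re z + complex.Re w.
Proof. by case: z => a b; case: w. Qed.
Lemma cImD z w : complex.Im (z + w) = complex.Im z + complex.Im w.
Proof. by case: z => a b; case: w. Qed.
Lemma cReN z : complex.Re (- z) = - complex.Re z.
Proof. by case: z. Qed.
Lemma cImN z : complex.Im (- z) = - complex.Im z.
Proof. by case: z. Qed.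
Lemma cReM z w : complex.Re (z * w) =
  complex.Re z * complex.Re w - complex.Im z * complex.Im w.
Proof. by case: z => a b; case: w. Qed.
Lemma cImM z w : complex.Im (z * w) =
  complex.Re z * complex.Im w + complex.Im z * complex.Re w.
Proof. by case: z => a b; case: w. Qed.
Lemma cReJ z : complex.Re (z^*)%C = complex.Re z.
Proof. by case: z. Qed.
Lemma cImJ z : complex.Im (z^*)%C = - complex.Im z.
Proof. by case: z. Qed.
Lemma complex_eq z w : complex.Re z = complex.Re w -> complex.Im z = complex.Im w ->
  z = w.
Proof. by case: z => a b; case: w => c d /= -> ->. Qed.

Lemma cabs_ge0 z : 0 <= cabs z.
Proof. by rewrite -lecR -normCE; exact: normr_ge0. Qed.
Lemma cabsD z w : cabs (z + w) <= cabs z + cabs w.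
Proof. by rewrite -lecR rmorphD/= -!normCE; exact: ler_normD. Qed.
Lemma cabsM z w : cabs (z * w) = cabs z * cabs w.
Proof. by apply: (@complexI R); rewrite rmorphM/= -!normCE normrM. Qed.
Lemma cabsN z : cabs (- z) = cabs z.
Proof. by rewrite /cabs normrN. Qed.
Lemma cabsC z w : cabs (z - w) = cabs (w - z).
Proof. by rewrite /cabs distrC. Qed.
Lemma cabsB z w : cabs (z - w) <= cabs z + cabs w.
Proof. by rewrite -(cabsN w); exact: cabsD. Qed.
Lemma cabs_tri w z u : cabs (z - u) <= cabs (z - w) + cabs (w - u).
Proof. by rewrite (_ : z - u = (z - w) + (w - u)) ; [exact: cabsD|ring]. Qed.
Lemma cabs_dist z w : `|cabs z - cabs w| <= cabs (z - w).
Proof.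
have h (u v : R[i]) : cabs u - cabs v <= cabs (u - v).
  by rewrite lerBlDr; have := cabsD (u - v) v; rewrite subrK.
by rewrite ler_norml h andbT lerNl opprB cabsC h.
Qed.
Lemma cabs0 : cabs (0 : R[i]) = 0.
Proof. by rewrite /cabs normr0. Qed.
Lemma cabs1 : cabs (1 : R[i]) = 1.
Proof. by rewrite /cabs normr1. Qed.
Lemma cabs_eq0 z : cabs z = 0 -> z = 0.
Proof. by move=> z0; apply/eqP; rewrite -normr_eq0 normCE z0. Qed.
Lemma cabs_gt0 z : z != 0 -> 0 < cabs z.
Proof.
by move=> z0; rewrite lt_neqAle cabs_ge0 andbT eq_sym; apply: contra z0 => /eqP/cabs_eq0->.
Qed.
Lemma cabs_sqrE z : cabs z ^+ 2 = complex.Re z ^+ 2 + complex.Im z ^+ 2.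
Proof.
by apply: (@complexI R); rewrite rmorphXn/= -normCE add_Re2_Im2.
Qed.
Lemma cabsR x : cabs x%:C%C = `|x|.
Proof. by rewrite /cabs normc_def /= expr0n /= addr0 sqrtr_sqr. Qed.
Lemma cabsJ z : cabs (z^*)%C = cabs z.
Proof. by rewrite /cabs !normc_def cReJ cImJ /= sqrrN. Qed.
Lemma Re_cabs z : `|complex.Re z| <= cabs z.
Proof.
rewrite -(ler_sqr (x:=`|_|)) ?nnegrE ?cabs_ge0// cabs_sqrE real_normK ?num_real//.
by rewrite lerDl sqr_ge0.
Qed.
Lemma Im_cabs z : `|complex.Im z| <= cabs z.
Proof.
rewrite -(ler_sqr (x:=`|_|)) ?nnegrE ?cabs_ge0// cabs_sqrE real_normK ?num_real//.
by rewrite lerDr sqr_ge0.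
Qed.
Lemma cabs_ReIm z : cabs z <= `|complex.Re z| + `|complex.Im z|.
Proof.
rewrite -ler_sqr ?nnegrE ?addr_ge0 ?cabs_ge0// cabs_sqrE sqrrD.
rewrite !real_normK ?num_real// lerD2r lerDl.
by rewrite mulrn_wge0// mulr_ge0.
Qed.
Lemma mulJ z : z * (z^*)%C = (cabs z ^+ 2)%:C%C.
Proof.
rewrite cabs_sqrE; apply: complex_eq; rewrite ?cReM ?cImM cReJ cImJ /=; ring.
Qed.
Lemma cJM z w : (z * w)^*%C = z^*%C * w^*%C.
Proof. exact: rmorphM. Qed.
Lemma cJR x : (x%:C%C)^*%C = x%:C%C.
Proof. by apply: complex_eq; rewrite ?cReJ ?cImJ //= oppr0. Qed.
Lemma cabs_sum I (s : seq I) (F : I -> R[i]) :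
  cabs (\sum_(i <- s) F i) <= \sum_(i <- s) cabs (F i).
Proof.
elim/big_ind2: _ => //; first by rewrite cabs0.
by move=> a b c d ab cd; rewrite (le_trans (cabsD _ _))// lerD.
Qed.
Lemma cvgCP (T : Type) (F : set_system T) (FF : Filter F) (f : T -> R[i]) (a : R[i]) :
  (f x @[x --> F] --> a) <-> (forall e : R, 0 < e -> \forall x \near F, cabs (a - f x) < e).
Proof.
split.
  move=> /cvgrPdist_lt fa e e0.
  have e0' : 0 < e%:C%C :> R[i] by rewrite (ltcR 0 e).
  have := fa _ e0'; apply: filterS => x.
  by rewrite normCE ltcR.
move=> fa; apply/cvgrPdist_lt => -[e e'] /=.
(* In the order of [R[i]] a positive number has imaginary part 0, so every admissible radius is
   real. *)
rewrite ltcE /= => /andP[/eqP -> e0].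
have := fa e e0; apply: filterS => x.
by rewrite normCE (ltcR _ e).
Qed.

End complex_modulus.

Section continuity.
Context (R : realType) (T : topologicalType).
Implicit Types (f g : T -> R[i]).

Lemma contCP f : continuous f <->
  forall x (e : R), 0 < e -> \forall y \near x, cabs (f x - f y) < e.
Proof.
split=> [cf x e e0|cf x]; first by have /cvgCP := cf x; exact.
by apply/cvgCP => e; exact: cf.
Qed.

Lemma cont_Re f : continuous f -> continuous (fun x => complex.Re (f x)).
Proof.
move=> /contCP cf x; apply/cvgrPdist_lt => e /(cf x); apply: filterS => y.
by apply: le_lt_trans; rewrite -cReN -cReD Re_cabs.
Qed.
Lemma cont_Im f : continuous f -> continuous (fun x => complex.Im (f x)).
Proof.
move=> /contCP cf x; apply/cvgrPdist_lt => e /(cf x); apply: filterS => y.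
by apply: le_lt_trans; rewrite -cImN -cImD Im_cabs.
Qed.
Lemma cont_cabs f : continuous f -> continuous (fun x => cabs (f x)).
Proof.
move=> /contCP cf x; apply/cvgrPdist_lt => e /(cf x); apply: filterS => y.
by apply: le_lt_trans; exact: cabs_dist.
Qed.
Lemma cont_ReIm f : continuous (fun x => complex.Re (f x)) ->
  continuous (fun x => complex.Im (f x)) -> continuous f.
Proof.
move=> cr ci; apply/contCP => x e e0; have e2 : 0 < e / 2 by rewrite divr_gt0.
have /cvgrPdist_lt/(_ _ e2) h1 := cr x; have /cvgrPdist_lt/(_ _ e2) h2 := ci x.
near=> y; rewrite (le_lt_trans (cabs_ReIm _))// cReD cImD cReN cImN (splitr e) ltrD//.
  by near: y.
by near: y.
Unshelve. all: by end_near. Qed.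
Lemma cont_real (g : T -> R) : continuous g -> continuous (fun x => (g x)%:C%C).
Proof. by move=> cg; apply: cont_ReIm => //= x; exact: cvg_cst. Qed.
End continuity.

Section bounded_borel.
Context (R : realType) (T : ptopologicalType).
Implicit Types (f g : T -> R[i]) (E : set T).

(** Boundedness is global, so that cutting to any set of finite measure gives an integrable
    function; integrability is never assumed separately below. *)
Definition bmeas f :=
  [/\ measurable_fun [set: borel T] (fun x : borel T => complex.Re (f x)),
      measurable_fun [set: borel T] (fun x : borel T => complex.Im (f x)) &
      exists M : R, forall x, cabs (f x) <= M].

Definition cut E f : T -> R[i] := patch (fun=> 0) E f.

Definition bounded_borel E := measurable (E : set (borel T)) /\ precompact E.

Lemma open_borel (U : set T) : open U -> measurable (U : set (borel T)).
Proof. by move=> oU; apply: sub_sigma_algebra. Qed.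
Lemma closed_borel (F : set T) : closed F -> measurable (F : set (borel T)).
Proof.
move=> cF; rewrite -(setCK F); apply: measurableC; apply: open_borel.
exact: closed_openC.
Qed.

Lemma continuous_borel (h : T -> R) : continuous h ->
  measurable_fun [set: borel T] (h : borel T -> R).
Proof.
move=> ch; apply: (measurability _ (RGenOpens.measurableE R)).
move=> _ [_ [a [b ->] <-]]; rewrite setTI; apply: open_borel.
by apply: open_comp => // x _; exact: ch.
Qed.

Lemma cont_bmeas f (M : R) : continuous f -> (forall x, cabs (f x) <= M) -> bmeas f.
Proof.
move=> cf fM; split; last by exists M.
  by apply: continuous_borel; exact: cont_Re.
by apply: continuous_borel; exact: cont_Im.
Qed.

Lemma bmeas_cst c : bmeas (fun=> c).
Proof. by apply: (@cont_bmeas _ (cabs c)) => // x; exact: cvg_cst. Qed.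

Lemma bmeasD f g : bmeas f -> bmeas g -> bmeas (fun x => f x + g x).
Proof.
move=> [fr fi [M fM]] [gr gi [N gN]]; split.
- by under eq_fun do rewrite cReD; exact: measurable_funD.
- by under eq_fun do rewrite cImD; exact: measurable_funD.
- by exists (M + N) => x; rewrite (le_trans (cabsD _ _))// lerD.
Qed.

Lemma bmeasM f g : bmeas f -> bmeas g -> bmeas (fun x => f x * g x).
Proof.
move=> [fr fi [M fM]] [gr gi [N gN]]; split.
- by under eq_fun do rewrite cReM; apply: measurable_funB; exact: measurable_funM.
- by under eq_fun do rewrite cImM; apply: measurable_funD; exact: measurable_funM.
- by exists (M * N) => x; rewrite cabsM ler_pM// cabs_ge0.
Qed.

Lemma bmeasZ c f : bmeas f -> bmeas (fun x => c * f x).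
Proof. by apply: bmeasM; exact: bmeas_cst. Qed.

Lemma bmeasB f g : bmeas f -> bmeas g -> bmeas (fun x => f x - g x).
Proof.
move=> bf /(bmeasZ (-1)) bg; have := bmeasD bf bg.
by under eq_fun do rewrite mulN1r.
Qed.

Lemma bmeasJ f : bmeas f -> bmeas (fun x => (f x)^*%C).
Proof.
move=> [fr fi [M fM]]; split.
- by under eq_fun do rewrite cReJ.
- by under eq_fun do rewrite cImJ; exact: measurableT_comp.
- by exists M => x; rewrite cabsJ.
Qed.

Lemma bmeas_sum I (s : seq I) (F : I -> T -> R[i]) :
  (forall i, bmeas (F i)) -> bmeas (fun x => \sum_(i <- s) F i x).
Proof.
move=> bF; elim: s => [|i s IH].
  by under eq_fun do rewrite big_nil; exact: bmeas_cst.
by under eq_fun do rewrite big_cons; exact: bmeasD.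
Qed.

Lemma cutE E f x : cut E f x = if x \in E then f x else 0.
Proof. by []. Qed.

Lemma cut_in E f x : E x -> cut E f x = f x.
Proof. by move=> Ex; rewrite /cut patchT// mem_set. Qed.
Lemma cut_out E f x : ~ E x -> cut E f x = 0.
Proof. by move=> Ex; rewrite /cut patchC// mem_set. Qed.

Lemma cut_eq E f g : (forall x, E x -> f x = g x) -> cut E f = cut E g.
Proof.
move=> fg; apply/funext => x; have [Ex|Ex] := pselect (E x).
  by rewrite !cut_in// fg.
by rewrite !cut_out.
Qed.

Lemma cut_id E f : (forall x, ~ E x -> f x = 0) -> cut E f = f.
Proof.
move=> f0; apply/funext => x; have [Ex|Ex] := pselect (E x).
  by rewrite cut_in.
by rewrite cut_out// f0.
Qed.

Lemma cut_cut E F f : E `<=` F -> cut E f = cut F (cut E f).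
Proof.
move=> EF; apply/funext => x; have [Ex|Ex] := pselect (E x).
  by rewrite !cut_in//; exact: EF.
by rewrite cut_out//; rewrite [RHS]cutE cut_out//; case: ifP.
Qed.

Lemma bmeas_cut E f : measurable (E : set (borel T)) -> bmeas f -> bmeas (cut E f).
Proof.
move=> mE [fr fi [M fM]]; split.
- rewrite (_ : (fun x => _) = (fun x : borel T => complex.Re (f x)) \_ E); last first.
    by apply/funext => x; rewrite /cut /patch; case: ifP.
  apply/(measurable_restrictT _ _).1 => //.
  exact: (@measurable_funS _ _ _ _ setT).
- rewrite (_ : (fun x => _) = (fun x : borel T => complex.Im (f x)) \_ E); last first.
    by apply/funext => x; rewrite /cut /patch; case: ifP.
  apply/(measurable_restrictT _ _).1 => //.
  exact: (@measurable_funS _ _ _ _ setT).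
- exists (Num.max M 0) => x; rewrite cutE; case: ifP => _.
    by rewrite le_max fM.
  by rewrite cabs0 le_max lexx orbT.
Qed.

Lemma radon_bounded_fin (m : radon_measure R T) E : hausdorff_space T ->
  bounded_borel E -> (m E < +oo)%E.
Proof.
move=> hT [mE pE]; have [K EK [cK clK]] := pE.
have mK : measurable (K : set (borel T)) by exact: closed_borel.
have [/(_ K cK mK) + _ _] := radonP m.
by apply: le_lt_trans; apply: le_measure; rewrite ?inE.
Qed.

End bounded_borel.

Section local_functionals.
Context (R : realType) (T : ptopologicalType) (hT : hausdorff_space T).
Implicit Types (f g : T -> R[i]) (E F : set T) (I : (T -> R[i]) -> R[i]).

(** Common interface of integration against a positive Radon measure, a complex measure and its
    conjugate. Linearity and boundedness are claimed only after cutting to a bounded Borel set,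
    since elsewhere the integrals may be mere default values. *)
Definition locfun I :=
  (forall E (a : R[i]) f g, bounded_borel (E : set T) -> bmeas f -> bmeas g ->
    I (cut E (fun x => a * f x + g x)) = a * I (cut E f) + I (cut E g)) /\
  (forall E, bounded_borel (E : set T) -> exists C : R, 0 <= C /\
    forall f M, bmeas f -> 0 <= M -> (forall x, E x -> cabs (f x) <= M) ->
      cabs (I (cut E f)) <= C * M).

Lemma bounded_borel_subset E F : measurable (E : set (borel T)) -> E `<=` F ->
  bounded_borel F -> bounded_borel E.
Proof. by move=> mE EF [_ /(precompact_subset EF)]. Qed.

Lemma bounded_borel_compact E : compact E -> bounded_borel E.
Proof.
move=> cE; have clE := compact_closed hT cE.
by split; [exact: closed_borel|rewrite precompact_closed].
Qed.

Lemma bounded_borelU E F : bounded_borel E -> bounded_borel F ->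
  bounded_borel (E `|` F).
Proof.
move=> [mE pE] [mF pF]; split; first exact: measurableU.
by move: pE pF; rewrite !precompactE closureU; exact: compactU.
Qed.

Lemma bmeas_Re_integrable (m : {measure set (borel T) -> \bar R}) E f :
  measurable (E : set (borel T)) -> (m E < +oo)%E -> bmeas f ->
  m.-integrable E (EFin \o (fun x : borel T => complex.Re (f x))).
Proof.
move=> mE Eoo [fr _ [M fM]]; apply: measurable_bounded_integrable => //.
  exact: (@measurable_funS _ _ _ _ setT).
exists M; split; first exact: num_real.
by move=> N MN x Ex /=; rewrite (le_trans (Re_cabs _))// (le_trans (fM _))// ltW.
Qed.

Lemma bmeas_Im_integrable (m : {measure set (borel T) -> \bar R}) E f :
  measurable (E : set (borel T)) -> (m E < +oo)%E -> bmeas f ->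
  m.-integrable E (EFin \o (fun x : borel T => complex.Im (f x))).
Proof.
move=> mE Eoo [_ fi [M fM]]; apply: measurable_bounded_integrable => //.
  exact: (@measurable_funS _ _ _ _ setT).
exists M; split; first exact: num_real.
by move=> N MN x Ex /=; rewrite (le_trans (Im_cabs _))// (le_trans (fM _))// ltW.
Qed.

Lemma cintegral_cut (m : {measure set (borel T) -> \bar R}) E f :
  cintegral m (cut E f) = Complex (\int[m]_(x in (E : set (borel T))) complex.Re (f x))
    (\int[m]_(x in (E : set (borel T))) complex.Im (f x)).
Proof.
rewrite /cintegral !(Rintegral_mkcond m E); congr Complex; apply: eq_Rintegral => x _;
  by rewrite cutE /patch; case: ifP.
Qed.

(** Real and imaginary parts are bounded separately, which is the origin of the factor 2; the same
    loss recurs in [cabs_avg]. *)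
Lemma cintegral_bound (m : radon_measure R T) E f (M : R) : bounded_borel E ->
  bmeas f -> 0 <= M -> (forall x, E x -> cabs (f x) <= M) ->
  cabs (cintegral m (cut E f)) <= 2 * fine (m E) * M.
Proof.
move=> bE bf M0 fM; have [mE _] := bE; have Efin := radon_bounded_fin m hT bE.
rewrite cintegral_cut (le_trans (cabs_ReIm _))//=.
have ic : m.-integrable E (EFin \o cst M).
  apply: measurable_bounded_integrable => //.
  by exists `|M|; split; [exact: num_real|move=> N MN x _ /=; exact: ltW].
have key (h : borel T -> R) : m.-integrable E (EFin \o h) ->
    (forall x, E x -> `|h x| <= M) -> `|\int[m]_(x in E) h x| <= fine (m E) * M.
  move=> ih hM; apply: (le_trans (le_normr_Rintegral mE ih)).
  rewrite mulrC -(Rintegral_cst m mE M); apply: le_Rintegral => //.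
  exact: integrable_norm.
rewrite (_ : 2 * _ * M = fine (m E) * M + fine (m E) * M); last by ring.
apply: lerD.
  by apply: key; [exact: bmeas_Re_integrable|move=> x /fM; apply: le_trans; exact: Re_cabs].
by apply: key; [exact: bmeas_Im_integrable|move=> x /fM; apply: le_trans; exact: Im_cabs].
Qed.

Lemma locfun_cintegral (m : radon_measure R T) : locfun (cintegral m).
Proof.
split=> [E a f g bE bf bg|E bE].
  have [mE _] := bE; have Efin := radon_bounded_fin m hT bE.
  have ir h := @bmeas_Re_integrable m E h mE Efin.
  have ii h := @bmeas_Im_integrable m E h mE Efin.
  rewrite !cintegral_cut.
  have bc c : bmeas (fun x => c * f x) by exact: bmeasZ.
  apply: complex_eq; rewrite ?cReD ?cImD ?cReM ?cImM /=.
    under eq_Rintegral do rewrite cReD.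
    rewrite RintegralD//; [|exact: ir|exact: ir]; congr (_ + _).
    under eq_Rintegral do rewrite cReM.
    by rewrite RintegralB// ?RintegralZl//; try (exact: ir || exact: ii);
      [have := ir _ (bc (complex.Re a)%:C%C)|have := ii _ (bc (complex.Im a)%:C%C)];
      apply: eq_integrable => // x _ /=; rewrite ?cReM ?cImM/= ?mul0r ?subr0 ?addr0.
  under eq_Rintegral do rewrite cImD.
  rewrite RintegralD//; [|exact: ii|exact: ii]; congr (_ + _).
  under eq_Rintegral do rewrite cImM.
  by rewrite RintegralD// ?RintegralZl//; try (exact: ir || exact: ii);
      [have := ii _ (bc (complex.Re a)%:C%C)|have := ir _ (bc (complex.Im a)%:C%C)];
      apply: eq_integrable => // x _ /=; rewrite ?cReM ?cImM/= ?mul0r ?subr0 ?addr0.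
exists (2 * fine (m E)); split; first by rewrite mulr_ge0.
by move=> f M bf M0 fM; exact: cintegral_bound.
Qed.

Lemma locfunD I J a b : locfun I -> locfun J -> locfun (fun f => a * I f + b * J f).
Proof.
move=> [Il Ib] [Jl Jb]; split=> [E c f g bE bf bg|E bE].
  by rewrite Il// Jl//; ring.
have [C [C0 HC]] := Ib E bE; have [D [D0 HD]] := Jb E bE.
exists (cabs a * C + cabs b * D); split.
  by rewrite addr_ge0// mulr_ge0// cabs_ge0.
move=> f M bf M0 fM; rewrite (le_trans (cabsD _ _))// !cabsM mulrDl -!mulrA.
by rewrite lerD// ler_wpM2l ?cabs_ge0 ?HC ?HD.
Qed.

Lemma locfun_cm (mu : cmeasure R T) : locfun (cm_integral mu).
Proof.
rewrite /cm_integral.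
have h1 := locfunD 1 (-1) (locfun_cintegral (cm_rp mu)) (locfun_cintegral (cm_rm mu)).
have h2 := locfunD 1 (-1) (locfun_cintegral (cm_ip mu)) (locfun_cintegral (cm_im mu)).
have := locfunD 1 'i%C h1 h2.
by congr locfun; apply/funext => f; ring.
Qed.

Lemma cutJ E f : cut E (fun x => (f x)^*%C) = (fun x => (cut E f x)^*%C).
Proof. by apply/funext => x; rewrite !cutE; case: ifP => // _; rewrite conjc0. Qed.

(** Puts the conjugate measure under the same interface, so that Fubini's theorem applies to it as
    well. *)
Lemma locfunJ I : locfun I -> locfun (fun f => (I (fun x => (f x)^*%C))^*%C).
Proof.
move=> [Il Ib]; split=> [E a f g bE bf bg|E bE].
  rewrite -!cutJ (_ : (fun x => _) = (fun x => (a^*)%C * (f x)^*%C + (g x)^*%C)).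
    rewrite Il//; [|exact: bmeasJ|exact: bmeasJ].
    by rewrite rmorphD rmorphM /= conjcK.
  by apply/funext => x; rewrite rmorphD rmorphM.
have [C [C0 HC]] := Ib E bE; exists C; split=> // f M bf M0 fM.
rewrite cabsJ -cutJ HC//; first exact: bmeasJ.
by move=> x /fM; rewrite cabsJ.
Qed.

Section linear.
Context (I : (T -> R[i]) -> R[i]) (hI : locfun I) (E : set T) (bE : bounded_borel E).

Lemma locfun_cutD f g : bmeas f -> bmeas g ->
  I (cut E (fun x => f x + g x)) = I (cut E f) + I (cut E g).
Proof.
move=> bf bg; have := hI.1 E 1 f g bE bf bg; rewrite mul1r => <-.
by congr (I (cut E _)); apply/funext => x; rewrite mul1r.
Qed.

Lemma locfun_cut0 : I (cut E (fun=> 0)) = 0.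
Proof.
have := locfun_cutD (@bmeas_cst R T 0) (@bmeas_cst R T 0).
rewrite (_ : (fun=> 0 + 0) = fun=> 0) ?addr0//.
by move=> /eqP; rewrite -subr_eq0 opprD addrA subrr sub0r oppr_eq0 => /eqP.
Qed.

Lemma locfun_cutZ a f : bmeas f -> I (cut E (fun x => a * f x)) = a * I (cut E f).
Proof.
move=> bf; have := hI.1 E a f _ bE bf (@bmeas_cst R T 0).
rewrite locfun_cut0 addr0 => <-.
by congr (I (cut E _)); apply/funext => x; rewrite addr0.
Qed.

Lemma locfun_cutB f g : bmeas f -> bmeas g ->
  I (cut E (fun x => f x - g x)) = I (cut E f) - I (cut E g).
Proof.
move=> bf bg; have := hI.1 E (-1) g f bE bg bf; rewrite mulN1r addrC => <-.
by congr (I (cut E _)); apply/funext => x; rewrite mulN1r addrC.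
Qed.

Lemma locfun_cut_sum K (s : seq K) (F : K -> T -> R[i]) : (forall k, bmeas (F k)) ->
  I (cut E (fun x => \sum_(k <- s) F k x)) = \sum_(k <- s) I (cut E (F k)).
Proof.
move=> bF; elim: s => [|k s IH].
  rewrite big_nil -[RHS]locfun_cut0.
  by congr (I (cut E _)); apply/funext => x; rewrite big_nil.
rewrite big_cons -IH -locfun_cutD//; last exact: bmeas_sum.
by congr (I (cut E _)); apply/funext => x; rewrite big_cons.
Qed.

End linear.
End local_functionals.

(** * Uniform continuity and Fubini's theorem *)

Section uniform_continuity.
Context (R : realType) (G : topologicalZmodType) (hG : hausdorff_space G).
Implicit Types (f g : G -> R[i]) (E F K U : set G).

Definition buc f :=
  (exists M : R, forall x, cabs (f x) <= M) /\
  forall e : R, 0 < e -> exists U, nbhs (0 : G) U /\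
    forall x y, U (y - x) -> cabs (f x - f y) < e.

(** Uniform continuity in each variable, uniformly in the other one: enough for partial integrals to
    be uniformly continuous and for approximation by finite sums of products. *)
Definition buc2 (Phi : G -> G -> R[i]) :=
  (exists M : R, forall s t, cabs (Phi s t) <= M) /\
  forall e : R, 0 < e -> exists U, nbhs (0 : G) U /\
    (forall s s' t, U (s' - s) -> cabs (Phi s t - Phi s' t) < e) /\
    (forall s t t', U (t' - t) -> cabs (Phi s t - Phi s t') < e).

Lemma nbhs0_sub U (x : G) : nbhs (0 : G) U -> \forall y \near x, U (y - x).
Proof.
move=> U0; have : (fun y : G => y - x) y @[y --> x] --> (0 : G).
  rewrite -[0](subrr x).
  apply: (@continuous_comp _ _ _ (fun y => (y, x)) (fun z : G * G => z.1 - z.2)).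
    by apply: cvg_pair => /=; [exact: cvg_id|exact: cvg_cst].
  exact: sub_continuous.
exact.
Qed.

Lemma nbhs0N U : nbhs (0 : G) U -> nbhs (0 : G) [set x | U (- x)].
Proof.
move=> U0; have := @opp_continuous G 0; rewrite /continuous_at oppr0; exact.
Qed.

Lemma buc_cont f : buc f -> continuous f.
Proof.
move=> [_ uf]; apply/contCP => x e /uf[U [/(nbhs0_sub x) + H]].
by apply: filterS => y; exact: H.
Qed.

Lemma buc_bmeas f : buc f -> bmeas f.
Proof. by move=> bf; have [[M fM] _] := bf; apply: cont_bmeas fM; exact: buc_cont. Qed.

Lemma Cc_buc f : Cc f -> buc f.
Proof.
move=> [cf cK]; set K := closure _ in cK.
have f0 x : ~ K x -> f x = 0.
  by move=> Kx; apply/eqP/negPn/negP => /(@subset_closure _ [set x | f x != 0]).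
split.
  have cg : continuous (fun x => cabs (f x)) by exact: cont_cabs.
  have : compact ((fun x => cabs (f x)) @` K).
    by apply: continuous_compact => //; exact: continuous_subspaceT.
  move=> /compact_bounded[M [_ HM]].
  exists (Num.max (M + 1) 0) => x; have [Kx|/f0 ->] := pselect (K x).
    rewrite le_max -(ger0_norm (cabs_ge0 _)); apply/orP; left.
    by apply: (HM (M + 1)); [rewrite ltrDl|exists x].
  by rewrite cabs0 le_max lexx orbT.
move=> e e0; have nc := (compact_near_coveringP K).1 cK.
have : \forall u \near (0 : G), K `<=` (fun x => cabs (f x - f (x + u)) < e).
  apply: nc => x Kx; have e2 : 0 < e / 2 by rewrite divr_gt0.
  have /contCP cf' := cf.
  have h1 := cf' x _ e2.
  have h2 : \forall z \near (x, 0 : G), cabs (f x - f (z.1 + z.2)) < e / 2.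
    have := @add_continuous G (x, 0); rewrite /continuous_at /= addr0.
    by move=> /(_ _ (cf' x _ e2)).
  case: h2 => -[A B] /= [xA u0B] AB.
  exists (A `&` [set y | cabs (f x - f y) < e / 2], B) => /=.
    by split=> //; apply: filterI.
  move=> [y u] /= [[Ay fy] Bu].
  rewrite (le_lt_trans (cabs_tri (f x) _ _))// (splitr e) ltrD//.
    by rewrite cabsC.
  exact: (AB (y, u)).
set U := [set u | K `<=` (fun x => cabs (f x - f (x + u)) < e)] => HU.
(* [U] controls increments that start in the support; its symmetrisation also covers the case where
   only [y] lies in the support. *)
exists (U `&` [set x | U (- x)]); split; first by apply: filterI => //; exact: nbhs0N.
move=> x y [/= u1 u2]; have [Kx|Kx] := pselect (K x).
  by have := u1 x Kx; rewrite (addrC x) subrK.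
have [Ky|Ky] := pselect (K y); last by rewrite !f0// subrr cabs0.
by have := u2 y Ky; rewrite opprB (addrC y) subrK cabsC.
Qed.

Lemma character_buc chi : is_character (chi : G -> R[i]) -> buc chi.
Proof.
move=> [cc cD c1]; have c0 : chi 0 = 1.
  have : chi 0 != 0 by rewrite -normr_eq0 c1 oner_eq0.
  by move=> /mulfI; apply; rewrite -cD addr0 mulr1.
have ca x : cabs (chi x) = 1 by rewrite /cabs c1.
split; first by exists 1 => x; rewrite ca.
move=> e e0; exists [set u | cabs (chi 0 - chi u) < e]; split.
  by move/contCP : cc => /(_ 0 e e0).
move=> x y /=; rewrite c0 => h.
have -> : chi x - chi y = chi x * (1 - chi (y - x)).
  by rewrite mulrBr mulr1 -cD (addrC x) subrK.
by rewrite cabsM ca mul1r.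
Qed.

Lemma buc_cst c : buc (fun=> c).
Proof.
split; first by exists (cabs c).
by move=> e e0; exists setT; split; [exact: filterT|move=> x y _; rewrite subrr cabs0].
Qed.

Lemma buc2D Phi Psi : buc2 Phi -> buc2 Psi -> buc2 (fun s t => Phi s t + Psi s t).
Proof.
move=> [[M PM] uP] [[N QN] uQ]; split.
  by exists (M + N) => s t; rewrite (le_trans (cabsD _ _))// lerD.
move=> e e0; have e2 : 0 < e / 2 by rewrite divr_gt0.
have [U [U0 [U1 U2]]] := uP _ e2; have [V [V0 [V1 V2]]] := uQ _ e2.
have h (a b c d : R[i]) : cabs (a - c) < e / 2 -> cabs (b - d) < e / 2 ->
    cabs (a + b - (c + d)) < e.
  by move=> h1 h2; rewrite opprD addrACA (le_lt_trans (cabsD _ _))// (splitr e) ltrD.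
exists (U `&` V); split; [exact: filterI|split].
  by move=> s s' t [/U1-/(_ t) ? /V1-/(_ t) ?]; exact: h.
by move=> s t t' [/(U2 s) ? /(V2 s) ?]; exact: h.
Qed.

Lemma buc2M Phi Psi : buc2 Phi -> buc2 Psi -> buc2 (fun s t => Phi s t * Psi s t).
Proof.
move=> [[M PM] uP] [[N QN] uQ].
have M0 : 0 <= M by rewrite (le_trans _ (PM 0 0))// cabs_ge0.
have N0 : 0 <= N by rewrite (le_trans _ (QN 0 0))// cabs_ge0.
split.
  by exists (M * N) => s t; rewrite cabsM ler_pM// cabs_ge0.
move=> e e0; have e2 : 0 < e / (M + N + 1) by rewrite divr_gt0// ltr_wpDl// addr_ge0.
have [U [U0 [U1 U2]]] := uP _ e2; have [V [V0 [V1 V2]]] := uQ _ e2.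
have h (a b c d : R[i]) : cabs b <= N -> cabs c <= M ->
    cabs (a - c) < e / (M + N + 1) -> cabs (b - d) < e / (M + N + 1) ->
    cabs (a * b - (c * d)) < e.
  move=> bN cM h1 h2.
  have -> : a * b - c * d = (a - c) * b + c * (b - d) by ring.
  apply: (le_lt_trans (cabsD _ _)); rewrite !cabsM.
  have : cabs (a - c) * cabs b <= e / (M + N + 1) * N.
    by apply: ler_pM => //; [exact: cabs_ge0|exact: cabs_ge0|exact: ltW].
  have : cabs c * cabs (b - d) <= M * (e / (M + N + 1)).
    by apply: ler_pM => //; [exact: cabs_ge0|exact: cabs_ge0|exact: ltW].
  have : e / (M + N + 1) * (M + N + 1) = e.
    by rewrite divfK// gt_eqF// ltr_wpDl// addr_ge0.
  by move: (e / _) e2 => x; lra.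
exists (U `&` V); split; [exact: filterI|split].
  by move=> s s' t [/U1-/(_ t) ? /V1-/(_ t) ?]; exact: h.
by move=> s t t' [/(U2 s) ? /(V2 s) ?]; exact: h.
Qed.

Lemma buc2_fst f : buc f -> buc2 (fun s _ => f s).
Proof.
move=> [[M fM] uf]; split; first by exists M.
move=> e e0; have [U [U0 HU]] := uf e e0; exists U; split=> //; split.
  by move=> s s' _; exact: HU.
by move=> s t t' _; rewrite subrr cabs0.
Qed.
Lemma buc2_swap Phi : buc2 Phi -> buc2 (fun s t => Phi t s).
Proof.
move=> [[M PM] uP]; split; first by exists M.
by move=> e /uP[U [U0 [U1 U2]]]; exists U; split=> //; split=> s t t'; [exact: U2|exact: U1].
Qed.
Lemma buc2_snd f : buc f -> buc2 (fun _ t => f t).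
Proof. by move=> /buc2_fst/buc2_swap. Qed.
Lemma buc2_diag Phi : buc2 Phi -> buc (fun s => Phi s s).
Proof.
move=> [[M PM] uP]; split; first by exists M.
move=> e e0; have e2 : 0 < e / 2 by rewrite divr_gt0.
have [U [U0 [U1 U2]]] := uP _ e2; exists U; split=> // x y Uxy.
rewrite (le_lt_trans (cabs_tri (Phi x y) _ _))// (splitr e) ltrD//.
  exact: U2.
exact: U1.
Qed.
Lemma buc2_l Phi t : buc2 Phi -> buc (fun s => Phi s t).
Proof.
move=> [[M PM] uP]; split; first by exists M.
by move=> e /uP[U [U0 [U1 _]]]; exists U; split=> // x y /U1.
Qed.
Lemma buc2_r Phi s : buc2 Phi -> buc (Phi s).
Proof. by move=> /buc2_swap /(buc2_l s). Qed.
Lemma buc2_add f : buc f -> buc2 (fun s t => f (s + t)).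
Proof.
move=> [[M fM] uf]; split; first by exists M.
move=> e /uf[U [U0 HU]]; exists U; split=> //; split=> [s s' t|s t t'] h.
  by apply: HU; rewrite opprD addrACA subrr addr0.
by apply: HU; rewrite opprD addrACA subrr add0r.
Qed.
Lemma buc2_sub f : buc f -> buc2 (fun s t => f (s - t)).
Proof.
move=> [[M fM] uf]; split; first by exists M.
move=> e /uf[U [U0 HU]]; exists (U `&` [set x | U (- x)]).
split; first by apply: filterI => //; exact: nbhs0N.
split=> [s s' t|s t t'] [h h']; apply: HU.
  by rewrite opprB addrA subrK.
by rewrite opprB addrC addrA subrK; rewrite /= opprB in h'.
Qed.
Lemma bucD f g : buc f -> buc g -> buc (fun x => f x + g x).
Proof. by move=> /buc2_fst bf /buc2_fst bg; exact: (buc2_diag (buc2D bf bg)). Qed.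
Lemma bucM f g : buc f -> buc g -> buc (fun x => f x * g x).
Proof. by move=> /buc2_fst bf /buc2_fst bg; exact: (buc2_diag (buc2M bf bg)). Qed.
Lemma bucZ c f : buc f -> buc (fun x => c * f x).
Proof. by move=> bf; apply: bucM => //; exact: buc_cst. Qed.
Lemma bucB f g : buc f -> buc g -> buc (fun x => f x - g x).
Proof.
move=> bf /(bucZ (-1)) /(bucD bf).
by under eq_fun do rewrite mulN1r.
Qed.
Lemma bucJ f : buc f -> buc (fun x => (f x)^*%C).
Proof.
move=> [[M fM] uf]; split; first by exists M => x; rewrite cabsJ.
by move=> e /uf[U [U0 HU]]; exists U; split=> // x y /HU; rewrite -rmorphB/= cabsJ.
Qed.
Lemma bucN f : buc f -> buc (fun x => f (- x)).
Proof.
move=> /buc2_sub /(buc2_r 0).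
by under eq_fun do rewrite sub0r.
Qed.
Lemma buc_cabs f : buc f -> buc (fun x => (cabs (f x))%:C%C).
Proof.
move=> [[M fM] uf]; split.
  by exists M => x; rewrite cabsR ger0_norm ?cabs_ge0.
move=> e /uf[U [U0 HU]]; exists U; split=> // x y /HU.
by rewrite -rmorphB/= cabsR; apply: le_lt_trans; exact: cabs_dist.
Qed.
Lemma buc_sum I (s : seq I) (F : I -> G -> R[i]) : (forall i, buc (F i)) ->
  buc (fun x => \sum_(i <- s) F i x).
Proof.
move=> bF; elim: s => [|i s IH].
  by under eq_fun do rewrite big_nil; exact: buc_cst.
by under eq_fun do rewrite big_cons; exact: bucD.
Qed.

Lemma buc_locfun J Phi E : locfun J -> buc2 Phi -> bounded_borel E ->
  buc (fun s => J (cut E (Phi s))).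
Proof.
move=> hJ bP bE; have [[M PM] uP] := bP.
have M0 : 0 <= M by rewrite (le_trans _ (PM 0 0))// cabs_ge0.
have [C [C0 HC]] := hJ.2 E bE.
have bm s : bmeas (Phi s) by apply: buc_bmeas; exact: buc2_r.
split; first by exists (C * M) => s; apply: HC.
move=> e e0; have e2 : 0 < e / (C + 1) by rewrite divr_gt0// ltr_wpDl.
have [U [U0 [U1 _]]] := uP _ e2; exists U; split=> // x y Uxy.
rewrite -(locfun_cutB hJ bE)//.
have : cabs (J (cut E (fun t => Phi x t - Phi y t))) <= C * (e / (C + 1)).
  apply: HC; [exact: bmeasB|exact: ltW|].
  by move=> t _; apply/ltW; exact: U1.
move=> /le_lt_trans; apply.
by rewrite mulrCA gtr_pMr// ltr_pdivrMr ?mul1r ?ltrDl// ltr_wpDl.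
Qed.

Section fubini.
Context (I J : (G -> R[i]) -> R[i]) (hI : locfun I) (hJ : locfun J).

Let tens (L : seq ((G -> R[i]) * (G -> R[i]))) s t := \sum_(p <- L) p.1 s * p.2 t.

Lemma tensor_fubini E E' (L : seq ((G -> R[i]) * (G -> R[i]))) :
  bounded_borel E -> bounded_borel E' ->
  {in L, forall p, bmeas p.1 /\ bmeas p.2} ->
  [/\ bmeas (fun s => J (cut E' (tens L s))), bmeas (fun t => I (cut E (tens L ^~ t))),
   forall s, bmeas (tens L s), forall t, bmeas (tens L ^~ t) &
  I (cut E (fun s => J (cut E' (tens L s)))) =
  J (cut E' (fun t => I (cut E (tens L ^~ t))))].
Proof.
move=> bE bE'; rewrite /tens; elim: L => [|p L IH] bL.
  have z (h : G -> G -> R[i]) : (fun x => \sum_(p <- [::]) h x x) = fun=> 0.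
    by apply/funext => x; rewrite big_nil.
  have zJ : (fun s : G => J (cut E' (fun t =>
      \sum_(p <- ([::] : seq ((G -> R[i]) * (G -> R[i])))) p.1 s * p.2 t))) = fun=> 0.
    apply/funext => s; rewrite -[RHS](locfun_cut0 hJ bE').
    by congr (J (cut E' _)); apply/funext => t; rewrite big_nil.
  have zI : (fun t : G => I (cut E (fun s =>
      \sum_(p <- ([::] : seq ((G -> R[i]) * (G -> R[i])))) p.1 s * p.2 t))) = fun=> 0.
    apply/funext => s; rewrite -[RHS](locfun_cut0 hI bE).
    by congr (I (cut E _)); apply/funext => t; rewrite big_nil.
  rewrite zI zJ; split; try exact: bmeas_cst.
  - by move=> s; under eq_fun do rewrite big_nil; exact: bmeas_cst.
  - by move=> s; under eq_fun do rewrite big_nil; exact: bmeas_cst.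
  - by rewrite (locfun_cut0 hI bE) (locfun_cut0 hJ bE').
have [q qL|B1 B2 B3 B4 B5] := IH _; first by apply: bL; rewrite inE qL orbT.
have [bp1 bp2] := bL p (mem_head _ _).
have eJ : (fun s : G => J (cut E' (fun t => \sum_(q <- p :: L) q.1 s * q.2 t))) =
    fun s => J (cut E' p.2) * p.1 s + J (cut E' (fun t => \sum_(q <- L) q.1 s * q.2 t)).
  apply/funext => s; rewrite mulrC -hJ.1//.
  by congr (J (cut E' _)); apply/funext => t; rewrite big_cons.
have eI : (fun t : G => I (cut E (fun s => \sum_(q <- p :: L) q.1 s * q.2 t))) =
    fun t => I (cut E p.1) * p.2 t + I (cut E (fun s => \sum_(q <- L) q.1 s * q.2 t)).
  apply/funext => t; rewrite mulrC -hI.1//.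
  by congr (I (cut E _)); apply/funext => s; rewrite big_cons mulrC.
rewrite eJ eI; split.
- by apply: bmeasD => //; exact: bmeasZ.
- by apply: bmeasD => //; exact: bmeasZ.
- by move=> s; under eq_fun do rewrite big_cons; apply: bmeasD => //; exact: bmeasZ.
- move=> t; under eq_fun do rewrite big_cons mulrC.
  by apply: bmeasD => //; exact: bmeasZ.
- by rewrite hI.1// hJ.1// B5 mulrC.
Qed.

(** [E] is cut into disjoint Borel pieces, each inside one translate [s0 + U]; on such a piece
    [Phi s] is replaced by [Phi s0], which gives the product of an indicator in [s] and a function
    of [t]. *)
Lemma tensor_approx Phi E U e (l : seq G) : buc2 Phi -> open U ->
    (forall s s' t, U (s' - s) -> cabs (Phi s t - Phi s' t) < e) -> 0 < e ->
    measurable (E : set (borel G)) ->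
    (forall x, E x -> exists2 s, s \in l & U (x - s)) ->
  exists L, [/\ {in L, forall p, bmeas p.1 /\ bmeas p.2},
    forall s t, ~ E s -> tens L s t = 0 &
    forall s t, E s -> cabs (Phi s t - tens L s t) < e].
Proof.
move=> bP oU HU e0; elim: l E => [|s0 l IH] E mE El.
  exists [::]; split=> [//|s t|s t /El[//]].
  by rewrite /tens big_nil.
pose A := E `&` [set x | U (x - s0)].
have mU : measurable ([set x | U (x - s0)] : set (borel G)).
  apply: open_borel; apply: (@open_comp _ _ (fun x => x - s0)) => // x _.
  apply: (@continuous_comp _ _ _ (fun y => (y, s0)) (fun z : G * G => z.1 - z.2)).
    by apply: cvg_pair => /=; [exact: cvg_id|exact: cvg_cst].
  exact: sub_continuous.
have mA : measurable (A : set (borel G)) by exact: measurableI.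
have [|x [Ex nA]|L [L1 L2 L3]] := IH (E `\` A); first exact: measurableD.
  have [s] := El x Ex; rewrite inE => /orP[/eqP ->|sl] Us; last by exists s.
  by exfalso; apply: nA.
exists ((cut A (fun=> 1), Phi s0) :: L); split.
- move=> p; rewrite inE => /orP[/eqP -> /=|/L1//]; split.
    by apply: bmeas_cut => //; exact: bmeas_cst.
  by apply: buc_bmeas; exact: buc2_r.
- move=> s t nE; rewrite /tens big_cons /= cut_out ?mul0r ?add0r; last by case.
  by apply: L2; case.
- move=> s t Es; rewrite /tens big_cons /=; have [As|As] := pselect (A s).
    have := L2 s t; rewrite /tens => -> //; last by case.
    by rewrite cut_in// mul1r addr0 cabsC; apply: HU; case: As.
  by rewrite cut_out// mul0r add0r; exact: L3.
Qed.

(* [G] need not be second countable, so the Borel sets of [G * G] are not those of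
   the product sigma-algebra; instead [Phi] is approximated uniformly by finite
   sums of products. *)
Lemma fubini Phi E E' : buc2 Phi -> bounded_borel E -> bounded_borel E' ->
  I (cut E (fun s => J (cut E' (Phi s)))) =
  J (cut E' (fun t => I (cut E (Phi ^~ t)))).
Proof.
move=> bP bE bE'; apply/eqP; rewrite -subr_eq0; apply/eqP/cabs_eq0/eqP.
rewrite eq_le cabs_ge0 andbT; apply/ler_addgt0Pr => d d0; rewrite add0r.
have [C [C0 HC]] := hI.2 E bE; have [D [D0 HD]] := hJ.2 E' bE'.
(* Passing to the sum of products costs [C * D * e] in each of the two iterated integrals; the added
   1 covers the case where [C * D] is 0. *)
have e0 : 0 < d / (2 * C * D + 1).
  by rewrite divr_gt0// ltr_wpDl// !mulr_ge0.
have [V [V0 [V1 V2]]] := bP.2 _ e0.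
have [U [oU U0] UV] : exists2 U : set G, open_nbhs 0 U & U `<=` V.
  by move: V0; rewrite nbhsE.
have [l Hl] : exists l : seq G, forall x, E x -> exists2 s, s \in l & U (x - s).
  have [_ pE] := bE; have [K EK [cK _]] := pE.
  move: cK; rewrite compact_cover => cK.
  case: (cK G setT (fun s => [set x | U (x - s)])).
  - move=> s _; apply: (@open_comp _ _ (fun x => x - s)) => // x _.
    apply: (@continuous_comp _ _ _ (fun y => (y, s)) (fun z : G * G => z.1 - z.2)).
      by apply: cvg_pair => /=; [exact: cvg_id|exact: cvg_cst].
    exact: sub_continuous.
  - by move=> x _; exists x => //=; rewrite subrr.
  move=> l _ Kl; exists (finmap.enum_fset l) => x Ex.
  by have [s /= sl Us] := Kl x (EK _ Ex); exists s.
have [mE _] := bE.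
have [L [L1 L2 L3]] := tensor_approx bP oU (fun s s' t h => V1 s s' t (UV _ h)) e0 mE Hl.
have [T1 T2 T3 T4 T5] := tensor_fubini bE bE' L1.
have bJ : bmeas (fun s => J (cut E' (Phi s))) by apply: buc_bmeas; exact: buc_locfun.
have bP1 s : bmeas (Phi s) by apply: buc_bmeas; exact: buc2_r.
have bP2 t : bmeas (Phi ^~ t) by apply: buc_bmeas; exact: buc2_l.
have : d / (2 * C * D + 1) * (2 * C * D + 1) = d.
  by rewrite divfK// gt_eqF// ltr_wpDl// !mulr_ge0.
move: (d / _) e0 L3 => e e0 L3 ed {V1 V2}.
have hl : cabs (I (cut E (fun s => J (cut E' (Phi s)))) -
    I (cut E (fun s => J (cut E' (tens L s))))) <= C * (D * e).
  rewrite -locfun_cutB//; apply: HC; [exact: bmeasB|by rewrite mulr_ge0// ltW|].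
  move=> s Es; rewrite -locfun_cutB//; apply: HD; [exact: bmeasB|exact: ltW|].
  by move=> t _; apply/ltW; exact: L3.
have bI : bmeas (fun t => I (cut E (Phi ^~ t))).
  by apply: buc_bmeas; apply: (buc_locfun hI (buc2_swap bP)).
have hr : cabs (J (cut E' (fun t => I (cut E (tens L ^~ t)))) -
    J (cut E' (fun t => I (cut E (Phi ^~ t))))) <= D * (C * e).
  rewrite -locfun_cutB//; apply: HD; [exact: bmeasB|by rewrite mulr_ge0// ltW|].
  move=> t Et; rewrite -locfun_cutB//; apply: HC; [exact: bmeasB|exact: ltW|].
  by move=> s Es; rewrite cabsC; apply/ltW; exact: L3.
rewrite (le_trans (cabs_tri (I (cut E (fun s => J (cut E' (tens L s))))) _ _))//.
rewrite {2}T5 (le_trans (lerD hl hr))//.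
by rewrite -ed; lra.
Qed.
End fubini.
End uniform_continuity.

(** * Haar measure and translation bounded measures *)

Section translations.
Context (R : realType) (G : topologicalZmodType) (hG : hausdorff_space G).
Implicit Types (A B E K U V : set G) (x y t : G).

Lemma addl_cont x : continuous (fun y : G => x + y).
Proof.
move=> y; apply: (@continuous_comp _ _ _ (fun y => (x, y)) (fun z : G * G => z.1 + z.2)).
  by apply: cvg_pair => /=; [exact: cvg_cst|exact: cvg_id].
exact: add_continuous.
Qed.

Lemma translateE x A : translate x A = (fun y => - x + y) @^-1` A.
Proof.
apply/seteqP; split=> [_ [y Ay <-] /=|y /= Ay]; first by rewrite addKr.
by exists (- x + y) => //; rewrite addNKr.
Qed.

Lemma translate_preimage x A : +%R x @^-1` A = translate (- x) A.
Proof. by rewrite translateE opprK. Qed.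

Lemma translateD x y A : translate x (translate y A) = translate (x + y) A.
Proof. by rewrite !translateE; apply/funext => z /=; rewrite opprD addrA [- y + _]addrC. Qed.
Lemma translate0 A : translate 0 A = A.
Proof. by rewrite translateE; apply/funext => z /=; rewrite oppr0 add0r. Qed.
Lemma translateS x A B : A `<=` B -> translate x A `<=` translate x B.
Proof. by rewrite !translateE => AB y; exact: AB. Qed.
Lemma translateC x A : translate x (~` A) = ~` translate x A.
Proof. by rewrite !translateE. Qed.
Lemma translateU x A B : translate x (A `|` B) = translate x A `|` translate x B.
Proof. by rewrite !translateE. Qed.
Lemma translateI x A B : translate x (A `&` B) = translate x A `&` translate x B.
Proof. by rewrite !translateE. Qed.

Lemma translate_open x A : open A -> open (translate x A).
Proof. by rewrite translateE => oA; apply: open_comp => // y _; exact: addl_cont. Qed.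
Lemma translate_closed x A : closed A -> closed (translate x A).
Proof.
move=> cA; rewrite -(setCK A) translateC; apply: open_closedC.
by apply: translate_open; exact: closed_openC.
Qed.
Lemma translate_compact x A : compact A -> compact (translate x A).
Proof.
move=> cA; rewrite /translate; apply: continuous_compact => //.
by apply: continuous_subspaceT; exact: addl_cont.
Qed.
Lemma translate_precompact x A : precompact A -> precompact (translate x A).
Proof.
move=> [K AK [cK clK]]; exists (translate x K); first by move=> y [z Az <-]; exists z => //; exact: AK.
by split; [exact: translate_compact|exact: translate_closed].
Qed.
Lemma translate_closure x A : closure (translate x A) = translate x (closure A).
Proof.
have h y B : closure (translate y B) `<=` translate y (closure B).
  have -> : translate y (closure B) = closure (translate y (closure B)).
    by apply/closure_id; apply: translate_closed; exact: closed_closure.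
  by apply: closureS; apply: translateS; exact: subset_closure.
apply/seteqP; split; first exact: h.
rewrite -[X in _ `<=` X]translate0 -(subrr x) -translateD; apply: translateS.
by apply: subset_trans (h _ _); rewrite translateD addNr translate0.
Qed.
Lemma translate_measurable x A : measurable (A : set (borel G)) ->
  measurable (translate x A : set (borel G)).
Proof.
have h : measurable_fun [set: borel G] (fun y : borel G => (- x + y : borel G)).
  apply: (measurability _ (erefl _ : @measurable _ (borel G) = _)).
  move=> _ [U oU <-]; rewrite setTI -translateE; apply: open_borel.
  exact: translate_open.
by rewrite translateE => mA; rewrite -[X in measurable X]setTI; exact: h.
Qed.
Lemma translate_bounded_borel x A : bounded_borel A -> bounded_borel (translate x A).
Proof. by move=> [mA pA]; split; [exact: translate_measurable|exact: translate_precompact]. Qed.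

Lemma setadd_compact A B : compact A -> compact B -> compact (setadd A B).
Proof.
move=> cA cB; have -> : setadd A B = (fun z : G * G => z.1 + z.2) @` (A `*` B).
  apply/seteqP; split=> [_ [x Ax [y By <-]]|_ [[x y] [/= Ax By] <-]].
    by exists (x, y).
  by exists x => //; exists y.
apply: continuous_compact; last exact: compact_setX.
by apply: continuous_subspaceT => z; exact: add_continuous.
Qed.
Lemma opp_compact A : compact A -> compact (-%R @` A).
Proof.
move=> cA; apply: continuous_compact => //.
by apply: continuous_subspaceT => z; exact: opp_continuous.
Qed.
Lemma setsubE A B : setsub A B = setadd A (-%R @` B).
Proof.
apply/seteqP; split=> [_ [x Ax [y By <-]]|_ [x Ax [_ [y By <-] <-]]].
  by exists x => //; exists (- y) => //; exists y.
by exists x => //; exists y.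
Qed.
Lemma setsub_compact A B : compact A -> compact B -> compact (setsub A B).
Proof. by move=> cA cB; rewrite setsubE; apply: setadd_compact => //; exact: opp_compact. Qed.

End translations.

Section haar.
Context (R : realType) (G : topologicalZmodType) (hG : hausdorff_space G).
Context (theta : radon_measure R G) (haar : is_haar theta).
Implicit Types (f g : G -> R[i]) (A B E F K U : set G).

Lemma haar_integral_translate (h : G -> R) x :
  measurable_fun [set: borel G] (h : borel G -> R) ->
  (\int[theta]_t (h (x + t)%R)%:E = \int[theta]_t (h t)%:E)%E.
Proof.
move=> mh.
have mphi : measurable_fun [set: borel G] (fun y : borel G => (x + y : borel G)).
  move=> _ Y mY; rewrite setTI; have := translate_measurable (- x) mY.
  by rewrite -translate_preimage.
have key (k : borel G -> \bar R) : measurable_fun setT k -> (forall y, 0 <= k y)%E ->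
    (\int[theta]_t (k (x + t)%R) = \int[theta]_t k t)%E.
  move=> mk k0.
  have := @ge0_integral_pushforward _ _ _ _ R _ mphi theta setT k measurableT mk
    (fun y _ => k0 y).
  rewrite preimage_setT => <-; apply: eq_measure_integral => A mA _.
  by have := haar.2 (- x) A mA; rewrite -translate_preimage.
rewrite integralE [RHS]integralE; congr (_ - _)%E.
  rewrite -(key ((fun t => (h t)%:E)^\+)%E)//.
    by apply: eq_integral => t _; rewrite !funeposE.
  by apply: measurable_funepos; exact/measurable_EFinP.
rewrite -(key ((fun t => (h t)%:E)^\-)%E)//.
  by apply: eq_integral => t _; rewrite !funenegE.
by apply: measurable_funeneg; exact/measurable_EFinP.
Qed.

Lemma haar_translate f x : bmeas f ->
  cintegral theta (fun t => f (x + t)) = cintegral theta f.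
Proof.
move=> [fr fi _]; rewrite /cintegral /Rintegral; congr (Complex (fine _) (fine _)).
  by have := haar_integral_translate x fr.
by have := haar_integral_translate x fi.
Qed.

Lemma cintegral_vol E : bounded_borel E ->
  cintegral theta (cut E (fun=> 1)) = (vol theta E)%:C%C.
Proof.
move=> [mE _]; rewrite cintegral_cut /vol !Rintegral_cst//= mul1r mul0r//.
Qed.

Lemma bounded_borel_fin E : bounded_borel E -> theta E \is a fin_num.
Proof. by move=> bE; rewrite ge0_fin_numE//; exact: radon_bounded_fin. Qed.

Lemma vol_ge0 E : 0 <= vol theta E.
Proof. by rewrite /vol fine_ge0. Qed.

Lemma le_vol E F : measurable (E : set (borel G)) -> bounded_borel F -> E `<=` F ->
  vol theta E <= vol theta F.
Proof.
move=> mE bF EF; apply: fine_le; rewrite ?bounded_borel_fin//.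
  exact: bounded_borel_subset EF bF.
by apply: le_measure; rewrite ?inE//; case: bF.
Qed.

Lemma vol_translate x E : measurable (E : set (borel G)) ->
  vol theta (translate x E) = vol theta E.
Proof. by move=> mE; rewrite /vol haar.2. Qed.

Lemma volU E F : bounded_borel E -> bounded_borel F -> E `&` F = set0 ->
  vol theta (E `|` F) = vol theta E + vol theta F.
Proof.
move=> bE bF EF; rewrite /vol measureU//; [|by case: bE|by case: bF].
by rewrite fineD// bounded_borel_fin.
Qed.

Lemma vol_subU E F H : bounded_borel E -> bounded_borel F ->
  measurable (H : set (borel G)) -> H `<=` E `|` F ->
  vol theta H <= vol theta E + vol theta F.
Proof.
move=> bE bF mH HEF; apply: (le_trans (le_vol mH (bounded_borelU bE bF) HEF)).
have [mE _] := bE; have [mF _] := bF.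
have <- : E `|` (F `\` E) = E `|` F.
  apply/seteqP; split=> x [Ex|]; [by left|by case; right|by left|].
  by move=> Fx; have [Ex|Ex] := pselect (E x); [left|right].
have bD : bounded_borel (F `\` E) by apply: bounded_borel_subset bF; [exact: measurableD|exact: subDsetl].
rewrite volU//; last by apply/seteqP; split=> // x [? []].
by rewrite lerD2l le_vol//; exact: measurableD.
Qed.

(** Finitely many translates of [U] cover the relatively compact set [A]; were [U] null, [A] would
    be null too. *)
Lemma haar_pos U A : open U -> U !=set0 -> precompact A -> measurable (A : set (borel G)) ->
  (0 < theta A)%E -> (0 < theta U)%E.
Proof.
move=> oU [u Uu] [K AK [cK clK]] mA A0; rewrite lt_neqAle measure_ge0 andbT.
apply/negP => /eqP U0.
move: cK; rewrite compact_cover => /(_ G setT (fun s => translate (s - u) U)).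
case; first by move=> s _; exact: translate_open.
  by move=> x _; exists x => //; exists u => //; rewrite subrK.
move=> l _ Kl.
have : (theta A <= \sum_(s <- finmap.enum_fset l) theta (translate (s - u)%R U))%E.
  have : forall x, A x -> exists2 s, s \in finmap.enum_fset l & translate (s - u) U x.
    by move=> x /AK /Kl[s sl Us]; exists s.
  elim: (finmap.enum_fset l) A mA {A0 AK} => [|s r IH] A mA Al.
    rewrite big_nil (_ : A = set0) ?measure0//.
    by apply/seteqP; split=> // x /Al[].
  have mU : measurable (translate (s - u) U : set (borel G)).
    by apply: open_borel; exact: translate_open.
  rewrite big_cons; apply: (@le_trans _ _ (theta (translate (s - u)%R U) + theta (A `\` translate (s - u)%R U))%E).
    rewrite (le_trans _ (measureU2 theta _ _))//; last exact: measurableD.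
    apply: le_measure; rewrite ?inE//; first by apply: measurableU => //; exact: measurableD.
    by move=> x Ax; have [?|?] := pselect (translate (s - u) U x); [left|right].
  rewrite leeD2l//; apply: IH; first exact: measurableD.
  move=> x [/Al[t]]; rewrite inE => /orP[/eqP -> //|tr Ut _]; by exists t.
rewrite big1; first by rewrite leNgt A0.
by move=> s _; rewrite haar.2//; exact: open_borel.
Qed.

End haar.

Section haar_positive.
Context (R : realType) (G : topologicalZmodType) (hG : hausdorff_space G).
Context (theta : radon_measure R G) (haar : is_haar theta).

(** Inner regularity on the whole group, whose measure is not 0, supplies a compact set of positive
    measure to compare [U] with. *)
Lemma haar_open_gt0 (U : set G) : open U -> U !=set0 -> (0 < theta U)%E.
Proof.
move=> oU Un0; have [[K [cK K0]]|nK] := pselect (exists K : set G, compact K /\ (0 < theta K)%E).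
  have clK := compact_closed hG cK.
  have pK : precompact K by rewrite precompact_closed.
  apply: (haar_pos haar oU Un0 pK _ K0).
  exact: closed_borel.
exfalso; have /eqP := haar.1; apply; apply/eqP.
have [_ _ /(_ _ openT) ->] := radonP theta.
rewrite eq_le; apply/andP; split.
  apply: ub_ereal_sup => _ [K [cK _ _] <-]; rewrite leNgt; apply/negP => K0.
  by apply: nK; exists K.
apply: ereal_sup_ubound; exists set0; last by rewrite measure0.
by split=> //; exact: compact0.
Qed.

End haar_positive.

(** * Integrals against a complex measure bounded by its total variation *)

Section total_variation_bound.
Context (R : realType) (T : ptopologicalType) (hT : hausdorff_space T).
Context (mu : cmeasure R T).
Implicit Types (E F : set T) (f g : T -> R[i]).

Lemma cm_integral_cut1 E : bounded_borel E ->
  cm_integral mu (cut E (fun=> 1)) = cm_val mu E.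
Proof.
move=> [mE _]; have h (m : radon_measure R T) :
    cintegral m (cut E (fun=> 1)) = (fine (m E))%:C%C.
  by rewrite cintegral_cut !Rintegral_cst//= mul1r mul0r.
rewrite /cm_integral !h /cm_val; apply: complex_eq;
  by rewrite ?cReD ?cImD ?cReN ?cImN ?cReM ?cImM /= ?cReD ?cImD ?cReN ?cImN/=; ring.
Qed.

Lemma bmeas_Re f : bmeas f -> bmeas (fun x => (complex.Re (f x))%:C%C).
Proof.
move=> [fr fi [M fM]]; split=> //=; exists M => x.
by rewrite cabsR (le_trans (Re_cabs _)).
Qed.
Lemma bmeas_Im f : bmeas f -> bmeas (fun x => (complex.Im (f x))%:C%C).
Proof.
move=> [fr fi [M fM]]; split=> //=; exists M => x.
by rewrite cabsR (le_trans (Im_cabs _)).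
Qed.

(** Finite partitions bound the integral of a simple function directly. The real part is sliced into
    levels of height [e], and the local bound [C] of the functional absorbs the slicing error
    [C * e]. *)
Lemma total_variation_Re E f (S M : R) : bounded_borel E -> bmeas f -> 0 <= M ->
  (forall x, E x -> cabs (f x) <= M) -> (Defs.total_variation mu E <= S%:E)%E ->
  cabs (cm_integral mu (cut E (fun x => (complex.Re (f x))%:C%C))) <= M * S.
Proof.
move=> bE bf M0 fM hS; have [mE _] := bE.
have [C [C0 HC]] := (locfun_cm hT mu).2 E bE.
have I := locfun_cm hT mu.
apply/ler_addgt0Pr => d d0.
have e0 : 0 < d / (C + 1) by rewrite divr_gt0// ltr_wpDl.
have : d / (C + 1) * (C + 1) = d by rewrite divfK// gt_eqF// ltr_wpDl.
move: (d / _) e0 => e e0 ed.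
(* The half-open slices of height [e] above [- M] have to contain the value [M] itself, hence the
   successor. *)
pose n := (Num.truncn (2 * M / e)).+1.
pose c (i : 'I_n) : R := i%:R * e - M.
pose h (x : T) := complex.Re (f x).
pose F (i : 'I_n) := E `&` [set x | c i <= h x < c i + e].
have hM x : E x -> `|h x| <= M by move=> Ex; rewrite (le_trans (Re_cabs _))// fM.
have mF i : measurable (F i : set (borel T)).
  have [fr _ _] := bf.
  have := fr measurableT _ (measurable_itv `[c i, c i + e[); rewrite setTI => mi.
  by apply: measurableI.
have bF i : bounded_borel (F i).
  by apply: bounded_borel_subset bE => //; exact: subIsetl.
have Fu i j x : F i x -> F j x -> i = j.
  move=> [_ /andP[i1 i2]] [_ /andP[j1 j2]].
  have hh (k l : 'I_n) : c k <= h x -> h x < c l + e -> (k <= l)%N.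
    move=> ck cl; have : k%:R * e < (l%:R + 1) * e.
      by have := le_lt_trans ck cl; rewrite /c; lra.
    by rewrite ltr_pM2r// natr1 ltr_nat ltnS.
  by apply: val_inj; apply/eqP; rewrite eqn_leq !hh.
have FE x : E x -> exists i, F i x.
  move=> Ex; have := hM x Ex; rewrite ler_norml => /andP[h1 h2].
  have q0 : 0 <= (h x + M) / e by rewrite divr_ge0 ?(ltW e0)//; lra.
  have /andP[k1 k2] := Num.Theory.truncn_itv q0.
  have kn : (Num.truncn ((h x + M) / e) < n)%N.
    by rewrite ltnS Num.Theory.le_truncn// ler_pM2r ?invr_gt0//; lra.
  exists (Ordinal kn); split=> //=; rewrite /c /=.
  move: k1 k2; move: (Num.truncn _) => k; rewrite ler_pdivlMr// ltr_pdivrMr// -natr1 mulrDl mul1r => k1 k2.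
  by apply/andP; split; lra.
have cM i : `|c i| <= M.
  rewrite ler_norml /c; have i0 : 0 <= i%:R * e by rewrite mulr_ge0 ?(ltW e0).
  have : (i <= Num.truncn (2 * M / e))%N by rewrite -ltnS.
  rewrite Num.Theory.truncn_ge_nat; last by rewrite divr_ge0 ?(ltW e0)// mulr_ge0.
  by rewrite ler_pdivlMr// => ?; apply/andP; split; lra.
pose psi x := \sum_(i < n) (c i)%:C%C * cut (F i) (fun=> 1) x.
have b1 i : bmeas (fun x => (c i)%:C%C * cut (F i) (fun=> 1) x).
  by apply: bmeasZ; apply: bmeas_cut => //; exact: bmeas_cst.
have bpsi : bmeas psi by exact: bmeas_sum.
have psiE x : E x -> cabs ((h x)%:C%C - psi x) <= e.
  move=> Ex; have [i Fi] := FE x Ex.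
  rewrite /psi (bigD1 i)//= cut_in// mulr1 big1 ?addr0; last first.
    move=> j ji; rewrite cut_out ?mulr0// => Fj.
    by move: ji; rewrite (Fu _ _ _ Fi Fj) eqxx.
  rewrite -rmorphB /= cabsR; case: Fi => _ /andP[? ?].
  by rewrite ger0_norm; lra.
have h1 : cabs (cm_integral mu (cut E (fun x => (h x)%:C%C)) -
    cm_integral mu (cut E psi)) <= C * e.
  rewrite -(locfun_cutB I bE)//; last exact: bmeas_Re.
  apply: HC; [|exact: ltW|exact: psiE].
  by apply: bmeasB => //; exact: bmeas_Re.
have h2 : cm_integral mu (cut E psi) = \sum_(i < n) (c i)%:C%C * cm_val mu (F i).
  rewrite (locfun_cut_sum I bE)//; apply: eq_bigr => i _.
  rewrite (locfun_cutZ I bE); last by apply: bmeas_cut => //; exact: bmeas_cst.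
  by rewrite -cut_cut ?cm_integral_cut1//; exact: subIsetl.
have h3 : \sum_(i < n) cabs (cm_val mu (F i)) <= S.
  rewrite -lee_fin; apply: le_trans hS; apply: ereal_sup_ubound.
  exists n, F; split=> //.
    by move=> i j _ _ [x [Fi Fj]]; exact: Fu Fi Fj.
  by apply/seteqP; split=> [x [i _ []]//|x /FE[i Fi]]; exists i.
rewrite -[X in cabs X](subrK (cm_integral mu (cut E psi))).
rewrite (le_trans (cabsD _ _))// addrC lerD//.
  rewrite h2 (le_trans (cabs_sum _ _))//.
  rewrite (@le_trans _ _ (M * \sum_(i < n) cabs (cm_val mu (F i))))//.
    by rewrite mulr_sumr; apply: ler_sum => i _; rewrite cabsM cabsR ler_wpM2r ?cabs_ge0.
  by rewrite ler_wpM2l.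
by rewrite (le_trans h1)// -ed; nra.
Qed.

Lemma total_variation_bound E f (S M : R) : bounded_borel E -> bmeas f -> 0 <= M ->
  (forall x, E x -> cabs (f x) <= M) -> (Defs.total_variation mu E <= S%:E)%E ->
  cabs (cm_integral mu (cut E f)) <= 2 * (M * S).
Proof.
move=> bE bf M0 fM hS; have I := locfun_cm hT mu.
have -> : cut E f = cut E (fun x => 'i%C * (complex.Im (f x))%:C%C + (complex.Re (f x))%:C%C).
  by congr cut; apply/funext => x; rewrite addrC -complexE.
rewrite I.1//; [|exact: bmeas_Im|exact: bmeas_Re].
rewrite (le_trans (cabsD _ _))// mulr2n mulrDl mul1r lerD//.
  have -> : (fun x => (complex.Im (f x))%:C%C) = (fun x => (complex.Re (- 'i%C * f x))%:C%C).
    by apply/funext => x; rewrite cReM /=; congr (_%:C%C); ring.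
  rewrite cabsM (_ : cabs 'i%C = 1); last first.
    by rewrite /cabs normc_def /= expr0n /= add0r expr1n sqrtr1.
  rewrite mul1r; apply: total_variation_Re => //; first exact: bmeasZ.
  move=> x Ex; rewrite cabsM cabsN /cabs normc_def /= expr0n /= add0r expr1n sqrtr1 mul1r.
  exact: fM.
exact: total_variation_Re.
Qed.

End total_variation_bound.

(** * Mass of a translation bounded measure compared with Haar measure *)

Section translation_bounded_measures.
Context (R : realType) (G : topologicalZmodType) (hG : hausdorff_space G).
Context (theta : radon_measure R G) (haar : is_haar theta).
Context (mu : cmeasure R G) (mu_tb : translation_bounded mu).
Implicit Types (f g : G -> R[i]) (A B E F K U V W : set G).

Lemma vol_gt0 U : open U -> U !=set0 -> precompact U -> 0 < vol theta U.
Proof.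
move=> oU Un0 pU; rewrite /vol fine_gt0// (haar_open_gt0 hG haar)//=.
by apply: radon_bounded_fin => //; split=> //; exact: open_borel.
Qed.

(** One translate at a time takes its share [g1] of [g], and the remainder [g2] vanishes there. Each
    share costs at most [2 * (M * S)], however much the translates overlap. *)
Lemma cover_bound V (S M : R) (l : seq G) g : open V -> precompact V ->
  (forall t, (Defs.total_variation mu (translate t V) <= S%:E)%E) ->
  bmeas g -> 0 <= M -> (forall x, cabs (g x) <= M) ->
  (forall x, g x <> 0 -> exists2 y, y \in l & translate y V x) ->
  cabs (cm_integral mu g) <= (size l)%:R * (2 * (M * S)).
Proof.
move=> oV pV hS; have I := locfun_cm hG mu.
have bV t : bounded_borel (translate t V).
  by split; [apply: open_borel; exact: translate_open|exact: translate_precompact].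
move=> bg M0; elim: l g bg => [|y l IH] g bg gM gl.
  rewrite mul0r (_ : g = cut set0 (fun=> 0)).
    by rewrite (locfun_cut0 I) ?cabs0//; apply: bounded_borel_compact => //; exact: compact0.
  apply/funext => x; rewrite cut_out//.
  by apply/eqP/negPn/negP => /eqP /gl[].
pose B := \big[setU/set0]_(t <- y :: l) translate t V.
have BP x t : t \in y :: l -> translate t V x -> B x.
  rewrite /B; elim: (y :: l) => [//|u r IHr]; rewrite inE big_cons => /orP[/eqP ->|tr] Vx.
    by left.
  by right; exact: IHr.
have bB : bounded_borel B.
  rewrite /B; elim: (y :: l) => [|u r IHr]; last by rewrite big_cons; exact: bounded_borelU.
  by rewrite big_nil; apply: bounded_borel_compact => //; exact: compact0.
pose g1 := cut (translate y V) g; pose g2 x := g x - g1 x.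
have b1 : bmeas g1 by apply: bmeas_cut => //; case: (bV y).
have b2 : bmeas g2 by exact: bmeasB.
have s2 x : g2 x <> 0 -> g x <> 0 /\ ~ translate y V x.
  rewrite /g2 /g1 => h; have [Vx|Vx] := pselect (translate y V x).
    by exfalso; apply: h; rewrite cut_in// subrr.
  by split=> // g0; apply: h; rewrite cut_out// g0 subrr.
have -> : g = cut B (fun x => g1 x + g2 x).
  rewrite cut_id; last first.
    move=> x nB; rewrite /g2 addrC subrK; apply/eqP/negPn/negP => /eqP/gl[t tl Vx].
    by apply: nB; exact: BP Vx.
  by apply/funext => x; rewrite /g2 addrC subrK.
rewrite (locfun_cutD I bB)// (le_trans (cabsD _ _))//= -natr1 mulrDl mul1r addrC.
rewrite lerD//.
  rewrite cut_id.
    apply: IH => // [x|x /s2[/gl[t + tV] nV]].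
      rewrite /g2 /g1; have [Vx|Vx] := pselect (translate y V x).
        by rewrite cut_in// subrr cabs0.
      by rewrite cut_out// subr0.
    by rewrite inE => /orP[/eqP ty|tl]; [move: nV; rewrite -ty|exists t].
  move=> x nB; apply/eqP/negPn/negP => /eqP/s2[/gl[t tl Vx] _].
  by apply: nB; exact: BP Vx.
rewrite cut_id.
  by apply: (total_variation_bound hG (bV y)).
by move=> x nB; rewrite /g1 cut_out// => Vx; apply: nB; apply: BP Vx; rewrite mem_head.
Qed.

(* A maximal family of disjoint translates [x + W], [x] in [E], has at most
   [vol F / vol W] members, and the translates [x + (W - W)] cover [E]. *)
Lemma translation_bounded_estimate : exists W (C : R),
  [/\ open W, W 0, precompact W, 0 <= C & forall g (M : R) E F,
    bmeas g -> 0 <= M -> (forall x, cabs (g x) <= M) ->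
    (forall x, g x <> 0 -> E x) -> bounded_borel F ->
    (forall x w, E x -> W w -> F (x + w)) ->
    cabs (cm_integral mu g) <= C * M * vol theta F].
Proof.
have [V [oV [v0 Vv0] pV supV]] := mu_tb.
have [S S0 hS] : exists2 S : R, 0 <= S &
    forall t, (Defs.total_variation mu (translate t V) <= S%:E)%E.
  move: supV; set s := ereal_sup _ => s_oo.
  exists (Num.max (fine s) 0); first by rewrite le_max lexx orbT.
  move=> t; apply: (@le_trans _ _ s); first by apply: ereal_sup_ubound; exists t.
  move: s_oo; case: s => [r _|//|_]; last by rewrite leNye.
  by rewrite lee_fin /= le_max lexx.
(* If two translates of [W] meet, their centres differ by an element of [W - W]; this difference set
   has to fit into a translate of [V]. *)
have [W [oW W0 WV]] : exists W, [/\ open W, W 0 &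
    forall w w', W w -> W w' -> V (v0 + w - w')].
  have cz : {for (0, 0), continuous (fun z : G * G => v0 + (z.1 - z.2))}.
    apply: (@continuous_comp _ _ _ (fun z : G * G => z.1 - z.2) (fun y => v0 + y)).
      exact: sub_continuous.
    exact: addl_cont.
  have : nbhs ((0, 0) : G * G) [set z | V (v0 + (z.1 - z.2))].
    by apply: cz; rewrite /= subrr addr0; apply: open_nbhs_nbhs; split.
  case=> -[A B] /= [A0 B0] AB.
  have [W [oW W0] WAB] : exists2 W : set G, open_nbhs 0 W & W `<=` A `&` B.
    have : nbhs (0 : G) (A `&` B) by exact: filterI.
    by rewrite nbhsE.
  exists W; split=> // w w' /WAB[Aw _] /WAB[_ Bw].
  by rewrite -addrA; exact: (AB (w, w')).
have pW : precompact W.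
  apply: (precompact_subset _ (translate_precompact (- v0) pV)).
  move=> w Ww; rewrite translateE /= opprK.
  by have := WV w 0 Ww W0; rewrite subr0.
have bW : bounded_borel W by split=> //; exact: open_borel.
have W1 : 0 < vol theta W by apply: vol_gt0 => //; exists 0.
exists W, (2 * S / vol theta W); split=> //.
  by rewrite divr_ge0 ?mulr_ge0// ltW.
move=> g M E F bg M0 gM gE bF EF.
(* Packings: centres in [E] whose translates of [W] are pairwise disjoint, hence disjoint subsets of
   [F]. *)
pose fix good (l : seq G) : Prop := if l is x :: r then
  [/\ E x, forall y, y \in r -> translate x W `&` translate y W = set0 & good r]
  else True.
have bWt x : bounded_borel (translate x W) by exact: translate_bounded_borel.
have gsize l : good l -> (size l)%:R * vol theta W <= vol theta F.
  pose U r := \big[setU/set0]_(t <- r) translate t W.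
  have bU r : bounded_borel (U r).
    rewrite /U; elim: r => [|u r IHr]; last by rewrite big_cons; exact: bounded_borelU.
    by rewrite big_nil; apply: bounded_borel_compact => //; exact: compact0.
  have Ux r z : U r z -> exists2 t, t \in r & translate t W z.
    rewrite /U; elim: r => [|u r IHr]; rewrite ?big_nil// big_cons => -[Wz|/IHr[t tr Wz]].
      by exists u => //; rewrite mem_head.
    by exists t => //; rewrite inE tr orbT.
  move=> gl; have -> : (size l)%:R * vol theta W = vol theta (U l).
    elim: l gl => [_|x r IH [Ex xr /IH IHr]].
      by rewrite mul0r /U big_nil /vol measure0.
    rewrite /= -natr1 mulrDl mul1r IHr addrC /U big_cons -/(U r) volU//.
      by rewrite (vol_translate haar)//; case: bW.
    apply/seteqP; split=> // z [Wz /Ux[t tr Wt]].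
    by rewrite -(xr t tr).
  apply: le_vol => //; first by case: (bU l).
  move=> z /Ux[t tl [w Ww <-]]; apply: EF => //.
  elim: l gl tl => [//|x r IH [Ex _ gr]]; rewrite inE => /orP[/eqP -> //|]; exact: IH.
have [l [gl El]] : exists l, good l /\ forall x, E x ->
    exists2 y, y \in l & translate x W `&` translate y W !=set0.
  apply: contrapT => nl.
  (* If no packing were maximal, there would be packings of every length, against the volume bound
     [gsize]. *)
  have all n : exists2 l, good l & size l = n.
    elim: n => [|n [l gl sl]]; first by exists [::].
    apply: contrapT => nn; apply: nl; exists l; split=> // x Ex.
    apply: contrapT => nx; apply: nn; exists (x :: l); last by rewrite /= sl.
    split=> // y yl; apply/eqP/negPn/negP => /set0P ne.
    by apply: nx; exists y.
  have [l gl sl] := all (Num.truncn (vol theta F / vol theta W)).+1.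
  have := gsize l gl; rewrite sl -ler_pdivlMr// leNgt.
  by rewrite Num.Theory.truncnS_gt.
have := @cover_bound V S M [seq y - v0 | y <- l] g oV pV hS bg M0 gM.
rewrite size_map => /(_ _)/le_trans -> //.
  move=> x /gE /El[y yl [z []]]; rewrite !translateE /= => xz yz.
  exists (y - v0); first exact: map_f.
  rewrite translateE /=; have := WV _ _ yz xz; congr V.
  rewrite opprB opprD opprK -addrA [- y + z]addrC [z - y + _]addrC subrKA.
  by rewrite -addrA [x - y]addrC.
have := gsize l gl; rewrite -ler_pdivlMr// => h.
have -> : 2 * S / vol theta W * M * vol theta F = vol theta F / vol theta W * (2 * (M * S)).
  by ring.
by rewrite ler_wpM2r// !mulr_ge0.
Qed.

End translation_bounded_measures.

(** * Van Hove sequences and averages *)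

(* The library puts no uniform structure on a topological group; this alias
   carries the one needed for Urysohn's lemma. *)
Definition group_uniform (G : topologicalZmodType) : Type := G.

Section group_uniformity.
Context (G : topologicalZmodType).

HB.instance Definition _ := Choice.on (group_uniform G).

Let ent : set_system (group_uniform G * group_uniform G) :=
  [set E | exists U : set G, nbhs (0 : G) U /\
    forall x y : G, U (y - x) -> E (x, y)].

Let ent_filter : Filter ent.
Proof.
split; first by exists setT; split=> //; exact: filterT.
  move=> P Q [U [U0 UP]] [V [V0 VQ]]; exists (U `&` V); split; first exact: filterI.
  by move=> x y [/UP ? /VQ ?].
by move=> P Q PQ [U [U0 UP]]; exists U; split=> // x y /UP /PQ.
Qed.

Let ent_refl E : ent E -> diagonal `<=` E.
Proof.
move=> [U [U0 UE]] [x y] /diagonalP ->; apply: UE; rewrite subrr.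
exact: nbhs_singleton.
Qed.

Let ent_inv E : ent E -> ent E^-1%relation.
Proof.
move=> [U [/nbhs0N U0 UE]]; exists [set x | U (- x)]; split=> // x y /=.
by rewrite opprB; exact: UE.
Qed.

Let ent_split E : ent E -> exists2 B, ent B & (B \; B)%relation `<=` E.
Proof.
move=> [U [U0 UE]].
have : nbhs ((0, 0) : G * G) [set z | U (z.1 + z.2)].
  by have := @add_continuous G (0, 0); rewrite /continuous_at/= addr0; exact.
case=> -[A B] /= [A0 B0] AB.
exists [set z : G * G | (A `&` B) (z.2 - z.1)].
  by exists (A `&` B); split=> //; exact: filterI.
move=> [x z] [y /= [_ Bxy] [Ayz _]]; apply: UE.
by have := AB (z - y, y - x) (conj Ayz Bxy); rewrite /= addrA subrK.
Qed.

HB.instance Definition _ := isUniform.Build (group_uniform G)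
  ent_filter ent_refl ent_inv ent_split.

(** Compactness of [K] gives a single neighbourhood [U] of 0 such that [K + U] avoids [C]; this
    uniform gap is the input of Urysohn's construction. *)
Lemma group_uniform_separator (K C : set G) : compact K -> closed C ->
  K `&` C = set0 -> uniform_separator C K.
Proof.
move=> cK cC KC.
have nc := (compact_near_coveringP K).1 cK.
have : \forall u \near (0 : G), K `<=` (fun x => ~ C (x + u)).
  apply: nc => x Kx.
  have : nbhs ((x, 0) : G * G) [set z | (~` C) (z.1 + z.2)].
    have := @add_continuous G (x, 0); rewrite /continuous_at/= addr0 => /(_ (~` C)); apply.
    apply: open_nbhs_nbhs; split; first exact: closed_openC.
    by move=> Cx; have : (K `&` C) x by []; rewrite KC.
  by case=> -[A B] AB0 AB; exists (A, B).
move=> HU; pose U : set G := [set u | K `<=` (fun x => ~ C (x + u))].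
have U0 : nbhs (0 : G) U by [].
exists (Uniform.class (group_uniform G)), [set z : G * G | U (z.1 - z.2)].
split.
- exists [set x | U (- x)]; split; first exact: nbhs0N.
  by move=> x y /=; rewrite opprB.
- apply/seteqP; split=> // -[x y] [[/= Cx Ky]] /= /(_ y Ky).
  by rewrite addrC subrK.
- move=> x V [E [W [W0 WE]] EV].
  apply: filterS (nbhs0_sub x W0) => y /WE Exy.
  by apply: EV; apply/xsectionP.
Qed.

End group_uniformity.

(** * Urysohn functions with compact support *)

Section bumps.
Context (R : realType) (G : topologicalZmodType) (hG : hausdorff_space G).
Context (lcG : locally_compact [set: G]).
Implicit Types (K O U : set G).

Lemma nbhs0_precompact : exists2 V : set G, open_nbhs 0 V & precompact V.
Proof.
have [//|U + [cU clU]] := @lcG 0; rewrite withinET nbhsE => -[V oV VU].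
by exists V => //; exists U.
Qed.

Lemma compact_open_precompact K : compact K ->
  exists U, [/\ open U, K `<=` U & precompact U].
Proof.
move=> cK; have [V [oV V0] [L VL [cL clL]]] := nbhs0_precompact.
exists (\bigcup_(x in K) translate x V); split.
- by apply: bigcup_open => x _; exact: translate_open.
- by move=> x Kx; exists x => //; rewrite translateE /= addNr.
- exists (setadd K L); first by move=> y [x Kx [v Vv <-]]; exists x => //; exists v => //; exact: VL.
  have c := setadd_compact cK cL; split=> //; exact: compact_closed.
Qed.

(** Shrinking [O] to a relatively compact neighbourhood of [K] makes the support of the separating
    function compact. *)
Lemma bump K O : compact K -> open O -> K `<=` O ->
  exists f : G -> R, [/\ continuous f, forall x, 0 <= f x <= 1,
    forall x, K x -> f x = 1, forall x, ~ O x -> f x = 0 &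
    compact (closure [set x | f x != 0])].
Proof.
move=> cK oO KO; have [U [oU KU pU]] := compact_open_precompact cK.
have : K `&` ~` (O `&` U) = set0.
  by apply/seteqP; split=> // x [Kx]; apply; split; [exact: KO|exact: KU].
move=> /(group_uniform_separator cK (open_closedC (openI oO oU))).
move=> /(@uniform_separatorP _ R)[f [cf f01 f0 f1]].
have z x : ~ (O `&` U) x -> f x = 0 by move=> nx; apply: f0; exists x.
exists f; split=> //.
- by move=> x; have := f01 (f x); rewrite /= in_itv /=; apply; exists x.
- by move=> x Kx; apply: f1; exists x.
- by move=> x nO; apply: z; case.
rewrite -precompactE; apply: precompact_subset pU => x /= /eqP fx.
by apply: contrapT => nU; apply: fx; apply: z; case.
Qed.

Lemma real_Cc (f : G -> R) : continuous f -> compact (closure [set x | f x != 0]) ->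
  Cc (fun x => (f x)%:C%C).
Proof.
move=> cf ck; split; first exact: cont_real.
rewrite (_ : [set x | _] = [set x | f x != 0])//.
apply/funext => x /=; congr (~~ _ : Prop); apply/eqP/eqP => [[]//|-> //].
Qed.

Lemma Cc_sub (phi : G -> R[i]) K : continuous phi -> compact K ->
  (forall x, ~ K x -> phi x = 0) -> Cc phi.
Proof.
move=> cp cK p0; split=> //.
apply: (subclosed_compact _ cK); first exact: closed_closure.
rewrite [X in _ `<=` X](closure_id K).1; last exact: compact_closed.
apply: closureS => x /= /eqP px; apply: contrapT => nK; exact/px/p0.
Qed.

Lemma Cc_supp (phi : G -> R[i]) : Cc phi ->
  exists2 K, compact K & forall x, ~ K x -> phi x = 0.
Proof.
move=> [cp cK]; eexists; first exact: cK.
by move=> x nK; apply/eqP/negPn/negP => px; apply: nK; exact: subset_closure.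
Qed.

End bumps.

Section van_hove_sequences.
Context (R : realType) (G : topologicalZmodType) (hG : hausdorff_space G).
Context (theta : radon_measure R G) (haar : is_haar theta).
Implicit Types (A B E F K L U V W : set G).

Definition sym_compact K := [/\ compact K, K 0 & forall x, K x -> K (- x)].

Lemma sym_compact_ex K : compact K -> exists2 L, sym_compact L & K `<=` L.
Proof.
move=> cK; exists ((K `|` (-%R @` K)) `|` [set 0]); last by move=> x Kx; do 2 left.
split; [|by right|].
  apply: compactU; last exact: compact_set1.
  by apply: compactU => //; exact: opp_compact.
move=> x [[Kx|[y Ky <-]]|->]; last by right; rewrite oppr0.
  by left; right; exists x.
by left; left; rewrite opprK.
Qed.

Lemma sym_compact_add K L : sym_compact K -> sym_compact L ->
  sym_compact (setadd K L).
Proof.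
move=> [cK K0 KN] [cL L0 LN]; split; first exact: setadd_compact.
  by exists 0 => //; exists 0 => //; rewrite addr0.
move=> _ [x Kx [y Ly <-]]; exists (- x); first exact: KN.
by exists (- y); [exact: LN|rewrite opprD].
Qed.

(** The points where cutting to [B] interferes with a function of support in [K] moved to that
    point; all error terms are supported here. For symmetric [K] it lies in the van Hove boundary,
    and being free of closures it is easier to enlarge. *)
Definition straddle K B : set G :=
  [set s | (exists2 k, K k & B (s + k)) /\ (exists2 k, K k & ~ B (s + k))].

Lemma straddle_boundary K B : sym_compact K -> straddle K B `<=` vh_boundary K B.
Proof.
move=> [cK K0 KN] s [[k Kk Bk] [l Kl Bl]].
have [Bs|nBs] := pselect (B s).
  right; split; apply: subset_closure => //.
  by exists (s + l) => //; exists l => //; rewrite addrK.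
left; split; apply: subset_closure => //.
by exists (s + k) => //; exists (- k); [exact: KN|rewrite addrK].
Qed.

(** Needed to thicken the straddling points by the set [W] of [translation_bounded_estimate], at the
    price of a larger compact set. *)
Lemma straddle_add K L B s w : sym_compact L -> straddle K B s -> L w ->
  straddle (setadd K L) B (s + w).
Proof.
move=> [_ _ LN] [[k Kk Bk] [l Kl Bl]] Lw; split.
  exists (k - w); first by exists k => //; exists (- w) => //; exact: LN.
  by rewrite addrCA !addrA addrK addrC.
exists (l - w); first by exists l => //; exists (- w) => //; exact: LN.
by rewrite addrCA !addrA addrK addrC.
Qed.

Lemma boundary_bounded K B : compact K -> precompact B ->
  bounded_borel (vh_boundary K B).
Proof.
move=> cK pB; have clB : compact (closure B) by rewrite -precompactE.
have clb : closed (vh_boundary K B).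
  by apply: closedU; apply: closedI; exact: closed_closure.
split; first exact: closed_borel.
have c1 : compact (setadd (closure B) K) by exact: setadd_compact.
exists (setadd (closure B) K `|` closure B); last first.
  by split; [exact: compactU|apply: closedU; [exact: compact_closed|exact: closed_closure]].
move=> x [[+ _]|[_ Bx]]; last by right.
move=> h; left; suff : closure (setadd B K) `<=` setadd (closure B) K by exact.
rewrite [X in _ `<=` X](closure_id _).1; last exact: compact_closed.
apply: closureS => _ [b Bb [k Kk <-]]; exists b; first exact: subset_closure.
by exists k.
Qed.

Lemma boundary_translate K B x :
  vh_boundary K (translate x B) = translate x (vh_boundary K B).
Proof.
rewrite /vh_boundary translateU !translateI -!translate_closure.
have -> : setadd (translate x B) K = translate x (setadd B K).
  apply/seteqP; split=> [_ [_ [b Bb <-] [k Kk <-]]|_ [_ [b Bb [k Kk <-]] <-]].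
    by exists (b + k); [exists b => //; exists k|rewrite addrA].
  by exists (x + b); [exists b|exists k => //; rewrite addrA].
have -> : setsub (~` translate x B) K = translate x (setsub (~` B) K).
  rewrite -translateC.
  apply/seteqP; split=> [_ [_ [b Bb <-] [k Kk <-]]|_ [_ [b Bb [k Kk <-]] <-]].
    by exists (b - k); [exists b => //; exists k|rewrite addrA].
  by exists (x + b); [exists b|exists k => //; rewrite addrA].
by rewrite translateC.
Qed.

Lemma van_hove_translate (B : nat -> set G) (x : nat -> G) : van_hove theta B ->
  van_hove theta (fun n => translate (x n) (B n)).
Proof.
move=> [B1 B2 B3]; split.
- by move=> n; have [? ?] := B1 n; split; [exact: translate_open|exact: translate_precompact].
- by move=> n; rewrite haar.2//; apply: open_borel; have [] := B1 n.
- move=> K cK; rewrite (_ : (fun n => _) =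
    (fun n => vol theta (vh_boundary K (B n)) / vol theta (B n))); first exact: B3.
  apply/funext => n; have [oB pB] := B1 n.
  rewrite boundary_translate !(vol_translate haar)//; first exact: open_borel.
  by have [] := boundary_bounded cK pB.
Qed.

(** Alternating two van Hove sequences gives another one; convergence along it forces the limits
    along the two to agree. *)
Definition interleave T (u v : nat -> T) n := if odd n then v n./2 else u n./2.

Lemma interleave_cvg (T : topologicalType) (u v : nat -> T) (l : T) :
  u @ \oo --> l -> v @ \oo --> l -> interleave u v @ \oo --> l.
Proof.
move=> ul vl A Al; have [M _ HM] := ul A Al; have [N _ HN] := vl A Al.
exists (maxn M N).*2 => //= n h; rewrite /interleave.
have : (maxn M N <= n./2)%N by rewrite -(doubleK (maxn M N)); exact: half_leq.
by rewrite geq_max => /andP[Mn Nn]; rewrite /preimage /mkset; case: (odd n); [exact: HN|exact: HM].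
Qed.

Lemma interleave_even T (u v : nat -> T) n : interleave u v n.*2 = u n.
Proof. by rewrite /interleave odd_double doubleK. Qed.
Lemma interleave_odd T (u v : nat -> T) n : interleave u v n.*2.+1 = v n.
Proof. by rewrite /interleave /= odd_double /= uphalf_double. Qed.

Lemma van_hove_interleave (B B' : nat -> set G) : van_hove theta B ->
  van_hove theta B' -> van_hove theta (interleave B B').
Proof.
move=> [B1 B2 B3] [C1 C2 C3]; split.
- by move=> n; rewrite /interleave; case: ifP.
- by move=> n; rewrite /interleave; case: ifP.
- move=> K cK; rewrite (_ : (fun n => _) = interleave
    (fun n => vol theta (vh_boundary K (B n)) / vol theta (B n))
    (fun n => vol theta (vh_boundary K (B' n)) / vol theta (B' n))).
    exact: interleave_cvg (B3 K cK) (C3 K cK).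
  apply/funext => n; by rewrite /interleave; case: ifP.
Qed.

Lemma interleave_lim (T : topologicalType) (hT : hausdorff_space T)
  (u v : nat -> T) (l a b : T) : interleave u v @ \oo --> l ->
  u @ \oo --> a -> v @ \oo --> b -> a = b.
Proof.
move=> ll ua vb; transitivity l.
  apply: (cvg_unique hT ua).
  move=> A Al; have [N _ HN] := ll A Al; exists N => // n /= Nn.
  by rewrite /preimage /mkset -(interleave_even u v); apply: HN => /=; lia.
apply: (cvg_unique hT _ vb).
move=> A Al; have [N _ HN] := ll A Al; exists N => // n /= Nn.
by rewrite /preimage /mkset -(interleave_odd u v); apply: HN => /=; lia.
Qed.

End van_hove_sequences.

(** * Averages over a set and their near invariance under translation *)

Section averages.
Context (R : realType) (G : topologicalZmodType) (hG : hausdorff_space G).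
Context (theta : radon_measure R G) (haar : is_haar theta).
Implicit Types (f g : G -> R[i]) (A B E F K L U V W : set G).

Definition avg B f : R[i] :=
  ((vol theta B)^-1)%:C%C * cintegral theta (cut B f).
Definition aavg B f : R :=
  (vol theta B)^-1 * \int[theta]_(x in (B : set (borel G))) cabs (f x).
Definition boundary_ratio K B : R := vol theta (vh_boundary K B) / vol theta B.

Let I := locfun_cintegral hG theta.

Lemma bmeas_cabs f : bmeas f -> bmeas (fun x => (cabs (f x))%:C%C).
Proof.
move=> [fr fi [M fM]]; split=> //=; last first.
  by exists M => x; rewrite cabsR ger0_norm// cabs_ge0.
rewrite (_ : (fun x => _) = (fun x : borel G => Num.sqrt
    ((complex.Re (f x)) ^+ 2 + (complex.Im (f x)) ^+ 2))); last first.
  by apply/funext => x; rewrite -cabs_sqrE sqrtr_sqr ger0_norm// cabs_ge0.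
apply: (@measurableT_comp _ _ _ _ _ _ (@Num.sqrt R)) => //.
  by apply: measurable_realfun.continuous_measurable_fun; exact: sqrt_continuous.
by apply: measurable_funD; exact: measurable_funX.
Qed.

Lemma cabs_integrable E f : bounded_borel E -> bmeas f ->
  theta.-integrable E (EFin \o (fun x : borel G => cabs (f x))).
Proof.
move=> bE bf; have [mE _] := bE; have Efin := radon_bounded_fin theta hG bE.
exact: (@bmeas_Re_integrable _ _ theta E _ mE Efin (bmeas_cabs bf)).
Qed.

Lemma avg_abs E f : avg E (fun x => (cabs (f x))%:C%C) = (aavg E f)%:C%C.
Proof.
rewrite /avg /aavg cintegral_cut /= /Rintegral integral0 /=.
by rewrite (_ : Complex _ 0 = (fine (\int[theta]_(x in E) (cabs (f x))%:E))%:C%C)// -rmorphM.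
Qed.

Section one_set.
Context (B : set G) (bB : bounded_borel B) (B0 : 0 < vol theta B).

Lemma avgD f g : bmeas f -> bmeas g ->
  avg B (fun x => f x + g x) = avg B f + avg B g.
Proof. by move=> bf bg; rewrite /avg (locfun_cutD I bB)// mulrDr. Qed.
Lemma avgB f g : bmeas f -> bmeas g ->
  avg B (fun x => f x - g x) = avg B f - avg B g.
Proof. by move=> bf bg; rewrite /avg (locfun_cutB I bB)// mulrBr. Qed.
Lemma avgZ c f : bmeas f -> avg B (fun x => c * f x) = c * avg B f.
Proof. by move=> bf; rewrite /avg (locfun_cutZ I bB)// mulrCA. Qed.
Lemma avg_sum J (s : seq J) (F : J -> G -> R[i]) : (forall j, bmeas (F j)) ->
  avg B (fun x => \sum_(j <- s) F j x) = \sum_(j <- s) avg B (F j).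
Proof. by move=> bF; rewrite /avg (locfun_cut_sum I bB)// mulr_sumr. Qed.
Lemma avgJ f : bmeas f -> avg B (fun x => (f x)^*%C) = (avg B f)^*%C.
Proof.
move=> bf; have [mB _] := bB; have fB := radon_bounded_fin theta hG bB.
rewrite /avg cJM cJR; congr (_ * _).
rewrite !cintegral_cut /=; congr Complex.
  by apply: eq_Rintegral => x _; rewrite cReJ.
under eq_Rintegral do rewrite cImJ -mulN1r.
rewrite RintegralZl ?mulN1r//; exact: bmeas_Im_integrable.
Qed.
Lemma avg_cst c : avg B (fun=> c) = c.
Proof.
have := avgZ c (@bmeas_cst R G 1).
under [in X in X -> _]eq_fun do rewrite mulr1.
by move=> ->; rewrite /avg (cintegral_vol theta)// -rmorphM/= mulVf ?mulr1// gt_eqF.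
Qed.

Lemma aavg_ge0 f : 0 <= aavg B f.
Proof.
rewrite /aavg mulr_ge0// ?invr_ge0 ?(ltW B0)//; apply: Rintegral_ge0 => x _.
exact: cabs_ge0.
Qed.

Lemma aavg_le f g : bmeas f -> bmeas g -> (forall x, B x -> cabs (f x) <= cabs (g x)) ->
  aavg B f <= aavg B g.
Proof.
move=> bf bg fg; rewrite /aavg ler_pM2l ?invr_gt0//.
have [mB _] := bB.
by apply: le_Rintegral => //; exact: cabs_integrable.
Qed.

Lemma aavg_cst c : aavg B (fun=> c) = cabs c.
Proof.
apply: (@complexI R); rewrite -avg_abs; exact: avg_cst.
Qed.

Lemma aavg_le_cst f (M : R) : bmeas f -> (forall x, B x -> cabs (f x) <= M) -> 0 <= M ->
  aavg B f <= M.
Proof.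
move=> bf fM M0; rewrite -(ger0_norm M0) -cabsR -aavg_cst.
apply: aavg_le => //; first exact: bmeas_cst.
by move=> x Bx; rewrite cabsR (ger0_norm M0) fM.
Qed.

Lemma aavgD f g : bmeas f -> bmeas g ->
  aavg B (fun x => f x + g x) <= aavg B f + aavg B g.
Proof.
move=> bf bg; have bfg := bmeasD (bmeas_cabs bf) (bmeas_cabs bg).
have <- : aavg B (fun x => (cabs (f x))%:C%C + (cabs (g x))%:C%C) = aavg B f + aavg B g.
  apply: (@complexI R); rewrite rmorphD /= -!avg_abs.
  rewrite -avgD; [|exact: bmeas_cabs|exact: bmeas_cabs].
  congr (avg B _); apply/funext => x; rewrite -rmorphD /= cabsR ger0_norm//.
  by rewrite addr_ge0// cabs_ge0.
apply: aavg_le => //; first exact: bmeasD.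
by move=> x _; rewrite -rmorphD /= cabsR ger0_norm ?cabsD// addr_ge0// cabs_ge0.
Qed.

Lemma cabs_avg f : bmeas f -> cabs (avg B f) <= 2 * aavg B f.
Proof.
move=> bf; have [mB _] := bB; have fB := radon_bounded_fin theta hG bB.
rewrite /avg cabsM cabsR ger0_norm ?invr_ge0 ?(ltW B0)// /aavg mulrCA ler_pM2l ?invr_gt0//.
rewrite cintegral_cut (le_trans (cabs_ReIm _))//= mulr2n mulrDl mul1r lerD//.
  apply: le_trans (le_normr_Rintegral mB (bmeas_Re_integrable mB fB bf)) _.
  apply: le_Rintegral => //; last by move=> x _; exact: Re_cabs.
    by apply: integrable_norm; exact: bmeas_Re_integrable.
  exact: cabs_integrable.
apply: le_trans (le_normr_Rintegral mB (bmeas_Im_integrable mB fB bf)) _.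
apply: le_Rintegral => //; last by move=> x _; exact: Im_cabs.
  by apply: integrable_norm; exact: bmeas_Im_integrable.
exact: cabs_integrable.
Qed.

Definition sqabs f x : R[i] := f x * (f x)^*%C.

Lemma bmeas_sqabs f : bmeas f -> bmeas (sqabs f).
Proof. by move=> bf; apply: bmeasM => //; exact: bmeasJ. Qed.

Lemma avg_sqabs f : avg B (sqabs f) = (aavg B (sqabs f))%:C%C.
Proof.
rewrite -avg_abs; congr (avg B _); apply/funext => x.
by rewrite /sqabs mulJ cabsR ger0_norm// sqr_ge0.
Qed.

(** The difference of the two sides is the variance of the modulus of [f], that is, the mean of
    [sqabs h]. *)
Lemma aavg_CS f : bmeas f -> aavg B f ^+ 2 <= aavg B (sqabs f).
Proof.
move=> bf; have bc := bmeas_cabs bf.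
pose c := aavg B f; pose h x := (cabs (f x))%:C%C - c%:C%C.
have bh : bmeas h by apply: bmeasB => //; exact: bmeas_cst.
have : 0 <= aavg B (sqabs h) by exact: aavg_ge0.
suff -> : aavg B (sqabs h) = aavg B (sqabs f) - c ^+ 2 by rewrite subr_ge0.
apply: (@complexI R); rewrite -avg_sqabs rmorphB /= -avg_sqabs.
have -> : sqabs h = fun x => sqabs f x - ((2 * c)%:C%C * (cabs (f x))%:C%C - (c ^+ 2)%:C%C).
  apply/funext => x; rewrite /sqabs mulJ /h -rmorphB mulJ cabsR.
  by rewrite real_normK ?num_real// -!(rmorphM, rmorphB)/=; congr (_%:C%C); ring.
rewrite avgB; [|exact: bmeas_sqabs|].
  rewrite avgB; [|exact: bmeasZ|exact: bmeas_cst].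
  rewrite avgZ// avg_abs avg_cst -/c -rmorphM -rmorphB /=; congr (_ - _%:C%C).
  by ring.
by apply: bmeasB; [exact: bmeasZ|exact: bmeas_cst].
Qed.

End one_set.

(** By invariance the shifted integral is one over [translate t B]; the two domains differ only at
    points that straddle [B]. *)
Lemma shift_bound K B t f (M : R) : sym_compact K -> open B -> precompact B ->
  K t -> buc f -> (forall x, cabs (f x) <= M) ->
  cabs (cintegral theta (cut B (fun s => f (s + t))) - cintegral theta (cut B f)) <=
  2 * vol theta (vh_boundary K B) * M.
Proof.
move=> sK oB pB Kt bf fM; have [cK K0 KN] := sK.
have M0 : 0 <= M by rewrite (le_trans _ (fM 0))// cabs_ge0.
have bB : bounded_borel B by split=> //; exact: open_borel.
have bB' := translate_bounded_borel t bB.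
have mf := buc_bmeas bf.
have -> : cintegral theta (cut B (fun s => f (s + t))) =
    cintegral theta (cut (translate t B) f).
  rewrite -(haar_translate haar (- t)); last first.
    by apply: bmeas_cut; [by case: bB|exact: (buc_bmeas (buc2_l t (buc2_add bf)))].
  congr cintegral; apply/funext => s; rewrite !cutE.
  have -> : (s \in translate t B) = (- t + s \in B).
    by rewrite translateE; apply/idP/idP; rewrite !inE.
  by rewrite (addrC (- t)) subrK.
have bU := bounded_borelU bB bB'.
have e1 E : E `<=` B `|` translate t B -> cut E f = cut (B `|` translate t B) (cut E f).
  exact: cut_cut.
rewrite (e1 _ (@subsetUr _ _ _)) (e1 _ (@subsetUl _ _ _)).
rewrite -(locfun_cutB I bU); [|by apply: bmeas_cut => //; case: bB'|by apply: bmeas_cut => //; case: bB].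
set g := (fun x => _).
have gs x : g x <> 0 -> vh_boundary K B x.
  move=> gx; apply: straddle_boundary => //.
  rewrite /g in gx; have [Bx|Bx] := pselect (B x); have [tx|tx] := pselect (translate t B x).
  - by exfalso; apply: gx; rewrite !cut_in// subrr.
  - split; first by exists 0; rewrite ?addr0.
    exists (- t); first exact: KN.
    by move=> h; apply: tx; rewrite translateE /= addrC.
  - split; last by exists 0; rewrite ?addr0.
    exists (- t); first exact: KN.
    by move: tx; rewrite translateE /= addrC.
  - by exfalso; apply: gx; rewrite !cut_out// subrr.
have bd := boundary_bounded hG cK pB.
have bg : bmeas g by apply: bmeasB; apply: bmeas_cut => //; [case: bB'|case: bB].
have -> : cut (B `|` translate t B) g = cut (vh_boundary K B) g.
  rewrite cut_id; first rewrite cut_id//.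
    by move=> x nx; apply/eqP/negPn/negP => /eqP /gs.
  move=> x nx; rewrite /g !cut_out ?subrr//; first by move=> ?; apply: nx; left.
  by move=> ?; apply: nx; right.
apply: cintegral_bound => // x _; rewrite /g !cutE; case: ifP; case: ifP => _ _.
- by rewrite subrr cabs0.
- by rewrite subr0.
- by rewrite sub0r cabsN.
- by rewrite subrr cabs0.
Qed.

Lemma avg_shift K B t f (M : R) : sym_compact K -> open B -> precompact B ->
  0 < vol theta B -> K t -> buc f -> (forall x, cabs (f x) <= M) ->
  cabs (avg B (fun s => f (s + t)) - avg B f) <= 2 * M * boundary_ratio K B.
Proof.
move=> sK oB pB B0 Kt bf fM; rewrite /avg -mulrBr cabsM cabsR ger0_norm ?invr_ge0 ?(ltW B0)//.
rewrite /boundary_ratio mulrA [leRHS]mulrC ler_pM2l ?invr_gt0//.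
by rewrite mulrAC; exact: shift_bound.
Qed.

Lemma vH_basic (B : nat -> set G) n : van_hove theta B ->
  [/\ open (B n), precompact (B n), bounded_borel (B n) & 0 < vol theta (B n)].
Proof.
move=> [H1 H2 _]; have [oB pB] := H1 n; have bB : bounded_borel (B n) by split=> //; exact: open_borel.
by split=> //; rewrite /vol fine_gt0// H2 /=; exact: radon_bounded_fin.
Qed.

Lemma vH_boundary (B : nat -> set G) K (e : R) : van_hove theta B -> compact K ->
  0 < e -> \forall n \near \oo, boundary_ratio K (B n) < e.
Proof.
move=> [_ _ H] cK e0; have /cvgrPdist_lt/(_ e e0) := H K cK.
apply: filterS => n; rewrite sub0r normrN; apply: le_lt_trans; exact: ler_norm.
Qed.

Lemma boundary_ratio_ge0 K (B : nat -> set G) n : van_hove theta B ->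
  0 <= boundary_ratio K (B n).
Proof. by move=> hB; rewrite divr_ge0// vol_ge0. Qed.

Definition cvg_avg (B : nat -> set G) f (a : R[i]) := avg (B n) f @[n --> \oo] --> a.

(** Transfers information about averages over all translates of a fixed [E] to averages over large
    sets [B]. Fubini's theorem makes the double average an [E]-average of shifted [B]-averages, each
    within [2 * M * boundary_ratio K B]; [cabs_avg] doubles this. *)
Lemma avg_avg K B E f (M : R) : sym_compact K -> open B -> precompact B ->
  0 < vol theta B -> bounded_borel E -> 0 < vol theta E -> E `<=` K -> buc f ->
  (forall x, cabs (f x) <= M) ->
  cabs (avg B (fun s => avg E (fun t => f (s + t))) - avg B f) <=
  4 * M * boundary_ratio K B.
Proof.
move=> sK oB pB B0 bE E0 EK bf fM.
have M0 : 0 <= M by rewrite (le_trans _ (fM 0))// cabs_ge0.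
have bB : bounded_borel B by split=> //; exact: open_borel.
have -> : avg B (fun s => avg E (fun t => f (s + t))) = avg E (fun t => avg B (fun s => f (s + t))).
  have bl := buc_locfun I (buc2_add bf) bE.
  have br := buc_locfun I (buc2_swap (buc2_add bf)) bB.
  rewrite /avg (locfun_cutZ I bB); last exact: buc_bmeas bl.
  rewrite (locfun_cutZ I bE); last exact: buc_bmeas br.
  by rewrite mulrCA (fubini I I (buc2_add bf) bB bE).
rewrite -[X in _ - X](avg_cst bE E0).
have b1 : bmeas (fun t => avg B (fun s => f (s + t))).
  by apply: bmeasZ; exact: buc_bmeas (buc_locfun I (buc2_swap (buc2_add bf)) bB).
rewrite -(avgB bE)//; last exact: bmeas_cst.
rewrite (le_trans (cabs_avg bE E0 _))//; first by apply: bmeasB => //; exact: bmeas_cst.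
have -> : 4 * M * boundary_ratio K B = 2 * (2 * M * boundary_ratio K B) by ring.
rewrite ler_pM2l//; apply: aavg_le_cst => //.
- by apply: bmeasB => //; exact: bmeas_cst.
- by move=> t Et; apply: avg_shift => //; exact: EK.
- by rewrite !mulr_ge0// ?invr_ge0 ?(ltW B0)// /boundary_ratio ?vol_ge0.
Qed.

(** A shift by [t] multiplies the average by [chi t], but changes it by a vanishing amount. *)
Lemma avg_character (B : nat -> set G) (chi : G -> R[i]) : van_hove theta B ->
  is_character chi -> (exists t, chi t <> 1) -> cvg_avg B chi 0.
Proof.
move=> hB cchi [t ct]; have bc := character_buc cchi.
have [_ cD c1] := cchi.
have ca x : cabs (chi x) = 1 by rewrite /cabs c1.
have [K sK Kt] := sym_compact_ex (@compact_set1 _ t).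
have [cK _ _] := sK.
apply/cvgCP => e e0.
have d0 : 0 < cabs (chi t - 1) by apply: cabs_gt0; rewrite subr_eq0; apply/eqP.
have e1 : 0 < cabs (chi t - 1) * e / 2 by rewrite divr_gt0// mulr_gt0.
apply: filterS (vH_boundary hB cK e1) => n bn.
have [oB pB bB B0] := vH_basic n hB.
rewrite sub0r cabsN -(ltr_pM2l d0) -cabsM.
have -> : (chi t - 1) * avg (B n) chi = avg (B n) (fun s => chi (s + t)) - avg (B n) chi.
  rewrite mulrBl mul1r -(avgZ bB); last exact: buc_bmeas.
  by congr (avg _ _ - _); apply/funext => s; rewrite cD mulrC.
apply: le_lt_trans (@avg_shift K (B n) t chi 1 sK oB pB B0 _ bc _) _; first exact: Kt.
  by move=> x; rewrite ca.
by rewrite mulr1 mulrC -ltr_pdivlMr.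
Qed.

End averages.

(** * Convolutions and autocorrelations along a set *)

Section convolution_estimates.
Context (R : realType) (G : topologicalZmodType) (hG : hausdorff_space G).
Context (lcG : locally_compact [set: G]).
Context (theta : radon_measure R G) (haar : is_haar theta).
Context (mu : cmeasure R G) (mu_tb : translation_bounded mu).
Implicit Types (f g phi psi : G -> R[i]) (A B E F K L U V W : set G).

Let I := locfun_cm hG mu.
Let J := locfunJ I.
Let Th := locfun_cintegral hG theta.

Lemma buc_subl phi t : buc phi -> buc (fun s => phi (t - s)).
Proof. by move=> /buc2_sub /(buc2_r t). Qed.

(** [g] lives on [t - K]; the thickening [t - K + L] has a volume independent of [t], hence one
    constant for all [t]. *)
Lemma conv_estimate K : compact K -> exists C : R, 0 <= C /\ forall g (M : R) t,
  bmeas g -> 0 <= M -> (forall x, cabs (g x) <= M) -> (forall s, g s <> 0 -> K (t - s)) ->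
  cabs (cm_integral mu g) <= C * M.
Proof.
move=> cK; have [W [C [oW W0 pW C0 H]]] := translation_bounded_estimate hG haar mu_tb.
have [L WL [cL _]] := pW.
pose F := setadd (-%R @` K) L.
have cF : compact F by apply: setadd_compact => //; exact: opp_compact.
have bF := bounded_borel_compact hG cF.
exists (C * vol theta F); split; first by rewrite mulr_ge0// vol_ge0.
move=> g M t bg M0 gM gs; rewrite mulrAC -(vol_translate haar t); last by case: bF.
apply: (H g M [set s | K (t - s)]) => //; first exact: translate_bounded_borel.
move=> x w /= Kx Ww; exists ((x - t) + w); last by rewrite addrA (addrC t) subrK.
by exists (x - t); [exists (t - x) => //; rewrite opprB|exists w => //; exact: WL].
Qed.

Lemma conv_bound phi : Cc phi -> exists C : R, 0 <= C /\ forall t E,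
  measurable (E : set (borel G)) ->
  cabs (cm_integral mu (cut E (fun s => phi (t - s)))) <= C.
Proof.
move=> cphi; have bphi := Cc_buc cphi; have [[M fM] _] := bphi.
have M0 : 0 <= M by rewrite (le_trans _ (fM 0))// cabs_ge0.
have [K cK sK] := Cc_supp cphi; have [C [C0 HC]] := conv_estimate cK.
exists (C * M); split; first exact: mulr_ge0.
move=> t E mE; apply: (HC _ _ t) => //.
- by apply: bmeas_cut => //; apply: buc_bmeas; exact: buc_subl.
- by move=> x; rewrite cutE; case: ifP => _; rewrite ?cabs0.
- move=> s; rewrite cutE; case: ifP => // _ h; apply: contrapT => nK.
  by apply: h; exact: sK.
Qed.

Lemma cut_setT g : cut setT g = g.
Proof. by apply: cut_id => x; case. Qed.

Lemma conv_cut phi K E t : compact K -> (forall x, ~ K x -> phi x = 0) ->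
  (forall s, K (t - s) -> E s) -> conv_meas mu phi t = cm_integral mu (cut E (fun s => phi (t - s))).
Proof.
move=> cK sK KE; rewrite /conv_meas cut_id// => s nE; apply: sK => h.
by apply: nE; exact: KE.
Qed.

(** For [y - x] in [V] the function [s |-> phi (x - s) - phi (y - s)] is uniformly small and
    supported in [x - (K + L')], so [conv_estimate] bounds its integral uniformly in [x]. *)
Lemma conv_buc phi : Cc phi -> buc (conv_meas mu phi).
Proof.
move=> cphi; have bphi := Cc_buc cphi; have [_ uphi] := bphi.
have [K cK sK] := Cc_supp cphi.
have [C1 [C10 HC1]] := conv_bound cphi; split.
  by exists C1 => t; rewrite /conv_meas -[X in cm_integral _ X]cut_setT; exact: HC1.
move=> e e0; have [V [oV V0] [L VL [cL clL]]] := nbhs0_precompact lcG.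
have [L' sL' LL'] := sym_compact_ex cL; have [cL' L'0 L'N] := sL'.
have [C [C0 HC]] := conv_estimate (setadd_compact cK cL').
have e1 : 0 < e / (C + 1) by rewrite divr_gt0// ltr_wpDl.
have [U [U0 HU]] := uphi _ e1.
exists (U `&` V); split; first by apply: filterI => //; apply: open_nbhs_nbhs; split.
move=> x y [Uxy Vxy].
pose E := [set s | K (x - s)] `|` [set s | K (y - s)].
have bE : bounded_borel E.
  apply: bounded_borelU; apply: bounded_borel_compact => //.
    have -> : [set s | K (x - s)] = setsub [set x] K.
      apply/seteqP; split=> [s /= Ks|_ [_ -> [k Kk <-]] /=]; last by rewrite opprB addrC subrK.
      by exists x => //; exists (x - s) => //; rewrite opprB addrC subrK.
    by apply: setsub_compact => //; exact: compact_set1.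
  have -> : [set s | K (y - s)] = setsub [set y] K.
    apply/seteqP; split=> [s /= Ks|_ [_ -> [k Kk <-]] /=]; last by rewrite opprB addrC subrK.
    by exists y => //; exists (y - s) => //; rewrite opprB addrC subrK.
  by apply: setsub_compact => //; exact: compact_set1.
rewrite (@conv_cut phi K E x)//; last by move=> s Ks; left.
rewrite (@conv_cut phi K E y)//; last by move=> s Ks; right.
have bs (t : G) : bmeas (fun s : G => phi (t - s)) by apply: buc_bmeas; exact: buc_subl.
rewrite -(locfun_cutB I bE)//.
apply: (@le_lt_trans _ _ (C * (e / (C + 1)))); last first.
  by rewrite mulrCA gtr_pMr// ltr_pdivrMr ?mul1r ?ltrDl// ltr_wpDl.
have mE : measurable (E : set (borel G)) by case: bE.
apply: (HC _ _ x); [by apply: bmeas_cut => //; exact: bmeasB|exact: ltW| |].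
  move=> s; rewrite cutE; case: ifP => _; last by rewrite cabs0 ltW.
  by apply/ltW/HU; rewrite opprD addrACA subrr addr0.
move=> s h; have : E s by apply: contrapT => nE; apply: h; rewrite cut_out.
case=> /= Ks; first by exists (x - s) => //; exists 0; rewrite ?addr0.
exists (y - s) => //; exists (x - y); last by rewrite addrC subrKA.
by rewrite -opprB; apply: L'N; apply: LL'; exact: VL.
Qed.

(** The thickening [B + W] required by [translation_bounded_estimate] stays inside the union of [B]
    and its boundary. *)
Lemma restrict_estimate : exists (C : R) K, [/\ 0 <= C, sym_compact K & forall g (M : R) B,
  open B -> precompact B -> bmeas g -> 0 <= M -> (forall x, cabs (g x) <= M) ->
  cabs (cm_integral mu (cut B g)) <=
    C * M * (vol theta B + vol theta (vh_boundary K B))].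
Proof.
have [W [C [oW W0 pW C0 H]]] := translation_bounded_estimate hG haar mu_tb.
have [L WL [cL _]] := pW; have [K sK LK] := sym_compact_ex cL.
have [cK K0 KN] := sK.
exists C, K; split=> // g M B oB pB bg M0 gM.
have bB : bounded_borel B by split=> //; exact: open_borel.
have bd := boundary_bounded hG cK pB; have bU := bounded_borelU bB bd.
have mB : measurable (B : set (borel G)) by exact: open_borel.
apply: (@le_trans _ _ (C * M * vol theta (B `|` vh_boundary K B))); last first.
  rewrite ler_wpM2l ?mulr_ge0//; apply: vol_subU => //; by case: bU.
apply: (H _ _ B) => //; first exact: bmeas_cut.
- by move=> x; rewrite cutE; case: ifP => _; rewrite ?cabs0.
- by move=> x h; apply: contrapT => nB; apply: h; rewrite cut_out.
move=> x w Bx Ww; have [Bxw|nB] := pselect (B (x + w)); first by left.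
right; apply: straddle_boundary => //; split; last by exists 0; rewrite ?addr0.
by exists (- w); [apply: KN; apply: LK; exact: WL|rewrite addrK].
Qed.

(** The mass that [mu] puts near the boundary of [B] is negligible along van Hove sequences: every
    error term against [mu] is reduced to this. *)
Lemma straddle_estimate K : sym_compact K -> exists (C : R) K', [/\ 0 <= C, compact K' &
  forall g (M : R) B, precompact B -> bmeas g -> 0 <= M -> (forall x, cabs (g x) <= M) ->
   (forall s, g s <> 0 -> straddle K B s) ->
  cabs (cm_integral mu g) <= C * M * vol theta (vh_boundary K' B)].
Proof.
move=> sK; have [W [C [oW W0 pW C0 H]]] := translation_bounded_estimate hG haar mu_tb.
have [L WL [cL _]] := pW; have [L' sL' LL'] := sym_compact_ex cL.
have sKL := sym_compact_add sK sL'; have [cKL _ _] := sKL.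
exists C, (setadd K L'); split=> // g M B pB bg M0 gM gs.
apply: (H _ _ (straddle K B)) => //; first exact: boundary_bounded.
move=> x w sx Ww; apply: straddle_boundary => //; apply: straddle_add => //.
by apply: LL'; exact: WL.
Qed.

Lemma cintegral_supp g K (M : R) t : compact K -> bmeas g -> 0 <= M ->
  (forall x, cabs (g x) <= M) -> (forall s, g s <> 0 -> K (s - t)) ->
  cabs (cintegral theta g) <= 2 * vol theta K * M.
Proof.
move=> cK bg M0 gM gK; have bK := bounded_borel_compact hG cK.
rewrite -(vol_translate haar t); last by case: bK.
have -> : g = cut (translate t K) g.
  rewrite cut_id// => x nx; apply/eqP/negPn/negP => /eqP/gK h.
  by apply: nx; rewrite translateE /= addrC.
by apply: cintegral_bound => //; exact: translate_bounded_borel.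
Qed.

(** Enlarges [B] by the support of a test function to a bounded Borel set, outside which the second
    variable of a double integral contributes nothing. *)
Lemma setsub_sup B K : compact K -> precompact B ->
  exists E, [/\ bounded_borel E, B `<=` E, setsub B K `<=` E & setadd B K `<=` E].
Proof.
move=> cK [L BL [cL clL]].
exists ((setsub L K `|` setadd L K) `|` L); split.
- apply: bounded_borelU; last exact: bounded_borel_compact.
  by apply: bounded_borelU; apply: bounded_borel_compact => //;
    [exact: setsub_compact|exact: setadd_compact].
- by move=> x /BL; right.
- by move=> _ [b /BL Lb [k Kk <-]]; left; left; exists b => //; exists k.
- by move=> _ [b /BL Lb [k Kk <-]]; left; right; exists b => //; exists k.
Qed.

(** The transform with the conjugate character, natural for Fourier-Bohr coefficients. On a
    reflected test function it becomes [inverse_fourier]. *)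
Definition ft phi (chi : G -> R[i]) : R[i] :=
  cintegral theta (fun t => (chi t)^*%C * phi t).

(** Exchanging the integrals leaves the function [k] to be integrated against [mu]. If [s + K] lies
    in [B], the integral defining [k s] is complete and equals [ft phi chi] times the conjugate of
    [chi s]; if [s + K] misses [B], then [k s] is 0. Only straddling points contribute to the
    error. *)
Lemma fourier_bohr_conv phi (chi : G -> R[i]) : Cc phi -> is_character chi ->
  exists (C : R) K, [/\ 0 <= C, compact K & forall B, open B -> precompact B ->
    cabs (cintegral theta (cut B (fun t => (chi t)^*%C * conv_meas mu phi t)) -
      ft phi chi * cm_integral mu (cut B (fun t => (chi t)^*%C))) <=
    C * vol theta (vh_boundary K B)].
Proof.
move=> cphi cchi; have bphi := Cc_buc cphi; have bchi := bucJ (character_buc cchi).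
have [_ chiD chi1] := cchi.
have ca x : cabs (chi x) = 1 by rewrite /cabs chi1.
have [[M fM] _] := bphi.
have M0 : 0 <= M by rewrite (le_trans _ (fM 0))// cabs_ge0.
have [K0 cK0 sK0] := Cc_supp cphi; have [K sK KK] := sym_compact_ex cK0.
have [cK K00 KN] := sK.
have s0 x : ~ K x -> phi x = 0 by move=> nK; apply: sK0 => /KK.
have [C [K' [C0 cK' H]]] := straddle_estimate sK.
pose M1 := 2 * vol theta K * M.
have M10 : 0 <= M1 by rewrite !mulr_ge0// vol_ge0.
exists (C * (M1 + M1)), K'; split=> //; first by rewrite mulr_ge0// addr_ge0.
move=> B oB pB.
have bB : bounded_borel B by split=> //; exact: open_borel.
have mB : measurable (B : set (borel G)) by case: bB.
have [E [bE BE BKE _]] := setsub_sup cK pB.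
pose Phi t s := (chi t)^*%C * phi (t - s).
have bPhi : buc2 Phi by apply: buc2M; [exact: buc2_fst|exact: buc2_sub].
pose k s := cintegral theta (cut B (fun t => Phi t s)).
have bk : buc k by exact: (buc_locfun Th (buc2_swap bPhi) bB).
have Phib t s : cabs (Phi t s) <= M by rewrite cabsM cabsJ ca mul1r.
have -> : cintegral theta (cut B (fun t => (chi t)^*%C * conv_meas mu phi t)) =
    cm_integral mu (cut E k).
  rewrite -(fubini Th I bPhi bB bE); congr cintegral; apply: cut_eq => t Bt.
  rewrite (@conv_cut phi K E)//; last first.
    by move=> s Ks; apply: BKE; exists t => //; exists (t - s) => //; rewrite opprB addrC subrK.
  rewrite -(locfun_cutZ I bE)//; apply: buc_bmeas; exact: buc_subl.
have ftE s : (chi s)^*%C * ft phi chi = cintegral theta (fun t => Phi t s).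
  have bF : bmeas (fun t => Phi t s) by apply: buc_bmeas; exact: buc2_l bPhi.
  rewrite -(haar_translate haar s bF) /ft.
  have bKK := bounded_borel_compact hG cK.
  have h g : (forall x, ~ K x -> g x = 0) -> g = cut K g by move=> g0; rewrite cut_id.
  have e1 : (fun t => (chi t)^*%C * phi t) = cut K (fun t => (chi t)^*%C * phi t).
    by apply: h => x /s0 ->; rewrite mulr0.
  rewrite e1 -(locfun_cutZ Th bKK); last by apply: buc_bmeas; exact: bucM.
  rewrite cut_id; last by move=> x /s0 ->; rewrite !mulr0.
  congr cintegral; apply/funext => t.
  by rewrite /Phi chiD cJM -!mulrA [s + t]addrC addrK.
rewrite [ft _ _ * _]mulrC.
have -> : cm_integral mu (cut B (fun t => (chi t)^*%C)) * ft phi chi =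
    cm_integral mu (cut E (cut B (fun s => ft phi chi * (chi s)^*%C))).
  by rewrite -cut_cut// (locfun_cutZ I bB) 1?mulrC//; exact: buc_bmeas.
have bm2 : bmeas (cut B (fun s => ft phi chi * (chi s)^*%C)).
  by apply: bmeas_cut => //; apply: bmeasZ; exact: buc_bmeas.
rewrite -(locfun_cutB I bE)//; last exact: buc_bmeas.
have kb s : cabs (k s) <= M1.
  apply: (@cintegral_supp _ K M s) => //.
  - by apply: bmeas_cut => //; apply: buc_bmeas; exact: buc2_l bPhi.
  - by move=> t; rewrite cutE; case: ifP => _; rewrite ?cabs0.
  - move=> t; rewrite cutE; case: ifP => // _; apply: contra_notP => nK.
    by rewrite /Phi s0// mulr0.
have fb s : cabs (ft phi chi * (chi s)^*%C) <= M1.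
  rewrite mulrC ftE; apply: (@cintegral_supp _ K M s) => //.
  - by apply: buc_bmeas; exact: buc2_l bPhi.
  - by move=> t; apply: contra_notP => nK; rewrite /Phi s0// mulr0.
apply: H => //.
- by apply: bmeas_cut; [case: bE|apply: bmeasB => //; exact: buc_bmeas].
- exact: addr_ge0.
- move=> s; rewrite cutE; case: ifP => _; last by rewrite cabs0 addr_ge0.
  rewrite (le_trans (cabsB _ _))// lerD//.
  by rewrite cutE; case: ifP => _; rewrite ?cabs0.
move=> s; apply: contra_notP => ns; have [Es|Es] := pselect (E s); last by rewrite cut_out.
rewrite cut_in//.
have [Bs|Bs] := pselect (B s).
  have all t : K (t - s) -> B t.
    move=> Kt; apply: contrapT => nB; apply: ns; split; first by exists 0; rewrite ?addr0.
    by exists (t - s) => //; rewrite addrC subrK.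
  rewrite cut_in// mulrC ftE /k cut_id ?subrr// => t nBt.
  by rewrite /Phi s0 ?mulr0// => /all.
have all t : K (t - s) -> ~ B t.
  move=> Kt Bt; apply: ns; split; last by exists 0; rewrite ?addr0.
  by exists (t - s) => //; rewrite addrC subrK.
rewrite [X in _ - X]cut_out// subr0 /k -[RHS](locfun_cut0 Th bB); congr cintegral.
by apply: cut_eq => t Bt; rewrite /Phi s0 ?mulr0// => /all.
Qed.

End convolution_estimates.

(** * The autocorrelation on a set as the integral of a product of convolutions *)

Section autocorrelation_estimates.
Context (R : realType) (G : topologicalZmodType) (hG : hausdorff_space G).
Context (lcG : locally_compact [set: G]).
Context (theta : radon_measure R G) (haar : is_haar theta).
Context (mu : cmeasure R G) (mu_tb : translation_bounded mu).
Implicit Types (f g phi psi : G -> R[i]) (A B E F K L U V W : set G).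

Let I := locfun_cm hG mu.
Let J := locfunJ I.
Let Th := locfun_cintegral hG theta.

(** Integration against the conjugate measure, without reflection. *)
Definition cm_conj g : R[i] := (cm_integral mu (fun x => (g x)^*%C))^*%C.

(** The reflections in the definition of the autocorrelation cancel: this is the integral of
    [g (s - t)] over [B * B] against [mu] in [s] and its conjugate in [t], before division by the
    volume. *)
Definition gamma_on B g : R[i] :=
  cm_integral mu (cut B (fun s => cm_conj (cut B (fun t => g (s - t))))).

Lemma fun_convE B g :
  fun_conv (fun_restrict (cm_integral mu) B)
    (fun_restrict (fun_tilde (cm_integral mu)) (-%R @` B)) g = gamma_on B g.
Proof.
rewrite /fun_conv /fun_restrict /gamma_on -/(cut B _); congr (cm_integral mu (cut B _)).
apply/funext => s; rewrite /fun_tilde /cm_conj; congr (_^*)%C; congr cm_integral.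
apply/funext => t; rewrite /tilde; congr (_^*)%C.
rewrite -/(cut _ _); have [Bt|Bt] := pselect (B t).
  by rewrite !cut_in//; exists t.
rewrite !cut_out//; move=> [u Bu /oppr_inj ut]; apply: Bt; by rewrite -ut.
Qed.

Definition reflect phi : G -> R[i] := fun x => phi (- x).

Lemma reflect_Cc phi : Cc phi -> Cc (reflect phi).
Proof.
move=> cphi; have [K cK sK] := Cc_supp cphi.
apply: (@Cc_sub _ _ hG _ (-%R @` K)).
- by apply: buc_cont; apply: bucN; exact: Cc_buc.
- exact: opp_compact.
- move=> x nx; apply: sK => Kx; apply: nx; exists (- x) => //; exact: opprK.
Qed.

(** The convolution is opened as an integral over [y], and two applications of Fubini's theorem
    leave the product of [H1] and the conjugate of [H2]. It agrees with the product of the full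
    convolutions where [y + K] lies in [B] and is 0 where [y + K] misses [B]; in between all factors
    are bounded independently of [B]. *)
Lemma gamma_conv phi psi : Cc phi -> Cc psi -> exists (C : R) K, [/\ 0 <= C, compact K &
  forall B, open B -> precompact B ->
  cabs (gamma_on B (Defs.conv theta phi (tilde psi)) -
    cintegral theta (cut B (fun y => conv_meas mu (reflect phi) y *
       (conv_meas mu (reflect psi) y)^*%C))) <= C * vol theta (vh_boundary K B)].
Proof.
move=> cphi cpsi; have bphi := Cc_buc cphi; have bpsi := Cc_buc cpsi.
have crphi := reflect_Cc cphi; have crpsi := reflect_Cc cpsi.
have [K1 cK1 sK1] := Cc_supp cphi; have [K2 cK2 sK2] := Cc_supp cpsi.
have [K sK KK] := sym_compact_ex (compactU cK1 cK2).
have [cK K00 KN] := sK.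
have s1 x : ~ K x -> phi x = 0 by move=> nK; apply: sK1 => h; apply: nK; apply: KK; left.
have s2 x : ~ K x -> psi x = 0 by move=> nK; apply: sK2 => h; apply: nK; apply: KK; right.
have [C1 [C10 HC1]] := conv_bound hG haar mu_tb crphi.
have [C2 [C20 HC2]] := conv_bound hG haar mu_tb crpsi.
exists (2 * (C1 * C2 + C1 * C2)), K; split=> //.
  by rewrite mulr_ge0// addr_ge0// mulr_ge0.
move=> B oB pB.
have bB : bounded_borel B by split=> //; exact: open_borel.
have mB : measurable (B : set (borel G)) by case: bB.
have [L [bL BL BKL _]] := setsub_sup hG cK pB.
have mL : measurable (L : set (borel G)) by case: bL.
(* Since [phi (s - y)] is [reflect phi (y - s)], these are convolutions of [mu] restricted to [B]
   with the reflected test functions. *)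
pose H1 y := cm_integral mu (cut B (fun s => phi (s - y))).
pose H2 y := cm_integral mu (cut B (fun s => psi (s - y))).
have bH1 : buc H1 by exact: (buc_locfun I (buc2_swap (buc2_sub bphi)) bB).
have bH2 : buc H2 by exact: (buc_locfun I (buc2_swap (buc2_sub bpsi)) bB).
have gE : gamma_on B (Defs.conv theta phi (tilde psi)) =
    cintegral theta (cut L (fun y => H1 y * (H2 y)^*%C)).
  (* Translating the variable of integration by [- t] makes the integrand a function of [s - y]
     times one of [t - y]; [y] is confined to [L] because [L] contains [B - K]. *)
  have e1 s t : B s -> Defs.conv theta phi (tilde psi) (s - t) =
      cintegral theta (cut L (fun y => phi (s - y) * (psi (t - y))^*%C)).
    move=> Bs; rewrite /Defs.conv /tilde.
    have bF : bmeas (fun y : G => phi (s - t - y) * (psi (- y))^*%C).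
      apply: buc_bmeas; apply: bucM; first exact: (buc2_r (s - t) (buc2_sub bphi)).
      by apply: bucJ; exact: bucN.
    rewrite -(haar_translate haar (- t) bF); congr cintegral.
    rewrite cut_id; last first.
      move=> y nL; rewrite s1 ?mul0r// => Ky; apply: nL; apply: BKL.
      by exists s => //; exists (s - y) => //; rewrite opprB addrC subrK.
    apply/funext => y; congr (phi _ * (psi _)^*%C); last by rewrite opprD opprK.
    by rewrite opprD opprK addrA subrK.
  rewrite /gamma_on.
  have e2 s : B s -> cm_conj (cut B (fun t => Defs.conv theta phi (tilde psi) (s - t))) =
      cintegral theta (cut L (fun y => phi (s - y) * (H2 y)^*%C)).
    move=> Bs.
    have -> : cut B (fun t => Defs.conv theta phi (tilde psi) (s - t)) =
        cut B (fun t => cintegral theta (cut L (fun y => phi (s - y) * (psi (t - y))^*%C))).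
      by apply: cut_eq => t _; exact: e1.
    have b2 : buc2 (fun t y => phi (s - y) * (psi (t - y))^*%C).
      apply: buc2M; first by apply: buc2_snd; exact: buc_subl.
      have [[M2 hM2] u2] := buc2_sub bpsi.
      split; first by exists M2 => a b; rewrite cabsJ.
      move=> e /u2[U [U0 [U1 U2]]]; exists U; split=> //; split=> a b c h;
        rewrite -rmorphB /= cabsJ; [exact: U1|exact: U2].
    rewrite [LHS](fubini J Th b2 bB bL); congr cintegral; apply: cut_eq => y Ly.
    rewrite (locfun_cutZ J bB); last first.
      by apply: buc_bmeas; apply: bucJ; exact: (buc2_l y (buc2_sub bpsi)).
    congr (_ * _); rewrite /H2; congr (_^*)%C; congr cm_integral.
    by rewrite -cutJ; congr (cut B _); apply/funext => t; rewrite conjcK.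
  have -> : cut B (fun s => cm_conj (cut B (fun t => Defs.conv theta phi (tilde psi) (s - t)))) =
     cut B (fun s => cintegral theta (cut L (fun y => phi (s - y) * (H2 y)^*%C))).
    by apply: cut_eq => s; exact: e2.
  have b3 : buc2 (fun s y => phi (s - y) * (H2 y)^*%C).
    by apply: buc2M; [exact: buc2_sub|apply: buc2_snd; exact: bucJ].
  rewrite (fubini I Th b3 bB bL); congr cintegral; apply: cut_eq => y Ly.
  rewrite mulrC -(locfun_cutZ I bB); last first.
    by apply: buc_bmeas; exact: (buc2_l y (buc2_sub bphi)).
  by congr (cm_integral mu (cut B _)); apply/funext => s; rewrite mulrC.
rewrite gE.
pose f1 := conv_meas mu (reflect phi); pose f2 := conv_meas mu (reflect psi).
have bf1 : buc f1 by apply: (conv_buc hG lcG haar mu_tb).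
have bf2 : buc f2 by apply: (conv_buc hG lcG haar mu_tb).
have H1E y : H1 y = cm_integral mu (cut B (fun s => reflect phi (y - s))).
  by rewrite /H1 /reflect; congr (cm_integral mu (cut B _)); apply/funext => s; rewrite opprB.
have H2E y : H2 y = cm_integral mu (cut B (fun s => reflect psi (y - s))).
  by rewrite /H2 /reflect; congr (cm_integral mu (cut B _)); apply/funext => s; rewrite opprB.
have f1b y : cabs (f1 y) <= C1.
  by rewrite /f1 /conv_meas -[X in cm_integral _ X]cut_setT; exact: HC1.
have f2b y : cabs (f2 y) <= C2.
  by rewrite /f2 /conv_meas -[X in cm_integral _ X]cut_setT; exact: HC2.
have h1b y : cabs (H1 y) <= C1 by rewrite H1E; exact: HC1.
have h2b y : cabs (H2 y) <= C2 by rewrite H2E; exact: HC2.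
have bm1 : bmeas (fun y => H1 y * (H2 y)^*%C).
  by apply: buc_bmeas; apply: bucM => //; exact: bucJ.
have bm2 : bmeas (fun y => f1 y * (f2 y)^*%C).
  by apply: buc_bmeas; apply: bucM => //; exact: bucJ.
rewrite -/f1 -/f2 (cut_cut (fun y => f1 y * (f2 y)^*%C) BL).
rewrite -(locfun_cutB Th bL)//; last exact: bmeas_cut.
set D := (fun y => _).
have Ds y : D y <> 0 -> straddle K B y.
  rewrite /D; apply: contra_notP => ns; have [By|By] := pselect (B y).
    have all s : K (s - y) -> B s.
      move=> Ks; apply: contrapT => nB; apply: ns; split; first by exists 0; rewrite ?addr0.
      by exists (s - y) => //; rewrite addrC subrK.
    rewrite cut_in// H1E H2E !cut_id ?subrr// => s nBs; rewrite /reflect opprB.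
      by rewrite s2// => /all.
    by rewrite s1// => /all.
  have all s : K (s - y) -> ~ B s.
    move=> Ks Bs; apply: ns; split; last by exists 0; rewrite ?addr0.
    by exists (s - y) => //; rewrite addrC subrK.
  rewrite cut_out// subr0 /H1 (_ : cm_integral _ _ = 0) ?mul0r//.
  rewrite -[RHS](locfun_cut0 I bB); congr cm_integral.
  by apply: cut_eq => t Bt; rewrite s1// => /all.
have Db y : cabs (D y) <= C1 * C2 + C1 * C2.
  rewrite (le_trans (cabsB _ _))// lerD//.
    by rewrite cabsM cabsJ ler_pM// cabs_ge0.
  rewrite cutE; case: ifP => _; last by rewrite cabs0 mulr_ge0.
  by rewrite cabsM cabsJ ler_pM// cabs_ge0.
have bD : bmeas D by apply: bmeasB => //; exact: bmeas_cut.
have bd := boundary_bounded hG cK pB.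
have -> : cut L D = cut (vh_boundary K B) (cut L D).
  rewrite [RHS]cut_id// => y ny; rewrite cutE; case: ifP => // _.
  by apply/eqP/negPn/negP => /eqP/Ds/(straddle_boundary sK).
rewrite -mulrA [X in _ <= _ * X]mulrC mulrA.
apply: cintegral_bound => //; first by apply: bmeas_cut.
  by rewrite addr_ge0// mulr_ge0.
by move=> y _; rewrite cutE; case: ifP => // _; rewrite cabs0 addr_ge0// mulr_ge0.
Qed.

Lemma gamma_linear B a f g : open B -> precompact B -> buc f -> buc g ->
  gamma_on B (fun x => a * f x + g x) = a * gamma_on B f + gamma_on B g.
Proof.
move=> oB pB bf bg; have bB : bounded_borel B by split=> //; exact: open_borel.
have b (s : G) (h : G -> R[i]) : buc h -> bmeas (fun t : G => h (s - t)).
  by move=> bh; apply: buc_bmeas; exact: (buc2_r s (buc2_sub bh)).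
have b' (h : G -> R[i]) : buc h -> bmeas (fun s : G => cm_conj (cut B (fun t : G => h (s - t)))).
  by move=> bh; apply: buc_bmeas; exact: (buc_locfun J (buc2_sub bh) bB).
rewrite /gamma_on -I.1//; [|exact: b'|exact: b'].
congr (cm_integral mu (cut B _)); apply/funext => s.
by rewrite [LHS](J.1 B a _ _ bB (b s f bf) (b s g bg)).
Qed.

(** The inner integral is bounded uniformly in [s] by [conv_estimate], as [g (s - t)] forces [t]
    into [s - K]; the outer one is then of the order of the volume. This continuity in [g] carries
    the approximate identity and the Riesz theorem. *)
Lemma gamma_bound K : compact K -> exists (C : R) K', [/\ 0 <= C, compact K' &
  forall g (M : R) B, open B -> precompact B -> buc g -> 0 <= M ->
    (forall x, cabs (g x) <= M) -> (forall x, ~ K x -> g x = 0) ->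
  cabs (gamma_on B g) <= C * M * (vol theta B + vol theta (vh_boundary K' B))].
Proof.
move=> cK; have [C1 [C10 H1]] := conv_estimate hG haar mu_tb cK.
have [C2 [K' [C20 [cK' _ _] H2]]] := restrict_estimate hG haar mu_tb.
exists (C2 * C1), K'; split=> //; first exact: mulr_ge0.
move=> g M B oB pB bg M0 gM gK.
have bB : bounded_borel B by split=> //; exact: open_borel.
rewrite -(mulrA C2); apply: H2 => //.
- by apply: buc_bmeas; exact: (buc_locfun J (buc2_sub bg) bB).
- exact: mulr_ge0.
move=> s; rewrite /cm_conj cabsJ; apply: (H1 _ _ s) => //.
- by apply: bmeasJ; apply: bmeas_cut; [case: bB|apply: buc_bmeas; exact: (buc2_r s (buc2_sub bg))].
- by move=> t; rewrite cabsJ cutE; case: ifP => _; rewrite ?cabs0.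
- move=> t; apply: contra_notP => nK; rewrite cutE; case: ifP => _; rewrite ?conjc0//.
  by rewrite gK ?conjc0.
Qed.

End autocorrelation_estimates.

(** * Trigonometric polynomials and Parseval's identity *)

Lemma complex_hausdorff (R : realType) : hausdorff_space R[i].
Proof. exact: (@norm_hausdorff (R[i] : numFieldType) (R[i] : normedModType R[i])). Qed.

Section limits_along_van_hove_sequences.
Context (R : realType) (G : topologicalZmodType) (theta : radon_measure R G).

Lemma van_hove_lim_unique (u : set G -> R[i]) (B B' : nat -> set G) (l l' : R[i]) :
  (forall C, van_hove theta C -> exists m : R[i], u (C n) @[n --> \oo] --> m) ->
  van_hove theta B -> van_hove theta B' ->
  u (B n) @[n --> \oo] --> l -> u (B' n) @[n --> \oo] --> l' -> l = l'.
Proof.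
move=> H hB hB' ul ul'; have [m um] := H _ (van_hove_interleave hB hB').
have e : interleave (fun n => u (B n)) (fun n => u (B' n)) = fun n => u (interleave B B' n).
  by apply/funext => n; rewrite /interleave; case: (odd n).
apply: (@interleave_lim R[i] (@complex_hausdorff R) (fun n => u (B n)) (fun n => u (B' n)) m l l' _ ul ul').
by rewrite e.
Qed.

(** Completeness in the form in which it is used: for each [e], an approximant with convergent
    averages supplies a point [l]. *)
Lemma complex_cauchy (u : nat -> R[i]) :
  (forall e : R, 0 < e -> exists l : R[i], \forall n \near \oo, cabs (u n - l) < e) ->
  exists l : R[i], u @ \oo --> l.
Proof.
move=> H.
have hr (p : R[i] -> R) : (forall a b, `|p a - p b| <= cabs (a - b)) ->
    exists l : R, (p (u n)) @[n --> \oo] --> l.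
  move=> hp; suff /cvg_ex[l ul] : cvg ((fun n => p (u n)) @ \oo) by exists l.
  apply/cauchy_cvgP; apply/cauchy_ballP => e e0.
  have [l [N _ HN]] := H _ (divr_gt0 e0 (@ltr0Sn R 1)).
  exists ([set x | exists2 n, (N <= n)%N & x = p (u n)],
      [set x | exists2 n, (N <= n)%N & x = p (u n)]).
    by split; exists N => // n Nn; exists n.
  move=> [x y] /= [[n Nn ->] [m Nm ->]].
  rewrite /ball /= (le_lt_trans (hp _ _))// (le_lt_trans (cabs_tri l _ _))//.
  by rewrite (splitr e) ltrD//; [exact: HN|rewrite cabsC; exact: HN].
have [a ua] := hr (@complex.Re R) (fun a b => ltac:(by rewrite -cReN -cReD; exact: Re_cabs)).
have [b ub] := hr (@complex.Im R) (fun a b => ltac:(by rewrite -cImN -cImD; exact: Im_cabs)).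
exists (Complex a b); apply/cvgCP => e e0.
have e2 : 0 < e / 2 by rewrite divr_gt0.
have /cvgrPdist_lt/(_ _ e2) h1 := ua; have /cvgrPdist_lt/(_ _ e2) h2 := ub.
near=> n; rewrite (le_lt_trans (cabs_ReIm _))// cReD cImD cReN cImN /= (splitr e) ltrD//.
  by near: n.
by near: n.
Unshelve. all: by end_near. Qed.

Lemma cvgC_near (u : nat -> R[i]) (l : R[i]) :
  (u @ \oo --> l) <-> (forall e : R, 0 < e -> \forall n \near \oo, cabs (u n - l) < e).
Proof.
split=> [/cvgCP h e /h|h].
  by apply: filterS => n; rewrite cabsC.
by apply/cvgCP => e /h; apply: filterS => n; rewrite cabsC.
Qed.

Lemma cvgCD (u v : nat -> R[i]) (a b : R[i]) : u @ \oo --> a -> v @ \oo --> b ->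
  (u n + v n) @[n --> \oo] --> a + b.
Proof.
move=> /cvgC_near ua /cvgC_near vb; apply/cvgC_near => e e0.
have e2 : 0 < e / 2 by rewrite divr_gt0.
have h1 := ua _ e2; have h2 := vb _ e2; near=> n.
rewrite opprD addrACA (le_lt_trans (cabsD _ _))// (splitr e) ltrD//; first by near: n.
by near: n.
Unshelve. all: by end_near. Qed.

Lemma cvgCZ c (u : nat -> R[i]) (a : R[i]) : u @ \oo --> a -> (c * u n) @[n --> \oo] --> c * a.
Proof.
move=> /cvgC_near ua; apply/cvgC_near => e e0.
have c0 : 0 < cabs c + 1 by rewrite ltr_wpDl ?cabs_ge0.
have := ua _ (divr_gt0 e0 c0); apply: filterS => n h.
rewrite -mulrBr cabsM; move: h; rewrite ltr_pdivlMr// => /le_lt_trans; apply.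
by rewrite mulrC ler_wpM2l ?cabs_ge0// lerDl.
Qed.

Lemma cvgCJ (u : nat -> R[i]) (a : R[i]) : u @ \oo --> a -> ((u n)^*%C) @[n --> \oo] --> (a^*)%C.
Proof.
move=> /cvgC_near ua; apply/cvgC_near => e /ua; apply: filterS => n.
by rewrite -rmorphB /= cabsJ.
Qed.

Lemma cvgC_cst (a : R[i]) : ((fun=> a) : nat -> R[i]) @ \oo --> a.
Proof. exact: cvg_cst. Qed.

Lemma cvgC_sum J (s : seq J) (u : J -> nat -> R[i]) (a : J -> R[i]) :
  (forall j, u j @ \oo --> a j) ->
  (\sum_(j <- s) u j n) @[n --> \oo] --> \sum_(j <- s) a j.
Proof.
move=> ua; elim: s => [|j s IH].
  rewrite big_nil (_ : (fun n => _) = fun=> 0); first exact: cvgC_cst.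
  by apply/funext => n; rewrite big_nil.
rewrite big_cons (_ : (fun n => _) = fun n => u j n + \sum_(j <- s) u j n).
  exact: (cvgCD (ua j) IH).
by apply/funext => n; rewrite big_cons.
Qed.

Lemma cvgC_unique (u : nat -> R[i]) (a b : R[i]) : u @ \oo --> a -> u @ \oo --> b -> a = b.
Proof. by move=> ua ub; exact: (cvg_unique (@complex_hausdorff R) ua ub). Qed.

Lemma cvgC_close (u v : nat -> R[i]) (a : R[i]) :
  (forall e : R, 0 < e -> \forall n \near \oo, cabs (u n - v n) < e) ->
  u @ \oo --> a -> v @ \oo --> a.
Proof.
move=> uv /cvgC_near ua; apply/cvgC_near => e e0.
have e2 : 0 < e / 2 by rewrite divr_gt0.
have h1 := ua _ e2; have h2 := uv _ e2; near=> n.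
rewrite (le_lt_trans (cabs_tri (u n) _ _))// (splitr e) ltrD//; last by near: n.
by rewrite cabsC; near: n.
Unshelve. all: by end_near. Qed.

Lemma cvgC_cabs_le (u : nat -> R[i]) (a : R[i]) (C : R) : u @ \oo --> a ->
  (\forall n \near \oo, cabs (u n) <= C) -> cabs a <= C.
Proof.
move=> /cvgC_near ua uC; apply/ler_addgt0Pr => e e0.
have := filterI (ua e e0) uC => -[N _ HN]; have [/ltW h1 h2] := HN N (leqnn N).
have := cabsD (a - u N) (u N); rewrite subrK => /le_trans; apply.
by rewrite addrC lerD// cabsC.
Qed.

End limits_along_van_hove_sequences.

Section trigonometric_polynomials.
Context (R : realType) (G : topologicalZmodType) (hG : hausdorff_space G).
Context (theta : radon_measure R G) (haar : is_haar theta).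
Implicit Types (f g P Q : G -> R[i]) (chi omega : dual R G).

Definition mk_dual (c : G -> R[i]) (h : is_character c) : dual R G :=
  exist _ (c : {compact-open, G -> R[i]}) (mem_set h).

Lemma dual_character chi : is_character chi.
Proof. exact: set_mem (projT2 chi). Qed.

Lemma dual_eq chi omega : (forall x, chi x = omega x) -> chi = omega.
Proof. by move=> h; apply: val_inj; apply/funext. Qed.

Lemma cabs_chi chi x : cabs (chi x) = 1.
Proof. by have [_ _ h] := dual_character chi; rewrite /cabs h. Qed.

Lemma dual_buc chi : buc chi.
Proof. by apply: character_buc; exact: dual_character. Qed.

Lemma mulJ_chi chi x : chi x * (chi x)^*%C = 1.
Proof. by rewrite mulJ cabs_chi expr1n. Qed.

Lemma character_mul (c d : G -> R[i]) : is_character c -> is_character d ->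
  is_character (fun x => c x * d x).
Proof.
move=> hc hd; have [cc cD c1] := hc; have [dc dD d1] := hd; split.
- by apply: buc_cont; apply: bucM; exact: character_buc.
- by move=> x y; rewrite cD dD mulrACA.
- by move=> x; rewrite normrM c1 d1 mulr1.
Qed.

Lemma character_conj (c : G -> R[i]) : is_character c ->
  is_character (fun x => (c x)^*%C).
Proof.
move=> hc; have [cc cD c1] := hc; split.
- by apply: buc_cont; apply: bucJ; exact: character_buc.
- by move=> x y; rewrite cD cJM.
- by move=> x; rewrite normCE cabsJ -normCE c1.
Qed.

(** With lists in place of indexed families, sums and products of polynomials become concatenations
    and pairings of lists. *)
Lemma trig_polyP P : is_trig_poly P <-> exists s : seq (R[i] * dual R G),
  P = fun x => \sum_(p <- s) p.1 * p.2 x.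
Proof.
split=> [[n [c [chi ->]]]|[s ->]].
  exists [seq (c i, chi i) | i <- index_enum 'I_n]; apply/funext => x.
  by rewrite big_map.
case: s => [|p0 s].
  exists 0%N, (fun=> 0), (fun=> mk_dual (set_mem (trivial_character R G))).
  by apply/funext => x; rewrite big_nil big_ord0.
exists (size (p0 :: s)), (fun i => (nth p0 (p0 :: s) i).1), (fun i => (nth p0 (p0 :: s) i).2).
by apply/funext => x; rewrite (big_nth p0) big_mkord.
Qed.

Lemma trig_poly_chi chi : is_trig_poly chi.
Proof.
apply/trig_polyP; exists [:: (1, chi)]; apply/funext => x.
by rewrite big_seq1 mul1r.
Qed.

Lemma trig_polyD P Q : is_trig_poly P -> is_trig_poly Q ->
  is_trig_poly (fun x => P x + Q x).
Proof.
move=> /trig_polyP[s ->] /trig_polyP[t ->]; apply/trig_polyP; exists (s ++ t).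
by apply/funext => x; rewrite big_cat.
Qed.

Lemma trig_polyM P Q : is_trig_poly P -> is_trig_poly Q ->
  is_trig_poly (fun x => P x * Q x).
Proof.
move=> /trig_polyP[s ->] /trig_polyP[t ->]; apply/trig_polyP.
pose m (p q : R[i] * dual R G) := (p.1 * q.1,
  mk_dual (character_mul (dual_character p.2) (dual_character q.2))).
exists [seq m p q | p <- s, q <- t]; apply/funext => x.
rewrite big_allpairs_dep mulr_suml; apply: eq_bigr => p _.
rewrite mulr_sumr; apply: eq_bigr => q _.
by rewrite /m /= mulrACA.
Qed.

Lemma trig_polyJ P : is_trig_poly P -> is_trig_poly (fun x => (P x)^*%C).
Proof.
move=> /trig_polyP[s ->]; apply/trig_polyP.
exists [seq (p.1^*%C, mk_dual (character_conj (dual_character p.2))) | p <- s].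
apply/funext => x; rewrite big_map rmorph_sum; apply: eq_bigr => p _.
exact: cJM.
Qed.

Lemma trig_poly_cst c : is_trig_poly ((fun=> c) : G -> R[i]).
Proof.
apply/trig_polyP; exists [:: (c, mk_dual (set_mem (trivial_character R G)))].
by apply/funext => x; rewrite big_seq1 /= mulr1.
Qed.

Lemma trig_polyX P n : is_trig_poly P -> is_trig_poly (fun x => P x ^+ n).
Proof.
move=> tP; elim: n => [|n IH]; first exact: trig_poly_cst.
by under eq_fun do rewrite exprS; exact: trig_polyM.
Qed.

Lemma trig_polyB P Q : is_trig_poly P -> is_trig_poly Q ->
  is_trig_poly (fun x => P x - Q x).
Proof.
move=> tP tQ; have := trig_polyD tP (trig_polyM (trig_poly_cst (-1)) tQ).
by under eq_fun do rewrite mulN1r.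
Qed.

Lemma trig_poly_buc P : is_trig_poly P -> buc P.
Proof.
by move=> /trig_polyP[s ->]; apply: buc_sum => p; apply: bucZ; exact: dual_buc.
Qed.

Lemma avg_chi_mul (B : nat -> set G) chi omega : van_hove theta B ->
  cvg_avg theta B (fun x => chi x * (omega x)^*%C) (chi == omega)%:R.
Proof.
move=> hB; have [->|co] := eqVneq.
  apply: cvg_near_cst; apply: nearW => n; have [_ _ bB B0] := vH_basic hG n hB.
  rewrite -(avg_cst hG bB B0 1); congr (avg _ _ _); apply/funext => x.
  exact: mulJ_chi.
apply: (avg_character hG haar hB).
  by apply: character_mul; [exact: dual_character|apply: character_conj; exact: dual_character].
apply: contrapT => h; move: co; apply/negP; rewrite negbK; apply/eqP/dual_eq => x.
have e : chi x * (omega x)^*%C = 1 by apply: contrapT => nx; apply: h; exists x.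
by rewrite -[RHS]mul1r -e -mulrA [_^*%C * _]mulrC mulJ_chi mulr1.
Qed.

Lemma avg_trig_poly P : is_trig_poly P -> exists m, forall B, van_hove theta B ->
  cvg_avg theta B P m.
Proof.
pose one := mk_dual (set_mem (trivial_character R G)).
move=> /trig_polyP[s ->]; exists (\sum_(p <- s) p.1 * (p.2 == one)%:R) => B hB.
rewrite /cvg_avg (_ : (fun n => _) = fun n => \sum_(p <- s) p.1 *
    avg theta (B n) (fun x => p.2 x * (one x)^*%C)); last first.
  apply/funext => n; have [_ _ bB B0] := vH_basic hG n hB.
  rewrite (avg_sum hG theta bB); last by move=> p; apply: bmeasZ; apply: buc_bmeas; exact: dual_buc.
  apply: eq_bigr => p _; rewrite (avgZ hG theta bB); last by apply: buc_bmeas; exact: dual_buc.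
  by congr (_ * avg _ _ _); apply/funext => x; rewrite (_ : one x = 1)// (rmorph1 (@conjc R)) mulr1.
by apply: cvgC_sum => p; apply: cvgCZ; exact: avg_chi_mul.
Qed.

End trigonometric_polynomials.

(** * From the Weyl seminorm to approximation in mean and in mean square *)

Section weyl_almost_periodic_functions.
Context (R : realType) (G : topologicalZmodType) (hG : hausdorff_space G).
Context (theta : radon_measure R G) (haar : is_haar theta).
Implicit Types (f g P Q : G -> R[i]) (chi omega : dual R G).

(** The polynomial is chosen before the van Hove sequence; only the index from which the bound holds
    depends on the sequence. *)
Definition mean_approx f := forall e : R, 0 < e -> exists P, is_trig_poly P /\
  forall B, van_hove theta B ->
    \forall n \near \oo, aavg theta (B n) (fun t => f t - P t) < e.

Definition mean2_approx f := forall e : R, 0 < e -> exists P, is_trig_poly P /\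
  forall B, van_hove theta B ->
    \forall n \near \oo, aavg theta (B n) (sqabs (fun t => f t - P t)) < e.

Lemma weyl_termE B x f : open B -> precompact B -> bmeas f ->
  (((vol theta B)^-1)%:E *
     \int[theta]_(t in (translate x B : set (borel G))) (cabs (f t))%:E)%E =
  (aavg theta (translate x B) f)%:E.
Proof.
move=> oB pB bf; have bB : bounded_borel B by split=> //; exact: open_borel.
have bxB := translate_bounded_borel x bB; have [mB _] := bB; have [mxB _] := bxB.
rewrite /aavg (vol_translate haar)// EFinM /Rintegral fineK//.
by apply: integrable_fin_num => //; exact: cabs_integrable.
Qed.

Lemma translate_avg B x f : bounded_borel B -> bmeas f ->
  avg theta (translate x B) f = avg theta B (fun t => f (x + t)).
Proof.
move=> bB bf; have [mB _] := bB; rewrite /avg (vol_translate haar)//; congr (_ * _).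
rewrite -(haar_translate haar x); last first.
  by apply: bmeas_cut => //; exact: translate_measurable.
congr cintegral; apply/funext => t; rewrite !cutE.
have -> // : (x + t \in translate x B) = (t \in B).
by rewrite translateE; apply/idP/idP; rewrite !inE /= addKr.
Qed.

(** A small Weyl seminorm yields one index [N] at which the averages over all translates of [A N]
    are small. Averaging these over [B n] and applying [avg_avg] recovers the average over [B n]
    itself. *)
Lemma weyl_mean_approx A f : van_hove theta A -> buc f ->
  weyl_ap_fun theta A f -> mean_approx f.
Proof.
(* Two thirds are spent on the averages over translates, doubled by [cabs_avg], and one third on the
   boundary term. *)
move=> hA bf [_ H] e e0; have e3 : 0 < e / 3 by rewrite divr_gt0.
have [P [tP hP]] := H _ e3; exists P; split=> // B hB.
have bP := trig_poly_buc tP; have bd := bucB bf bP; have bmd := buc_bmeas bd.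
move: hP; rewrite /weyl_norm /limn_esup limf_esupE.
case/ereal_inf_lt => _ [F [N _ NF] <-] hF.
have {hF}hN x : aavg theta (translate x (A N)) (fun t => f t - P t) < e / 3.
  have [oA pA _ _] := vH_basic hG N hA.
  rewrite -lte_fin -weyl_termE//; apply: le_lt_trans hF.
  apply: (@le_trans _ _ (ereal_sup (range (fun x => ((vol theta (A N))^-1%:E *
     \int[theta]_(t in (translate x (A N) : set (borel G))) (cabs (f t - P t))%:E)%E)))).
    by apply: ereal_sup_ubound; exists x.
  by apply: ereal_sup_ubound; exists N => //; apply: NF => /=.
pose h := (fun t => (cabs (f t - P t))%:C%C : R[i]).
have bh : buc h by exact: buc_cabs.
have [[M hM] _] := bh.
have M0 : 0 <= M by rewrite (le_trans _ (hM 0))// cabs_ge0.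
have [oA pA bA A0] := vH_basic hG N hA.
have [L AL [cL _]] := pA; have [K sK LK] := sym_compact_ex cL; have [cK _ _] := sK.
have d0 : 0 < e / 3 / (4 * M + 1) by rewrite divr_gt0// ltr_wpDl// mulr_ge0.
have := vH_boundary hB cK d0; apply: filterS => n hn.
have [oB pB bB B0] := vH_basic hG n hB.
have AK : A N `<=` K by move=> x /AL/LK.
have := avg_avg hG haar sK oB pB B0 bA A0 AK bh hM.
set u := avg _ _ _ => h1.
have h2 : cabs u <= 2 * (e / 3).
  have bu : bmeas (fun s : G => avg theta (A N) (fun t : G => h (s + t))).
    apply: bmeasZ; apply: buc_bmeas.
    exact: (buc_locfun (locfun_cintegral hG theta) (buc2_add bh) bA).
  rewrite (le_trans (cabs_avg hG bB B0 bu))// ler_pM2l//.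
  apply: aavg_le_cst => //; last exact: ltW.
  move=> x Bx; rewrite -translate_avg//; last exact: buc_bmeas.
  rewrite avg_abs cabsR ger0_norm; last first.
    by apply: aavg_ge0; rewrite (vol_translate haar)//; case: bA.
  exact/ltW.
have -> : aavg theta (B n) (fun t => f t - P t) = cabs (avg theta (B n) h).
  by rewrite avg_abs cabsR ger0_norm// aavg_ge0.
rewrite -[X in cabs X](subrK u) (le_lt_trans (cabsD _ _))// cabsC.
have r0 := boundary_ratio_ge0 K n hB.
have h3 : 4 * M * boundary_ratio theta K (B n) < e / 3.
  apply: (@le_lt_trans _ _ ((4 * M + 1) * boundary_ratio theta K (B n))).
    by rewrite ler_wpM2r// lerDl.
  by rewrite mulrC -ltr_pdivlMr// ltr_wpDl// mulr_ge0.
have -> : e = e / 3 + 2 * (e / 3) by field.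
by rewrite ltr_leD// (le_lt_trans h1).
Qed.

(** Bernoulli's inequality used twice, [1 - N * z <= (1 - z) ^ N] and
    [(1 - z) ^ N * (1 + N * z) <= 1], with [z = y ^ n] and [N = k ^ n], so that
    [N * z = (k * y) ^ n]. The polynomial falls from nearly 1 to nearly 0 around [y = 1 / k], as in
    elementary proofs of the Stone-Weierstrass theorem. *)
Lemma cutoff_bounds (y : R) (k n : nat) : 0 <= y <= 1 ->
  [/\ 0 <= (1 - y ^+ n) ^+ (k ^ n) <= 1,
     k%:R * y <= 2^-1 -> 1 - (1 - y ^+ n) ^+ (k ^ n) <= 2^-1 ^+ n &
     2 <= k%:R * y -> (1 - y ^+ n) ^+ (k ^ n) <= 2^-1 ^+ n].
Proof.
move=> /andP[y0 y1]; set z := y ^+ n.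
have z0 : 0 <= z by exact: exprn_ge0.
have z1 : z <= 1 by exact: exprn_ile1.
have w0 : 0 <= 1 - z by rewrite subr_ge0.
have w1 : 1 - z <= 1 by rewrite gerBl.
have N1 (N : nat) : 1 - N%:R * z <= (1 - z) ^+ N.
  elim: N => [|N IH]; first by rewrite mul0r subr0 expr0.
  rewrite exprS; apply: (@le_trans _ _ ((1 - z) * (1 - N%:R * z))).
    have : 0 <= N%:R * z * z by rewrite !mulr_ge0.
    by rewrite -natr1 mulrDl; lra.
  by rewrite ler_wpM2l.
have N2 (N : nat) : (1 - z) ^+ N * (1 + N%:R * z) <= 1.
  elim: N => [|N IH]; first by rewrite mul0r addr0 expr0 mulr1.
  rewrite exprSr -mulrA; apply: le_trans IH; apply: ler_wpM2l; first exact: exprn_ge0.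
  have : 0 <= N%:R * z * z by rewrite !mulr_ge0.
  have : 0 <= z * z by rewrite mulr_ge0.
  by rewrite -natr1 mulrDl; lra.
have kz : (k ^ n)%:R * z = (k%:R * y) ^+ n by rewrite natrX exprMn.
split.
- by rewrite exprn_ge0//= exprn_ile1.
- move=> ky; have := N1 (k ^ n)%N; rewrite kz => h.
  have : (k%:R * y) ^+ n <= 2^-1 ^+ n by apply: lerXn2r => //; rewrite nnegrE ?mulr_ge0.
  by lra.
- move=> ky; have := N2 (k ^ n)%N; rewrite kz => h.
  have k2 : 2 ^+ n <= (k%:R * y) ^+ n by apply: lerXn2r => //; rewrite nnegrE ?mulr_ge0.
  have p0 : 0 <= (1 - z) ^+ (k ^ n) by exact: exprn_ge0.
  rewrite exprVn -(mulr1 (_ ^+ _)^-1) ler_pdivlMl ?exprn_gt0//.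
  rewrite mulrC; apply: le_trans h; apply: ler_wpM2l => //.
  by rewrite (le_trans k2)// lerDr.
Qed.

(* With [p y = (1 - y^n)^(k^n)], a polynomial cut-off, the trigonometric
   polynomial [P * p(|P|^2 / c)] is bounded by a multiple of [sup |f|] and still
   close to [f] in mean; for bounded functions this gives closeness in mean
   square. *)
Lemma mean_approx_mean2 f : buc f -> mean_approx f -> mean2_approx f.
Proof.
move=> bf H e e0; have [[M0 fM0] _] := bf.
pose M := M0 + 1.
have M00 : 0 <= M0 by rewrite (le_trans _ (fM0 0))// cabs_ge0.
have Mgt0 : 0 < M by rewrite ltr_wpDl.
have fM x : cabs (f x) <= M by rewrite (le_trans (fM0 x))// lerDl.
(* The square of [cabs (f x - Q x)] will be at most [5 * M] times the bound in [Qb], that is,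
   [25 * M] times [cabs (f x - P x)] plus [10 * M ^+ 2 * 2^-1 ^+ n]; each term is allotted
   [e / 2]. *)
have e1 : 0 < e / (50 * M) by rewrite divr_gt0// mulr_gt0.
have [P [tP HP]] := H _ e1.
have bP := trig_poly_buc tP; have [[L hL] _] := bP.
have L0 : 0 <= L by rewrite (le_trans _ (hL 0))// cabs_ge0.
(* [k] is large enough for [y x] to stay below 1, and [n] for the two errors of order [2^-1 ^+ n] in
   [n3] and [n4]. *)
pose k := (Num.truncn (L ^+ 2 / (8 * M ^+ 2))).+1.
have M2 : 0 < 8 * M ^+ 2 by rewrite mulr_gt0// exprn_gt0.
have kL : L ^+ 2 < k%:R * (8 * M ^+ 2).
  by rewrite -ltr_pdivrMr// Num.Theory.truncnS_gt.
pose n := (Num.truncn ((L + 20 * M ^+ 2 / e * M + 1) / M)).+1.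
have n2 : ((L + 20 * M ^+ 2 / e * M + 1) / M) < 2 ^+ n.
  apply: (lt_trans (Num.Theory.truncnS_gt _)); rewrite -/n -natrX ltr_nat.
  exact: ltn_expl.
have e20 : 0 <= 20 * M ^+ 2 / e * M by rewrite !mulr_ge0// ?invr_ge0 ?exprn_ge0// ltW.
have n3 : L * 2^-1 ^+ n <= M.
  rewrite exprVn ler_pdivrMr ?exprn_gt0// mulrC -ler_pdivrMr// (le_trans _ (ltW n2))//.
  by rewrite ler_pM2r ?invr_gt0//; lra.
have n4 : 10 * M ^+ 2 * 2^-1 ^+ n <= e / 2.
  rewrite exprVn ler_pdivrMr ?exprn_gt0// [leRHS]mulrC -ler_pdivrMr ?divr_gt0//.
  rewrite (le_trans _ (ltW n2))// ler_pdivlMr//.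
  have -> : 10 * M ^+ 2 / (e / 2) * M = 20 * M ^+ 2 / e * M by field; rewrite gt_eqF.
  by lra.
(* With this scaling the thresholds [1 / 2] and 2 for [k * y] in [cutoff_bounds] correspond to
   [cabs (P x)] equal to [2 * M] and [4 * M]. *)
pose y x := cabs (P x) ^+ 2 / (k%:R * (8 * M ^+ 2)).
pose p x := (1 - y x ^+ n) ^+ (k ^ n).
pose Q x := P x * (p x)%:C%C.
have k0 : 0 < k%:R * (8 * M ^+ 2) by rewrite mulr_gt0// ltr0n.
have tQ : is_trig_poly Q.
  apply: trig_polyM => //.
  rewrite (_ : (fun x => (p x)%:C%C) = fun x => (1 - (((k%:R * (8 * M ^+ 2))^-1)%:C%C *
      (P x * (P x)^*%C)) ^+ n) ^+ (k ^ n)).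
    apply: trig_polyX; apply: trig_polyB; first exact: trig_poly_cst.
    apply: trig_polyX; apply: trig_polyM; first exact: trig_poly_cst.
    by apply: trig_polyM => //; exact: trig_polyJ.
  apply/funext => x; rewrite mulJ -rmorphM /= -rmorphXn -[1]/((1 : R)%:C%C) -rmorphB -rmorphXn /=.
  by rewrite /p /y mulrC.
have yE x : k%:R * y x = cabs (P x) ^+ 2 / (8 * M ^+ 2).
  rewrite /y; field; rewrite gt_eqF//= pnatr_eq0//.
(* Up to [2 * M] the cut-off is nearly 1 and [Q] is close to [P]. Beyond it [P] is at distance at
   least [M] from [f], so the crude bound [5 * M] on the distance from [f] to [Q] already suffices;
   beyond [4 * M] the cut-off makes [Q] smaller than [M]. *)
have Qb x : cabs (Q x) <= 4 * M /\ cabs (f x - Q x) <= 5 * cabs (f x - P x) + 2 * M * 2^-1 ^+ n.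
  have P0 := cabs_ge0 (P x); have fP0 := cabs_ge0 (f x - P x).
  have y01 : 0 <= y x <= 1.
    rewrite /y divr_ge0 ?exprn_ge0 ?(ltW k0)//= ler_pdivrMr// mul1r.
    by rewrite (le_trans _ (ltW kL))// lerXn2r// nnegrE.
  have [/andP[p0 p1] pl pu] := cutoff_bounds k n y01; rewrite -/(p x) in p0 p1 pl pu.
  have h2n : 0 <= 2^-1 ^+ n :> R by rewrite exprn_ge0// invr_ge0.
  have Mh : 0 <= 2 * M * 2^-1 ^+ n by rewrite !mulr_ge0// ltW.
  have Qp : cabs (Q x) = cabs (P x) * p x by rewrite cabsM cabsR ger0_norm.
  have [Psm|Plg] := leP (cabs (P x)) (2 * M).
    split; first by rewrite Qp (le_trans (ler_piMr P0 p1))//; lra.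
    have {}/pl pl : k%:R * y x <= 2^-1.
      rewrite yE ler_pdivrMr//.
      have -> : 2^-1 * (8 * M ^+ 2) = (2 * M) ^+ 2 by field.
      by rewrite lerXn2r// nnegrE// mulr_ge0// ltW.
    have -> : f x - Q x = (f x - P x) + P x * (1 - p x)%:C%C.
      by rewrite /Q rmorphB /=; ring.
    rewrite (le_trans (cabsD _ _))// cabsM cabsR ger0_norm ?subr_ge0// lerD//; first by lra.
    by rewrite ler_pM// subr_ge0.
  have Q4 : cabs (Q x) <= 4 * M.
    have [Psm|Plg'] := leP (cabs (P x)) (4 * M).
      by rewrite Qp (le_trans (ler_piMr P0 p1)).
    have {}/pu pu : 2 <= k%:R * y x.
      rewrite yE ler_pdivlMr//.
      have -> : 2 * (8 * M ^+ 2) = (4 * M) ^+ 2 by field.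
      by rewrite lerXn2r// ?nnegrE// ?mulr_ge0 ?ltW.
    rewrite Qp (@le_trans _ _ (L * 2^-1 ^+ n))//; last by lra.
    by rewrite ler_pM.
  split=> //.
  have : M <= cabs (f x - P x).
    have := cabs_tri (f x) (P x) 0; rewrite !subr0 => h; have := fM x.
    by rewrite cabsC; lra.
  by have := cabsB (f x) (Q x); have := fM x; lra.
exists Q; split=> // B hB.
have bQ := trig_poly_buc tQ.
apply: filterS (HP B hB) => m hm; have [oB pB bB B0] := vH_basic hG m hB.
pose g := fun x => (25 * M)%:C%C * (f x - P x).
have bfP : bmeas (fun x => f x - P x) by apply: buc_bmeas; exact: bucB.
have bfQ : bmeas (fun x => f x - Q x) by apply: buc_bmeas; exact: bucB.
have s2 : 0 <= 10 * M ^+ 2 * 2^-1 ^+ n by rewrite !mulr_ge0// ?exprn_ge0 ?invr_ge0// ltW.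
pose c : R[i] := (10 * M ^+ 2 * 2^-1 ^+ n)%:C%C.
have bg : bmeas (fun x => (cabs (g x))%:C%C) by exact: (@bmeas_cabs R G g (bmeasZ _ bfP)).
have bh : bmeas (fun x => (cabs (g x))%:C%C + c).
  by apply: bmeasD; [exact: bg|exact: bmeas_cst].
apply: (@le_lt_trans _ _ (aavg theta (B m) (fun x => (cabs (g x))%:C%C + c))).
  apply: aavg_le => //; first exact: bmeas_sqabs.
  move=> x _; rewrite /sqabs mulJ /c -rmorphD !cabsR !ger0_norm ?sqr_ge0 ?addr_ge0 ?cabs_ge0//.
  have [q1 q2] := Qb x; have := fM x; have := cabsB (f x) (Q x).
  rewrite /g cabsM cabsR ger0_norm ?mulr_ge0 ?(ltW Mgt0)// => h1 h2.
  have h5 : cabs (f x - Q x) <= 5 * M by lra.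
  rewrite expr2 (@le_trans _ _ (5 * M * (5 * cabs (f x - P x) + 2 * M * 2^-1 ^+ n)))//.
    by rewrite ler_pM ?cabs_ge0.
  by rewrite le_eqVlt; apply/orP; left; apply/eqP; ring.
have bc := @bmeas_cst R G c.
rewrite (le_lt_trans (aavgD hG bB B0 _ _))//.
rewrite aavg_cst// /c cabsR (ger0_norm s2).
have -> : aavg theta (B m) (fun x => (cabs (g x))%:C%C) = 25 * M * aavg theta (B m) (fun x => f x - P x).
  apply: (@complexI R); rewrite [RHS]rmorphM /= -!avg_abs.
  rewrite -(avgZ hG theta bB); last exact: bmeas_cabs.
  congr (avg _ _ _); apply/funext => x; rewrite -rmorphM cabsR ger0_norm ?cabs_ge0//.
  by rewrite /g cabsM cabsR ger0_norm// mulr_ge0// ltW.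
have : 25 * M * aavg theta (B m) (fun x => f x - P x) < e / 2.
  have -> : e / 2 = 25 * M * (e / (50 * M)) by field; rewrite gt_eqF.
  by rewrite ltr_pM2l// mulr_gt0.
by lra.
Qed.

End weyl_almost_periodic_functions.

(** * Bessel's inequality and Parseval's identity along a van Hove sequence *)

Section parseval.
Context (R : realType) (G : topologicalZmodType) (hG : hausdorff_space G).
Context (theta : radon_measure R G) (haar : is_haar theta).
Implicit Types (f g P Q : G -> R[i]) (chi omega : dual R G) (s : seq (dual R G)).

Definition trig_sum (c : dual R G -> R[i]) s : G -> R[i] :=
  fun x => \sum_(chi <- s) c chi * chi x.

(** Repeated characters are merged, since orthogonality gives a diagonal sum only for distinct
    ones. *)
Lemma trig_poly_uniq P : is_trig_poly P -> exists c s, uniq s /\ P = trig_sum c s.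
Proof.
move=> /trig_polyP[l ->]; elim: l => [|[a chi] l [c [s [us IH]]]].
  by exists (fun=> 0), [::]; split=> //; apply/funext => x; rewrite /trig_sum !big_nil.
have IHx x : \sum_(p <- l) p.1 * p.2 x = trig_sum c s x by rewrite -IH.
pose c' omega := if omega == chi then a + (if chi \in s then c chi else 0) else c omega.
have [chis|chis] := boolP (chi \in s).
  exists c', s; split=> //; apply/funext => x; rewrite big_cons IHx /trig_sum.
  rewrite !(bigD1_seq chi)//= /c' eqxx chis mulrDl addrA; congr (_ + _).
  by apply: eq_bigr => omega /negbTE ->.
exists c', (chi :: s); split; first by rewrite /= chis.
apply/funext => x; rewrite big_cons IHx /trig_sum big_cons /c' eqxx (negbTE chis) addr0.
congr (_ + _); apply: eq_big_seq => omega os; case: eqP => // oc.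
by move: chis; rewrite -oc os.
Qed.

Lemma trig_sum_trig_poly c s : is_trig_poly (trig_sum c s).
Proof.
apply/trig_polyP; exists [seq (c chi, chi) | chi <- s].
by apply/funext => x; rewrite big_map.
Qed.

Section along_a_sequence.
Context (B : nat -> set G) (hB : van_hove theta B) (f : G -> R[i]) (bf : buc f).
Context (a : dual R G -> R[i]) (sigma : R).
Hypothesis fa : forall chi, cvg_avg theta B (fun x => (chi x)^*%C * f x) (a chi).
Hypothesis fsigma : cvg_avg theta B (sqabs f) sigma%:C%C.

(** The square is expanded, orthogonality of characters leaves the diagonal, and the square is
    completed around the Fourier coefficients [a]. *)
Lemma mean_square_trig_sum c s : uniq s ->
  cvg_avg theta B (sqabs (fun x => f x - trig_sum c s x))
    (sigma + \sum_(chi <- s) (cabs (c chi - a chi) ^+ 2 - cabs (a chi) ^+ 2))%:C%C.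
Proof.
move=> us.
pose v chi n := avg theta (B n) (fun x => (chi x)^*%C * f x).
pose w chi omega n := avg theta (B n) (fun x => chi x * (omega x)^*%C).
have bchi chi : bmeas chi by apply: buc_bmeas; exact: dual_buc.
have bm := buc_bmeas bf.
have bcf chi : bmeas (fun x => (chi x)^*%C * f x) by apply: bmeasM => //; exact: bmeasJ.
have bcc chi omega : bmeas (fun x => chi x * (omega x)^*%C).
  by apply: bmeasM => //; exact: bmeasJ.
have E n : avg theta (B n) (sqabs (fun x => f x - trig_sum c s x)) =
    avg theta (B n) (sqabs f) + (\sum_(chi <- s) (- (c chi)^*%C) * v chi n +
    (\sum_(chi <- s) (- c chi) * (v chi n)^*%C +
     \sum_(chi <- s) c chi * \sum_(omega <- s) (c omega)^*%C * w chi omega n)).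
  have [_ _ bB B0] := vH_basic hG n hB.
  pose F1 chi x := (- (c chi)^*%C) * ((chi x)^*%C * f x).
  pose F2 chi x := (- c chi) * ((chi x)^*%C * f x)^*%C.
  pose F3 chi omega x := (c omega)^*%C * (chi x * (omega x)^*%C).
  have bF1 chi : bmeas (F1 chi) by exact: bmeasZ.
  have bF2 chi : bmeas (F2 chi) by apply: bmeasZ; exact: bmeasJ.
  have bF3 chi omega : bmeas (F3 chi omega) by exact: bmeasZ.
  have bF4 chi : bmeas (fun x => c chi * \sum_(omega <- s) F3 chi omega x).
    by apply: bmeasZ; exact: bmeas_sum.
  have bS1 : bmeas (fun x => \sum_(chi <- s) F1 chi x) by exact: bmeas_sum.
  have bS2 : bmeas (fun x => \sum_(chi <- s) F2 chi x) by exact: bmeas_sum.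
  have bS4 : bmeas (fun x => \sum_(chi <- s) c chi * \sum_(omega <- s) F3 chi omega x).
    exact: bmeas_sum.
  have bS24 := bmeasD bS2 bS4; have bS124 := bmeasD bS1 bS24.
  have -> : sqabs (fun x => f x - trig_sum c s x) = fun x => sqabs f x +
      (\sum_(chi <- s) F1 chi x + (\sum_(chi <- s) F2 chi x +
       \sum_(chi <- s) c chi * \sum_(omega <- s) F3 chi omega x)).
    apply/funext => x; rewrite /sqabs; set T := trig_sum c s x.
    have -> : (f x - T) * (f x - T)^*%C = f x * (f x)^*%C +
        (- (f x * T^*%C) + (- (T * (f x)^*%C) + T * T^*%C)) by rewrite rmorphB /=; ring.
    have TJ : T^*%C = \sum_(chi <- s) (c chi)^*%C * (chi x)^*%C.
      by rewrite /T /trig_sum rmorph_sum; apply: eq_bigr => chi _; exact: cJM.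
    congr (_ + (_ + (_ + _))).
    - rewrite TJ mulr_sumr -sumrN; apply: eq_bigr => chi _.
      by rewrite /F1; ring.
    - rewrite /T mulr_suml -sumrN; apply: eq_bigr => chi _.
      by rewrite /F2 cJM conjcK; ring.
    - rewrite {1}/T mulr_suml; apply: eq_bigr => chi _; rewrite -mulrA; congr (_ * _).
      rewrite TJ mulr_sumr; apply: eq_bigr => omega _.
      by rewrite /F3 mulrCA.
  rewrite (avgD hG theta bB)//; last exact: bmeas_sqabs.
  rewrite (avgD hG theta bB bS1 bS24) (avgD hG theta bB bS2 bS4); congr (_ + (_ + (_ + _))).
  - rewrite (avg_sum hG theta bB)//; apply: eq_bigr => chi _.
    by rewrite (avgZ hG theta bB).
  - rewrite (avg_sum hG theta bB)//; apply: eq_bigr => chi _.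
    by rewrite (avgZ hG theta bB) ?(avgJ hG theta bB)//; exact: bmeasJ.
  - rewrite (avg_sum hG theta bB)//; apply: eq_bigr => chi _.
    rewrite (avgZ hG theta bB); last exact: bmeas_sum.
    rewrite (avg_sum hG theta bB)//; congr (_ * _); apply: eq_bigr => omega _.
    by rewrite (avgZ hG theta bB).
rewrite /cvg_avg (funext E).
have -> : (sigma + \sum_(chi <- s) (cabs (c chi - a chi) ^+ 2 - cabs (a chi) ^+ 2))%:C%C =
    sigma%:C%C + (\sum_(chi <- s) (- (c chi)^*%C) * a chi +
    (\sum_(chi <- s) (- c chi) * (a chi)^*%C +
     \sum_(chi <- s) c chi * \sum_(omega <- s) (c omega)^*%C * (chi == omega)%:R)).
  rewrite rmorphD /= rmorph_sum /=; congr (_ + _).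
  rewrite -!big_split /=; apply: eq_big_seq => chi chis.
  rewrite (bigD1_seq chi)//= eqxx mulr1 big1 ?addr0; last first.
    by move=> omega; rewrite eq_sym => /negbTE ->; rewrite mulr0.
  by rewrite rmorphB /= -!mulJ rmorphB /=; ring.
apply: (cvgCD fsigma); apply: cvgCD.
  by apply: cvgC_sum => chi; apply: cvgCZ; exact: fa.
apply: cvgCD.
  by apply: cvgC_sum => chi; apply: cvgCZ; apply: cvgCJ; exact: fa.
apply: cvgC_sum => chi; apply: cvgCZ; apply: cvgC_sum => omega; apply: cvgCZ.
exact: avg_chi_mul.
Qed.

Lemma mean_square_ge0 (u : G -> R[i]) (l : R) :
  cvg_avg theta B (sqabs u) l%:C%C -> 0 <= l.
Proof.
move=> /cvgC_near h; apply/ler_addgt0Pr => e e0; have [N _ HN] := h e e0.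
have := HN N (leqnn N); rewrite avg_sqabs -rmorphB /= cabsR ltr_norml => /andP[_ h1].
have [_ _ _ B0] := vH_basic hG N hB.
have := aavg_ge0 B0 (sqabs u); lra.
Qed.

Lemma bessel s : uniq s -> \sum_(chi <- s) cabs (a chi) ^+ 2 <= sigma.
Proof.
move=> us; have := mean_square_ge0 (@mean_square_trig_sum a s us).
rewrite (eq_bigr (fun chi => - cabs (a chi) ^+ 2)).
  by rewrite sumrN subr_ge0.
by move=> chi _; rewrite subrr cabs0 expr0n /= sub0r.
Qed.

(** An approximant may have any coefficients: replacing them by those of [f] only lowers the mean
    square error. *)
Lemma parseval_approx (e : R) : mean2_approx theta f -> 0 < e ->
  exists2 s, uniq s & sigma <= \sum_(chi <- s) cabs (a chi) ^+ 2 + e.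
Proof.
move=> H e0; have [P [tP HP]] := H e e0.
have [c [s [us Ps]]] := trig_poly_uniq tP; exists s => //.
have := @mean_square_trig_sum c s us; rewrite -Ps => /(@cvgC_cabs_le _ _ _ e).
rewrite cabsR big_split /= sumrN => /(_ _)/(le_trans (ler_norm _)) h.
rewrite -lerBlDl; apply: le_trans (h _).
  by rewrite addrA lerD2r lerDl; apply: sumr_ge0 => chi _; rewrite sqr_ge0.
apply: filterS (HP B hB) => n hn; rewrite avg_sqabs cabsR ger0_norm; first exact: ltW.
by have [_ _ _ B0] := vH_basic hG n hB; exact: aavg_ge0.
Qed.

End along_a_sequence.

(** The product is approximated by that of two polynomials, whose mean exists. [Q] is chosen after
    [P], because its error gets multiplied by a bound on [P]. *)
Lemma mean2_product f g : buc f -> buc g -> mean_approx theta f -> mean_approx theta g ->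
  forall B, van_hove theta B -> exists m, cvg_avg theta B (fun x => f x * (g x)^*%C) m.
Proof.
move=> bf bg Hf Hg B hB; apply: complex_cauchy => e e0.
have [[M gM] _] := bg.
have M0 : 0 <= M by rewrite (le_trans _ (gM 0))// cabs_ge0.
(* Each of the two product errors is allowed [e / 8]; doubled by [cabs_avg] they amount to
   [e / 2]. *)
have e1 : 0 < e / 8 / (M + 1) by rewrite divr_gt0 ?divr_gt0// ltr_wpDl.
have [P [tP HP]] := Hf _ e1; have bP := trig_poly_buc tP; have [[N PN] _] := bP.
have N0 : 0 <= N by rewrite (le_trans _ (PN 0))// cabs_ge0.
have e2 : 0 < e / 8 / (N + 1) by rewrite divr_gt0 ?divr_gt0// ltr_wpDl.
have [Q [tQ HQ]] := Hg _ e2; have bQ := trig_poly_buc tQ.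
have [m Hm] := avg_trig_poly hG haar (trig_polyM tP (trig_polyJ tQ)).
have e3 : 0 < e / 2 by rewrite divr_gt0.
have /cvgC_near/(_ _ e3) h3 := Hm B hB.
exists m; have h1 := HP B hB; have h2 := HQ B hB.
near=> n.
have [_ _ bB B0] := vH_basic hG n hB.
rewrite (le_lt_trans (cabs_tri (avg theta (B n) (fun x => P x * (Q x)^*%C)) _ _))//.
rewrite (splitr e) ltr_leD//; last by apply/ltW; near: n.
have bfP : bmeas (fun x => f x - P x) by apply: buc_bmeas; exact: bucB.
have bgQ : bmeas (fun x => g x - Q x) by apply: buc_bmeas; exact: bucB.
have bg' := buc_bmeas (bucJ bg); have bP' := buc_bmeas bP.
have b1 : bmeas (fun x => (f x - P x) * (g x)^*%C) by exact: bmeasM.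
have b2 : bmeas (fun x => P x * (g x - Q x)^*%C) by apply: bmeasM => //; exact: bmeasJ.
rewrite -(avgB hG theta bB); last 2 first.
- by apply: bmeasM => //; exact: buc_bmeas.
- by apply: bmeasM => //; apply: bmeasJ; exact: buc_bmeas.
have -> : (fun x => f x * (g x)^*%C - P x * (Q x)^*%C) =
    (fun x => (f x - P x) * (g x)^*%C + P x * (g x - Q x)^*%C).
  by apply/funext => x; rewrite rmorphB /=; ring.
rewrite (le_lt_trans (cabs_avg hG bB B0 (bmeasD b1 b2)))//.
have k1 : aavg theta (B n) (fun x => (f x - P x) * (g x)^*%C) <= (M + 1) * aavg theta (B n) (fun x => f x - P x).
  have -> : (M + 1) * aavg theta (B n) (fun x => f x - P x) =
      aavg theta (B n) (fun x => (M + 1)%:C%C * (f x - P x)).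
    apply: (@complexI R); rewrite [LHS]rmorphM /= -!avg_abs -(avgZ hG theta bB); last exact: bmeas_cabs.
    by congr avg; apply/funext => x; rewrite cabsM cabsR ger0_norm ?addr_ge0// rmorphM.
  apply: aavg_le => //; first exact: bmeasZ.
  move=> x _; rewrite !cabsM cabsJ cabsR ger0_norm ?addr_ge0// mulrC ler_wpM2r ?cabs_ge0//.
  by rewrite (le_trans (gM x))// lerDl.
have k2 : aavg theta (B n) (fun x => P x * (g x - Q x)^*%C) <= (N + 1) * aavg theta (B n) (fun x => g x - Q x).
  have -> : (N + 1) * aavg theta (B n) (fun x => g x - Q x) =
      aavg theta (B n) (fun x => (N + 1)%:C%C * (g x - Q x)).
    apply: (@complexI R); rewrite [LHS]rmorphM /= -!avg_abs -(avgZ hG theta bB); last exact: bmeas_cabs.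
    by congr avg; apply/funext => x; rewrite cabsM cabsR ger0_norm ?addr_ge0// rmorphM.
  apply: aavg_le => //; first exact: bmeasZ.
  move=> x _; rewrite !cabsM cabsJ cabsR ger0_norm ?addr_ge0// ler_wpM2r ?cabs_ge0//.
  by rewrite (le_trans (PN x))// lerDl.
have k3 : (M + 1) * aavg theta (B n) (fun x => f x - P x) < e / 8.
  by rewrite mulrC -ltr_pdivlMr ?ltr_wpDl//; near: n.
have k4 : (N + 1) * aavg theta (B n) (fun x => g x - Q x) < e / 8.
  by rewrite mulrC -ltr_pdivlMr ?ltr_wpDl//; near: n.
have := aavgD hG bB B0 b1 b2; lra.
Unshelve. all: by end_near. Qed.

Lemma trig_poly_mean_approx P : is_trig_poly P -> mean_approx theta P.
Proof.
move=> tP e e0; exists P; split=> // B hB; apply: nearW => n.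
have [_ _ bB B0] := vH_basic hG n hB.
apply: le_lt_trans e0; apply: aavg_le_cst => //.
  by apply: buc_bmeas; apply: bucB; exact: trig_poly_buc.
by move=> x _; rewrite subrr cabs0.
Qed.

End parseval.

(** * The topology of the dual group *)

Section dual_topology.
Context (R : realType) (G : topologicalZmodType) (hG : hausdorff_space G).
Implicit Types (chi omega : dual R G) (K : set G).

Definition dual_near K chi (e : R) : set (dual R G) :=
  [set omega | forall x, K x -> cabs (chi x - omega x) < e].

Lemma dual_cont chi : continuous (dual_fun chi).
Proof. by apply: buc_cont; exact: dual_buc. Qed.

Lemma entourage_complexP (E : set (R[i] * R[i])) : entourage E <->
  exists2 e : R, 0 < e & forall a b, cabs (a - b) < e -> E (a, b).
Proof.
rewrite -entourage_ballE; split=> [[[e e'] /= e0 H]|[e e0 H]].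
  move: e0 H; rewrite ltcE /= => /andP[/eqP -> e0] H.
  exists e => // a b ab; apply: H => /=.
  by rewrite /ball /= normCE ltcR.
exists e%:C%C => /=; first by rewrite ltcR.
by move=> [a b]; rewrite /ball /= normCE ltcR => /H.
Qed.

(** At a continuous limit the compact-open topology is uniform convergence on compact sets, and
    [dual] carries the subspace topology. *)
Lemma dual_cvgP (F : set_system (dual R G)) chi : Filter F ->
  F --> chi <-> forall K (e : R), compact K -> 0 < e -> F (dual_near K chi e).
Proof.
move=> FF.
have FF' : Filter ((set_val : dual R G -> G -> R[i]) @ F) by exact: fmap_filter.
have co := @compact_open_fam_compactP G R[i] (dual_fun chi)
  ((set_val : dual R G -> G -> R[i]) @ F) (@dual_cont chi) FF'.
split=> [Fchi K e cK e0|H].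
  have h : {compact-open, ((set_val : dual R G -> G -> R[i]) @ F) --> (dual_fun chi)}.
    move=> W nW; apply: (Fchi (set_val @^-1` W)).
    by apply: (@initial_continuous (dual R G) {compact-open, G -> R[i]} set_val).
  have /co/fam_cvgP/(_ K cK) := h.
  move=> /(_ [set h | forall y, K y -> [set z : R[i] * R[i] | cabs (z.1 - z.2) < e] (dual_fun chi y, h y)]).
  apply; apply/uniform_nbhs; exists [set z : R[i] * R[i] | cabs (z.1 - z.2) < e].
  by split=> //; apply/entourage_complexP; exists e.
have h : {family compact, ((set_val : dual R G -> G -> R[i]) @ F) --> (dual_fun chi)}.
  apply/fam_cvgP => K cK P /uniform_nbhs[E [/entourage_complexP[e e0 eE] EP]].
  apply: filterS (H K e cK e0) => omega ho; apply: EP => y Ky.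
  by apply: eE; exact: ho.
have {}h := co.2 h.
move=> U [_ [[W oW <-] Wchi] WU]; apply: filterS WU _.
by apply: h; apply: open_nbhs_nbhs; split.
Qed.

Lemma dual_nbhs K chi (e : R) : compact K -> 0 < e -> nbhs chi (dual_near K chi e).
Proof. by move=> cK e0; apply: ((dual_cvgP chi (nbhs_filter chi)).1) => //; exact: cvg_id. Qed.

Lemma dual_hausdorff : hausdorff_space (dual R G).
Proof.
move=> p q pq; apply: dual_eq => x; apply/eqP; rewrite -subr_eq0; apply/eqP/cabs_eq0/eqP.
rewrite eq_le cabs_ge0 andbT; apply/ler_addgt0Pr => e e0; rewrite add0r.
have e2 : 0 < e / 2 by rewrite divr_gt0.
have [w [h1 h2]] := pq _ _ (dual_nbhs p (@compact_set1 _ x) e2) (dual_nbhs q (@compact_set1 _ x) e2).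
rewrite (le_trans (cabs_tri (dual_fun w x) _ _))// (splitr e) lerD// ltW//; first exact: h1.
by rewrite cabsC; exact: h2.
Qed.

Lemma compact_unit_disc : compact [set z : R[i] | cabs z <= 1].
Proof.
pose m (p : R * R) : R[i] := Complex p.1 p.2.
have cm : continuous m.
  apply: cont_ReIm => /= x; [exact: cvg_fst|exact: cvg_snd].
have cbox : compact (m @` (`[-1, 1]%classic `*` `[-1, 1]%classic)).
  apply: continuous_compact; first exact: continuous_subspaceT.
  by apply: compact_setX; exact: segment_compact.
apply: (subclosed_compact _ cbox).
  have -> : [set z : R[i] | cabs z <= 1] = cabs (R:=R) @^-1` [set x | x <= 1] by [].
  apply: closed_comp; last exact: closed_le.
  by move=> x _; apply: cont_cabs => y; exact: cvg_id.
move=> z /= z1; exists (complex.Re z, complex.Im z); last by case: z z1.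
split=> /=; rewrite in_itv /= -ler_norml (le_trans _ z1)//; [exact: Re_cabs|exact: Im_cabs].
Qed.

Lemma ultra_fmap (T U : Type) (h : T -> U) (F : set_system T) :
  UltraFilter F -> UltraFilter (h @ F).
Proof.
move=> FU; split; first exact: fmap_proper_filter.
move=> H HF FH; apply/seteqP; split=> A; last exact: FH.
move=> HA; have [//|nA] := in_ultra_setVsetC (h @^-1` A) FU.
have {}nA : H (~` A) by apply: FH.
by exfalso; apply: (@filter_not_empty _ H HF); rewrite -(setICr A); exact: filterI.
Qed.

(* Arzela-Ascoli for characters: an ultrafilter on an equicontinuous set of
   characters converges pointwise, and its limit is a character. *)
Lemma equicontinuous_dual_precompact (W : set (dual R G)) :
  (forall e : R, 0 < e -> exists2 U, nbhs (0 : G) U &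
    forall chi u, W chi -> U u -> cabs (chi u - 1) <= e) ->
  forall F : set_system (dual R G), UltraFilter F -> F W -> exists chi, F --> chi.
Proof.
move=> eqc F FU FW.
have lim x : {l : R[i] | (fun chi : dual R G => chi x) @ F --> l}.
  apply: cid; have := compact_unit_disc; rewrite compact_ultra.
  have fU : UltraFilter ((fun chi : dual R G => chi x) @ F) by exact: ultra_fmap.
  case/(_ _ fU) => [|l [_ hl]]; last by exists l.
  change (F [set chi : dual R G | cabs (dual_fun chi x) <= 1]).
  by apply: filterS filterT => chi _ /=; rewrite cabs_chi.
pose f x := projT1 (lim x).
have hf x : (fun chi : dual R G => chi x) @ F --> f x := projT2 (lim x).
have fe x (e : R) : 0 < e -> F [set chi : dual R G | cabs (f x - chi x) < e].
  by move=> e0; have /cvgCP := hf x; exact.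
have ex (P : set (dual R G)) : F P -> exists chi, P chi.
  by move=> /filter_ex.
have small (a : R[i]) : (forall e : R, 0 < e -> cabs a <= e) -> a = 0.
  move=> ha; apply/cabs_eq0/eqP; rewrite eq_le cabs_ge0 andbT.
  by apply/ler_addgt0Pr => e /ha; rewrite add0r.
have f1 x : `|f x| = 1.
  rewrite normCE; congr (_%:C%C); apply/eqP; rewrite -subr_eq0 -normr_eq0 eq_le normr_ge0 andbT.
  apply/ler_addgt0Pr => e e0; rewrite add0r.
  have [chi /= h] := ex _ (fe x _ e0).
  by rewrite -(cabs_chi chi x) (le_trans (cabs_dist _ _))// ltW.
have fM x y : f (x + y) = f x * f y.
  apply/eqP; rewrite -subr_eq0; apply/eqP/small => e e0.
  have e3 : 0 < e / 4 by rewrite divr_gt0.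
  have [chi [[h1 h2] h3]] := ex _ (filterI (filterI (fe x _ e3) (fe y _ e3)) (fe (x + y) _ e3)).
  have [_ cD _] := dual_character chi; rewrite /= cD in h1 h2 h3.
  have fy : cabs (f y) <= 1 by rewrite /cabs f1.
  have -> : f (x + y) - f x * f y = (f (x + y) - chi x * chi y) -
      ((f x - chi x) * f y + chi x * (f y - chi y)) by ring.
  rewrite (le_trans (cabsB _ _))// (@le_trans _ _ (e / 4 + (e / 4 + e / 4)))//; last by lra.
  rewrite lerD ?(ltW h3)// (le_trans (cabsD _ _))// !cabsM cabs_chi mul1r lerD ?(ltW h2)//.
  by rewrite (le_trans (ler_piMr (cabs_ge0 _) fy))// ltW.
have fu (e : R) : 0 < e -> exists2 U, nbhs (0 : G) U & forall u, U u -> cabs (f u - 1) <= e.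
  move=> e0; have e2 : 0 < e / 2 by rewrite divr_gt0.
  have [U U0 HU] := eqc _ e2; exists U => // u Uu.
  have [chi [h1 h2]] := ex _ (filterI (fe u _ e2) FW).
  rewrite (le_trans (cabs_tri (chi u) _ _))// (splitr e) lerD ?(ltW h1)//.
  exact: HU.
have cf : is_character f.
  split=> //; apply/contCP => x e e0; have e2 : 0 < e / 2 by rewrite divr_gt0.
  have [U U0 HU] := fu _ e2; apply: filterS (nbhs0_sub x U0) => y /HU h.
  have -> : f x - f y = - (f x * (f (y - x) - 1)).
    by rewrite mulrBr mulr1 -fM (addrC x) subrK opprB.
  have fx : cabs (f x) = 1 by rewrite /cabs f1.
  by rewrite cabsN cabsM fx mul1r (le_lt_trans h)// ltr_pdivrMr// ltr_pMr// ltr1n.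
exists (mk_dual cf); apply/dual_cvgP => K e cK e0.
have e3 : 0 < e / 4 by rewrite divr_gt0.
have [U0' n1 H1] := eqc _ e3; have [U1' n2 H2] := fu _ e3.
have [U [oU U0] UU] : exists2 U : set G, open_nbhs 0 U & U `<=` U0' `&` U1'.
  have : nbhs (0 : G) (U0' `&` U1') by exact: filterI.
  by rewrite nbhsE.
(* Equicontinuity reduces uniform closeness on [K] to closeness at the finitely many centres of a
   cover by translates of [U]. *)
move: cK; rewrite compact_cover => /(_ G setT (fun s => translate s U)).
case; first by move=> s _; exact: translate_open.
  by move=> x _; exists x => //; rewrite translateE /= addNr.
move=> l _ Kl.
have Fl : F [set chi : dual R G | forall s, s \in finmap.enum_fset l -> cabs (f s - chi s) < e / 4].
  elim: (finmap.enum_fset l) => [|s r IH]; first by apply: filterS filterT => chi _ s; rewrite in_nil.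
  apply: filterS (filterI (fe s _ e3) IH) => chi [h1 h2] t; rewrite inE => /orP[/eqP ->|] //.
  exact: h2.
apply: filterS (filterI Fl FW) => chi [h1 h2] x Kx.
have [s sl Us] := Kl x Kx; rewrite translateE /= in Us.
have [/(H1 chi _ h2) k1 /H2 k2] := UU _ Us.
have xE : x = s + (- s + x) by rewrite addNKr.
have [_ cD _] := dual_character chi.
have -> : dual_fun (mk_dual cf) x - chi x = (f s - chi s) * f (- s + x) +
    chi s * ((f (- s + x) - 1) - (chi (- s + x) - 1)).
  by rewrite {1 2}xE cD (_ : dual_fun _ _ = f (s + (- s + x)))// fM; ring.
have fx : cabs (f (- s + x)) = 1 by rewrite /cabs f1.
rewrite (le_lt_trans (cabsD _ _))// !cabsM cabs_chi mul1r fx mulr1.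
have := h1 s sl; have := cabsB (f (- s + x) - 1) (chi (- s + x) - 1); lra.
Qed.

End dual_topology.

(** * Pure point Radon measures *)

Section pure_point_integral.
Import HBNNSimple.
Context (R : realType) (T : ptopologicalType) (hT : hausdorff_space T).
Context (nu : radon_measure R T).
Implicit Types (h : T -> R) (s : seq T).
Local Open Scope ereal_scope.

Lemma borel_set1 (x : T) : measurable ([set x] : set (borel T)).
Proof.
by apply: closed_borel; exact: accessible_closed_set1 (hausdorff_accessible hT) _.
Qed.

Lemma atom_fin (x : T) : nu [set x] \is a fin_num.
Proof.
rewrite ge0_fin_numE//; apply: radon_bounded_fin => //.
by apply: bounded_borel_compact => //; exact: compact_set1.
Qed.

Lemma le_sum_integral h s : continuous h -> (forall x, 0 <= h x)%R -> uniq s ->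
  \sum_(x <- s) ((h x)%:E * nu [set x]) <= \int[nu]_x (h x)%:E.
Proof.
move=> ch h0 us; have mh : measurable_fun [set: borel T] (h : borel T -> R) by exact: continuous_borel.
have ms : measurable (\big[setU/set0]_(x <- s) [set x] : set (borel T)).
  by apply: bigsetU_measurable => x _; exact: borel_set1.
apply: (@le_trans _ _ (\int[nu]_(x in \big[setU/set0]_(x <- s) [set x] : set (borel T)) (h x)%:E)).
  rewrite ge0_integral_bigsetU//.
  - apply: lee_sum => x _.
    rewrite (eq_integral (fun=> (h x)%:E)) ?integral_cst//; first exact: borel_set1.
    by move=> y; rewrite inE => ->.
  - by move=> x; exact: borel_set1.
  - by move=> i j _ _ [y [-> ->]].
  - by apply/measurable_EFinP; exact: measurable_funS mh.
  - by move=> x _; rewrite lee_fin.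
apply: ge0_subset_integral => //; first exact/measurable_EFinP.
by move=> x _; rewrite lee_fin.
Qed.

Lemma pure_point_finite_approx (B : set T) (e : R) : pure_point nu ->
  bounded_borel B -> (0 < e)%R ->
  exists s, [/\ uniq s, forall x, x \in s -> B x & nu B <= \sum_(x <- s) nu [set x] + e%:E].
Proof.
move=> pp [mB pB] e0; have fB : nu B \is a fin_num.
  by rewrite ge0_fin_numE//; exact: radon_bounded_fin.
have : nu B - e%:E < \esum_(x in B) nu [set x].
  by rewrite -pp// lteBlDr// lteDl// ?lte_fin// fin_numE.
move=> /ereal_sup_gt[_ [A [fA AB] <-]] h.
exists (finmap.enum_fset (fset_set A)); split.
- exact: finmap.fset_uniq.
- by move=> x; rewrite (in_fset_set fA) inE; exact: AB.
- by rewrite -leeBlDr// -(fsbig_finite _ (fun x => nu [set x]) fA)// ltW.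
Qed.

(** Pure pointness speaks of relatively compact sets only. The level sets of a simple function below
    [h] at positive values are of this kind, so each may be replaced by finitely many of its atoms,
    with errors [d / 2], [d / 4] and so on. *)
Lemma pure_point_integral_le h (sigma : R) : pure_point nu ->
  continuous h -> (forall x, 0 <= h x)%R ->
  (forall c : R, (0 < c)%R -> precompact [set x | (c <= h x)%R]) ->
  (forall s, uniq s -> \sum_(x <- s) ((h x)%:E * nu [set x]) <= sigma%:E) ->
  \int[nu]_x (h x)%:E <= sigma%:E.
Proof.
move=> pp ch h0 ph hs.
rewrite ge0_integralTE//.
apply: ub_ereal_sup => _ [g /= gh <-].
have gh' x : (g x <= h x)%R by have := gh x; rewrite lee_fin.
rewrite sintegralE.
have key (ys : seq R) (d : R) : uniq ys -> (0 < d)%R -> (forall y, y \in ys -> 0 <= y)%R ->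
    exists s, [/\ uniq s, forall x, x \in s -> g x \in ys &
    \sum_(y <- ys) (y%:E * nu (g @^-1` [set y])) <=
    \sum_(x <- s) ((g x)%:E * nu [set x]) + d%:E].
  elim: ys d => [|y ys IH] d.
    by move=> _ d0 _; exists [::]; split=> //; rewrite !big_nil add0e lee_fin ltW.
  move=> /= /andP[yys uys] d0 yge.
  have d2 : (0 < d / 2)%R by rewrite divr_gt0.
  have [|s [us sys hsum]] := IH _ uys d2.
    by move=> z zs; apply: yge; rewrite inE zs orbT.
  (* The level set of 0 need not be relatively compact, but it contributes nothing. *)
  have [y0|y0] := eqVneq y 0%R.
    exists s; split=> //; first by move=> x /sys; rewrite inE orbC => ->.
    rewrite big_cons y0 mul0e add0e (le_trans hsum)// leeD2l// lee_fin.
    by rewrite ler_pdivrMr// ler_pMr// ler1n.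
  have ypos : (0 < y)%R by rewrite lt_neqAle eq_sym y0 yge// mem_head.
  have bF : bounded_borel (g @^-1` [set y]).
    split; first exact: measurable_sfunP.
    apply: precompact_subset (ph y ypos) => x /= <-; exact: gh'.
  have [t [ut tF ht]] := pure_point_finite_approx pp bF (divr_gt0 d2 ypos).
  exists (t ++ s); split.
  - rewrite cat_uniq ut us andbT /=; apply/hasPn => x /sys xys.
    apply/negP => /tF /= gx; by move: yys; rewrite -gx xys.
  - by move=> x; rewrite mem_cat inE => /orP[/tF/= ->|/sys ->]; rewrite ?eqxx ?orbT.
  - rewrite big_cons big_cat /=.
    have e1 : \sum_(x <- t) ((g x)%:E * nu [set x]) = y%:E * \sum_(x <- t) nu [set x].
      rewrite ge0_sume_distrr; last by move=> x _.
      by apply: eq_big_seq => x /tF /= ->.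
    have : y%:E * nu (g @^-1` [set y]) <= y%:E * \sum_(x <- t) nu [set x] + (d / 2)%:E.
      have y0e : 0 <= y%:E by rewrite lee_fin ltW.
      apply: (le_trans (lee_wpmul2l y0e ht)).
      by rewrite muleDr// ?fin_num_adde_defl// -EFinM mulrCA divff ?gt_eqF// mulr1.
    move=> /leeD /(_ hsum) /le_trans; apply.
    by rewrite e1 addeACA -EFinD -splitr.
apply/lee_addgt0Pr => d d0.
have fr : finite_set (range g) by [].
rewrite fsbig_finite//=.
have [||s [us _ hsum]] := key (finmap.enum_fset (fset_set (range g))) d _ d0.
- exact: finmap.fset_uniq.
- by move=> y; rewrite (in_fset_set fr) inE => -[x _ <-].
apply: (le_trans hsum); rewrite leeD2r// (le_trans _ (hs s us))//; apply: lee_sum => x _.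
by rewrite lee_wpmul2r// lee_fin.
Qed.

End pure_point_integral.

(** * Borel measures generated by a set function on open sets *)

Section outer_regular_measure.
Context (R : realType) (T : ptopologicalType).
Context (lam : set T -> \bar R).
Local Open Scope ereal_scope.
Hypothesis lam0 : lam set0 = 0.
Hypothesis lam_ge0 : forall U, 0 <= lam U.
Hypothesis lam_le : forall U V, open U -> open V -> U `<=` V -> lam U <= lam V.
Hypothesis lam_sub : forall U : nat -> set T, (forall n, open (U n)) ->
  lam (\bigcup_n U n) <= \sum_(n <oo) lam (U n).

(** The outer measure determined by the values on open sets. It serves twice: for sums of point
    masses and for the Riesz representation theorem. *)
Definition outer_regular (B : set T) : \bar R :=
  ereal_inf [set lam U | U in [set U : set T | open U /\ B `<=` U]].

Hypothesis lam_split : forall U V, open U -> open V ->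
  outer_regular (V `&` U) + outer_regular (V `\` U) <= lam V.

Lemma outer_regular_open U : open U -> outer_regular U = lam U.
Proof.
move=> oU; apply/eqP; rewrite eq_le; apply/andP; split.
  by apply: ereal_inf_lbound; exists U => //; split.
by apply: le_ereal_inf_tmp => _ [V [oV UV] <-]; exact: lam_le.
Qed.

Let or0 : outer_regular set0 = 0.
Proof. by rewrite outer_regular_open ?lam0//; exact: open0. Qed.

Let or_ge0 B : 0 <= outer_regular B.
Proof. by apply: le_ereal_inf_tmp => _ [V _ <-]; exact: lam_ge0. Qed.

Let or_le : {homo outer_regular : A B / A `<=` B >-> A <= B}.
Proof.
move=> A B AB; apply: ereal_inf_le_tmp => _ [V [oV BV] <-].
by exists V => //; split=> // x /AB/BV.
Qed.

Let or_sub : sigma_subadditive outer_regular.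
Proof.
move=> A; have [[i Aioo]|] := pselect (exists i, outer_regular (A i) = +oo).
  rewrite (eseries_pinfty _ _ Aioo) ?leey// => n _.
  by rewrite -ltNye (lt_le_trans _ (or_ge0 _)).
rewrite -forallNE => Aoo; apply/lee_addgt0Pr => e e0.
have fA i : outer_regular (A i) \is a fin_num.
  by rewrite ge0_fin_numE// lt_neqAle leey andbT; apply/eqP; exact: Aoo.
have ex n : exists U, [/\ open U, A n `<=` U &
    lam U <= outer_regular (A n) + (e / (2 ^ n.+1)%:R)%:E].
  have en : (0 < e / (2 ^ n.+1)%:R)%R by rewrite divr_gt0// ltr0n expn_gt0.
  have [_ [U [oU AU] <-] h] := lb_ereal_inf_adherent en (fA n).
  by exists U; split=> //; exact: ltW.
have [U HU] := choice ex.
apply: (@le_trans _ _ (lam (\bigcup_n U n))).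
  apply: ereal_inf_lbound; exists (\bigcup_n U n) => //; split.
    by apply: bigcup_open => n _; have [] := HU n.
  by move=> x [n _ Anx]; exists n => //; have [_ AU _] := HU n; exact: AU.
apply: (le_trans (lam_sub _)); first by move=> n; have [] := HU n.
apply: le_trans (epsilon_trick _ (fun n => or_ge0 (A n)) (ltW e0)).
by apply: lee_nneseries => [n _ _|n _]; [exact: lam_ge0|have [] := HU n].
Qed.

HB.instance Definition _ := isOuterMeasure.Build R T outer_regular or0 or_ge0 or_le or_sub.

(** Outer regularity reduces Caratheodory's condition to open test sets, and for those it is exactly
    [lam_split]. *)
Lemma outer_regular_caratheodory U : open U ->
  caratheodory_measurable outer_regular U.
Proof.
move=> oU; apply: le_caratheodory_measurable => X.
apply: le_ereal_inf_tmp => _ [V [oV XV] <-]; apply: le_trans (lam_split oU oV).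
apply: leeD; first by apply: or_le; exact: setSI.
by apply: or_le => x [Xx nU]; split=> //; exact: XV.
Qed.

Lemma outer_regular_borel (B : set (borel T)) : measurable B ->
  caratheodory_measurable outer_regular B.
Proof.
move=> mB; apply: (mB [set A | caratheodory_measurable outer_regular A]); split.
  split; first exact: caratheodory_measurable_set0.
    by move=> A mA; rewrite setTD; exact: caratheodory_measurable_setC.
  by move=> A mA; exact: caratheodory_measurable_bigcup.
by move=> U; exact: outer_regular_caratheodory.
Qed.

Lemma outer_regular_measure :
  exists m : {measure set (borel T) -> \bar R}, forall B, m B = outer_regular B.
Proof.
have sa : semi_sigma_additive (outer_regular : set (borel T) -> \bar R).
  move=> F mF tF mU.
  exact: (@caratheodory_measure_sigma_additive R T outer_regular F
    (fun n => outer_regular_borel (mF n)) tF (outer_regular_borel mU)).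
pose m : {measure set (borel T) -> \bar R} :=
  HB.pack (outer_regular : set (borel T) -> \bar R)
   (isMeasure.Build _ (borel T) R (outer_regular : set (borel T) -> \bar R) or0 or_ge0 sa).
by exists m.
Qed.

End outer_regular_measure.

(** * The Radon measure with prescribed locally summable point masses *)

Section atomic_measure.
Context (R : realType) (T : ptopologicalType) (hT : hausdorff_space T).
Context (w : T -> R) (w0 : forall x, 0 <= w x).
Local Open Scope ereal_scope.
Let lam (U : set T) : \bar R := \esum_(x in U) (w x)%:E.
Hypothesis w_loc : forall x, exists U, [/\ open U, U x & lam U < +oo].

Let w0e x : 0 <= (w x)%:E. Proof. by rewrite lee_fin. Qed.
Let lam_ge0 U : 0 <= lam U. Proof. by apply: esum_ge0 => x _. Qed.
Let lamID A B : lam A = lam (A `&` B) + lam (A `\` B).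
Proof. by rewrite /lam (esumID B)// setDE. Qed.
Let lam_le A B : A `<=` B -> lam A <= lam B.
Proof.
by move=> AB; rewrite [leRHS](lamID _ A) (setIidr AB) leeDl.
Qed.
Let lam_sub (U : nat -> set T) : lam (\bigcup_n U n) <= \sum_(n <oo) lam (U n).
Proof.
rewrite (seqDU_bigcup_eq U) /lam (@nneseries_sum_bigcup _ _ _ (fun x => (w x)%:E))//.
by apply: lee_nneseries => [n _ _|n _]; [exact: lam_ge0|apply: lam_le; exact: subset_seqDU].
Qed.

Let lam_U2 A B : lam (A `|` B) <= lam A + lam B.
Proof.
rewrite (lamID _ A) leeD//; first by apply: lam_le; exact: subIsetr.
by apply: lam_le => x [[Ax|//] nAx].
Qed.

Let lam_fsets A (e : R) : (0 < e)%R -> lam A < +oo -> exists F : set T,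
  [/\ finite_set F, F `<=` A & lam A - e%:E < lam F].
Proof.
move=> e0 Aoo; have fA : lam A \is a fin_num by rewrite ge0_fin_numE.
have : lam A - e%:E < lam A by rewrite lteBlDr// lteDl// ?lte_fin// fin_numE.
move=> /ereal_sup_gt[_ [F [fF FA] <-]] h; exists F; split=> //.
by apply: (lt_le_trans h); rewrite /lam esum_fset.
Qed.

Let openDfin U (F : set T) : open U -> finite_set F -> open (U `\` F).
Proof.
move=> oU fF; rewrite setDE; apply: openI => //; apply: closed_openC.
exact: (accessible_finite_set_closed.1 (hausdorff_accessible hT)) fF.
Qed.

Let nu := outer_regular lam.

Let nu_open U : open U -> nu U = lam U.
Proof. by move=> oU; apply: outer_regular_open => // A B _ _; exact: lam_le. Qed.

Let nu_le A B : A `<=` B -> nu A <= nu B.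
Proof.
move=> AB; apply: ereal_inf_le_tmp => _ [V [oV BV] <-].
by exists V => //; split=> // x /AB/BV.
Qed.

Let lam_nu A : lam A <= nu A.
Proof. by apply: le_ereal_inf_tmp => _ [V [oV AV] <-]; exact: lam_le. Qed.

(** A finite set [F] carries all but [e] of the mass of the complement of [A] in [U]. Removing it
    from [U] leaves an open set, finite sets being closed, that contains [A] and exceeds its mass by
    at most [e]. *)
Let nu_lam U A : open U -> lam U < +oo -> A `<=` U -> nu A = lam A.
Proof.
move=> oU Uoo AU; apply/eqP; rewrite eq_le lam_nu andbT.
apply/lee_addgt0Pr => e e0.
have UAoo : lam (U `\` A) < +oo by apply: le_lt_trans Uoo; apply: lam_le; exact: subDsetl.
have [F [fF FUA h]] := lam_fsets e0 UAoo.
have fin B : B `<=` U -> lam B \is a fin_num.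
  by move=> BU; rewrite ge0_fin_numE//; apply: le_lt_trans Uoo; exact: lam_le.
apply: (@le_trans _ _ (lam (U `\` F))).
  apply: ereal_inf_lbound; exists (U `\` F) => //; split; first exact: openDfin.
  by move=> x Ax; split; [exact: AU|move=> /FUA[]].
have FU : F `<=` U by move=> x /FUA[].
have e1 : lam U = lam F + lam (U `\` F) by rewrite (lamID _ F) (setIidr FU).
have e2 : lam U = lam A + lam (U `\` A) by rewrite (lamID _ A) (setIidr AU).
move: h e1 e2; have := fin F FU; have := fin A AU; have := fin U (@subset_refl _ U).
have := fin (U `\` A) (@subDsetl _ _ _); have := fin (U `\` F) (@subDsetl _ _ _).
case: (lam F) (lam A) (lam U) (lam (U `\` A)) (lam (U `\` F)) => [a||] [b||] [c||] [d||] [f||] //= _ _ _ _ _.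
rewrite -EFinB -!EFinD lte_fin lee_fin => h [e1] [e2]; lra.
Qed.

Let lam_split U V : open U -> open V -> nu (V `&` U) + nu (V `\` U) <= lam V.
Proof.
move=> oU oV; have [Voo|] := boolP (lam V < +oo); last by rewrite -leNgt leye_eq => /eqP ->; rewrite leey.
by rewrite (lamID _ U) !(nu_lam oV Voo).
Qed.

Lemma compact_lam_open (K : set T) : compact K ->
  exists U, [/\ open U, K `<=` U & lam U < +oo].
Proof.
move=> cK; have [U HU] := choice w_loc.
move: cK; rewrite compact_cover => /(_ T setT U).
case; first by move=> x _; have [] := HU x.
  by move=> x _; exists x => //; have [] := HU x.
move=> l _ Kl; exists (\big[setU/set0]_(x <- finmap.enum_fset l) U x).
have : forall x, K x -> exists2 s, s \in finmap.enum_fset l & U s x.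
  by move=> x /Kl[s sl Us]; exists s.
move=> {}Kl; split.
- elim: (finmap.enum_fset l) => [|t r IH]; first by rewrite big_nil; exact: open0.
  by rewrite big_cons; apply: openU => //; have [] := HU t.
- move=> x /Kl[s]; elim: (finmap.enum_fset l) => // t r IH.
  by rewrite inE big_cons => /orP[/eqP -> Us|tr Us]; [left|right; exact: IH].
- elim: (finmap.enum_fset l) => [|t r IH]; first by rewrite big_nil /lam esum_set0.
  rewrite big_cons; apply: le_lt_trans (lam_U2 _ _) _.
  by apply: lte_add_pinfty => //; have [] := HU t.
Qed.

(** Compact sets have open neighbourhoods of finite mass, inside which the outer regular extension
    is the plain sum of the weights; hence pure pointness on relatively compact sets. *)
Lemma atomic_measure_exists : exists nu : radon_measure R T,
  pure_point nu /\ forall x, nu [set x] = (w x)%:E.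
Proof.
have [m mE] := @outer_regular_measure R T lam (esum_set0 _) lam_ge0
  (fun U V _ _ => @lam_le U V) (fun U _ => lam_sub U) lam_split.
have mlam K B : compact K -> B `<=` K -> m B = lam B.
  move=> cK BK; have [U [oU KU Uoo]] := compact_lam_open cK.
  by rewrite mE; apply: (nu_lam oU Uoo); exact: subset_trans KU.
have m1 x : m [set x] = (w x)%:E.
  rewrite (mlam [set x])//; last exact: compact_set1.
  by rewrite /lam esum_set1.
have rm : is_radon m.
  split.
  - move=> K cK _; have [U [oU KU Uoo]] := compact_lam_open cK.
    by rewrite mE; apply: le_lt_trans Uoo; rewrite -nu_open//; exact: nu_le.
  - move=> B mB; rewrite mE /outer_regular; congr ereal_inf.
    by apply: eq_imagel => U [oU _]; rewrite mE -/nu nu_open.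
  - move=> U oU; rewrite mE -/nu nu_open//; apply/eqP; rewrite eq_le; apply/andP; split.
      (* Inner regularity: finite subsets are compact and already exhaust the sum of the weights. *)
      apply: ub_ereal_sup => _ [F [fF FU] <-].
      apply: (@le_trans _ _ (m F)).
        rewrite mE; apply: le_trans (lam_nu _); rewrite /lam esum_fset//.
      apply: ereal_sup_ubound; exists F => //; split=> //; first exact: finite_compact.
      apply: closed_borel; exact: (accessible_finite_set_closed.1 (hausdorff_accessible hT)) fF.
    apply: ub_ereal_sup => _ [K [cK mK KU] <-].
    by rewrite -nu_open// mE; exact: nu_le.
exists (RadonMeasure rm); split=> [B mB [K BK [cK _]]|x]; last exact: m1.
by rewrite /= (mlam K B)//; apply: eq_esum => x _; rewrite m1.
Qed.

End atomic_measure.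

(** * Fourier transforms of test functions and atoms *)

Section fourier_transform_of_test_functions.
Context (R : realType) (G : topologicalZmodType) (hG : hausdorff_space G).
Context (lcG : locally_compact [set: G]).
Context (theta : radon_measure R G) (haar : is_haar theta).
Implicit Types (f g phi psi : G -> R[i]) (chi omega : dual R G) (K : set G).

Let Th := locfun_cintegral hG theta.
Local Notation ift := (inverse_fourier theta).

Lemma ift_continuous phi : Cc phi -> continuous (fun chi : dual R G => cabs (ift phi chi)).
Proof.
move=> cphi chi; have bphi := Cc_buc cphi; have [[M fM] _] := bphi.
have M0 : 0 <= M by rewrite (le_trans _ (fM 0))// cabs_ge0.
have [K cK sK] := Cc_supp cphi; have bK := bounded_borel_compact hG cK.
apply/(@cvgrPdist_lt _ _ _ _ (@nbhs_filter (dual R G) chi)) => e e0.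
pose C := 2 * vol theta K * M + 1.
have C0 : 0 < C by rewrite ltr_wpDl// !mulr_ge0// vol_ge0.
apply: (@filterS _ _ (@nbhs_filter (dual R G) chi) _ _ _ (dual_nbhs chi cK (divr_gt0 e0 C0))) => omega ho.
rewrite (le_lt_trans (cabs_dist _ _))//.
have b (x : dual R G) : bmeas (fun t => x t * phi t).
  by apply: buc_bmeas; apply: bucM => //; exact: dual_buc.
have E (x : dual R G) : ift phi x = cintegral theta (cut K (fun t => x t * phi t)).
  by rewrite cut_id// => t /sK ->; rewrite mulr0.
rewrite !E -(locfun_cutB Th bK)//.
apply: (@le_lt_trans _ _ (2 * vol theta K * (e / C * M))).
  apply: cintegral_bound => //; first exact: bmeasB.
    by rewrite mulr_ge0// ltW// divr_gt0.
  move=> x Kx; rewrite -mulrBl cabsM ler_pM ?cabs_ge0//.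
  by apply/ltW; exact: ho.
have -> : 2 * vol theta K * (e / C * M) = (C - 1) / C * e.
  by rewrite /C; field; rewrite -/C gt_eqF.
by rewrite gtr_pMl// ltr_pdivrMr// mul1r; lra.
Qed.

Lemma ift_translate phi chi u : Cc phi ->
  cintegral theta (fun t => chi t * phi (t - u)) = chi u * ift phi chi.
Proof.
move=> cphi; have bphi := Cc_buc cphi; have [_ cD _] := dual_character chi.
have bF : bmeas (fun t => chi t * phi (t - u)).
  by apply: buc_bmeas; apply: bucM; [exact: dual_buc|exact: (buc2_l u (buc2_sub bphi))].
rewrite -(haar_translate haar u bF).
have [K cK sK] := Cc_supp cphi; have bK := bounded_borel_compact hG cK.
rewrite -[inverse_fourier _ _ _]/(cintegral theta (fun t => chi t * phi t)).
rewrite -[X in _ = _ * cintegral _ X](@cut_id _ _ K); last by move=> x /sK ->; rewrite mulr0.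
rewrite -(locfun_cutZ Th bK); last by apply: buc_bmeas; apply: bucM => //; exact: dual_buc.
rewrite cut_id; last by move=> x /sK ->; rewrite !mulr0.
by congr cintegral; apply/funext => t; rewrite cD (addrC u) addrK mulrA.
Qed.

(** [(chi u - 1) * ift phi chi] is the transform of the translate of [phi] by [u] minus [phi], which
    is small for small [u] uniformly in [chi]; the lower bound [c] allows division. *)
Lemma ift_equicontinuous phi (c : R) : Cc phi -> 0 < c -> forall e : R, 0 < e ->
  exists2 U, nbhs (0 : G) U & forall chi u, c <= cabs (ift phi chi) -> U u ->
    cabs (chi u - 1) <= e.
Proof.
move=> cphi c0 e e0; have bphi := Cc_buc cphi; have [_ uphi] := bphi.
have [K cK sK] := Cc_supp cphi.
have [V [oV V0] [L VL [cL clL]]] := nbhs0_precompact lcG.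
have [L' sL' LL'] := sym_compact_ex cL; have [cL' L'0 L'N] := sL'.
have cKL : compact (setadd K L') by exact: setadd_compact.
have bKL := bounded_borel_compact hG cKL.
pose C := 2 * vol theta (setadd K L') + 1.
have C0 : 0 < C by rewrite ltr_wpDl// mulr_ge0// vol_ge0.
have e1 : 0 < e * c / C by rewrite divr_gt0// mulr_gt0.
have [U [U0 HU]] := uphi _ e1.
exists (U `&` V); first by apply: filterI => //; apply: open_nbhs_nbhs; split.
move=> chi u hc [Uu Vu]; rewrite -(ler_pM2r c0).
apply: (@le_trans _ _ (cabs (chi u - 1) * cabs (ift phi chi))).
  by rewrite ler_wpM2l// cabs_ge0.
rewrite -cabsM mulrBl mul1r -ift_translate//.
have b1 : bmeas (fun t => chi t * phi (t - u)).
  by apply: buc_bmeas; apply: bucM; [exact: dual_buc|exact: (buc2_l u (buc2_sub bphi))].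
have b2 : bmeas (fun t => chi t * phi t).
  by apply: buc_bmeas; apply: bucM => //; exact: dual_buc.
have -> : cintegral theta (fun t => chi t * phi (t - u)) =
    cintegral theta (cut (setadd K L') (fun t => chi t * phi (t - u))).
  rewrite cut_id// => t nt; rewrite sK ?mulr0// => Kt; apply: nt.
  by exists (t - u) => //; exists u; [apply: LL'; exact: VL|rewrite subrK].
have -> : ift phi chi = cintegral theta (cut (setadd K L') (fun t => chi t * phi t)).
  rewrite cut_id// => t nt; rewrite sK ?mulr0// => Kt; apply: nt.
  by exists t => //; exists 0; rewrite ?addr0.
rewrite -(locfun_cutB Th bKL)//.
apply: (@le_trans _ _ (2 * vol theta (setadd K L') * (e * c / C))).
  apply: cintegral_bound => //; first exact: bmeasB.
    exact: ltW.
  move=> x _; rewrite -mulrBr cabsM cabs_chi mul1r; apply/ltW; apply: HU.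
  by rewrite opprB addrC subrK.
have -> : 2 * vol theta (setadd K L') * (e * c / C) = (C - 1) / C * (e * c).
  by rewrite /C; field; rewrite -/C gt_eqF.
by rewrite ger_pMl ?mulr_gt0// ler_pdivrMr// mul1r gerBl.
Qed.

(** The Riemann-Lebesgue lemma: the characters at which the transform is not small form an
    equicontinuous closed set, compact by Arzela-Ascoli. *)
Lemma ift_precompact phi (c : R) : Cc phi -> 0 < c ->
  precompact [set chi : dual R G | c <= cabs (ift phi chi) ^+ 2].
Proof.
(* For a modulus below 1 the square is at most the modulus, so the bound on the square passes to the
   modulus with [d]. *)
move=> cphi c0; pose d := Num.min c 1.
have d0 : 0 < d by rewrite lt_min c0 ltr01.
pose W : set (dual R G) := [set chi | d <= cabs (ift phi chi)].
have clW : closed W.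
  have -> : W = (fun chi : dual R G => cabs (ift phi chi)) @^-1` [set x | d <= x] by [].
  by apply: closed_comp; [move=> x _; exact: ift_continuous|exact: closed_ge].
exists W.
  move=> chi /= h; rewrite /W /= leNgt; apply/negP => hd.
  have a0 := cabs_ge0 (ift phi chi).
  have a1 : cabs (ift phi chi) < 1 by rewrite (lt_le_trans hd)// ge_min lexx orbT.
  have ac : cabs (ift phi chi) < c by rewrite (lt_le_trans hd)// ge_min lexx.
  have : cabs (ift phi chi) ^+ 2 <= cabs (ift phi chi) by rewrite expr2 ler_piMl// ltW.
  by move=> /(le_trans h); rewrite leNgt ac.
split=> //; rewrite compact_ultra => F FU FW.
have eqc e : 0 < e -> exists2 U, nbhs (0 : G) U & forall chi u, W chi -> U u -> cabs (chi u - 1) <= e.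
  by move=> e0; exact: (ift_equicontinuous cphi d0 e0).
have [chi Fchi] := equicontinuous_dual_precompact eqc FU FW.
exists chi; split=> //.
apply: clW => B /Fchi FB; have [x [Wx Bx]] := filter_ex (filterI FW FB).
by exists x.
Qed.

Lemma integral_bump_gt0 (h : G -> R) K : continuous h -> (forall x, 0 <= h x) ->
  compact K -> (forall x, ~ K x -> h x = 0) -> 0 < h 0 ->
  exists2 r : R, 0 < r & cintegral theta (fun x => (h x)%:C%C) = r%:C%C.
Proof.
move=> ch h0 cK sK hp; have bK := bounded_borel_compact hG cK; have [mK _] := bK.
exists (\int[theta]_x h x); last first.
  by rewrite /cintegral /=; congr Complex; rewrite /Rintegral integral0.
pose U := [set x | h 0 / 2 < h x].
have oU : open U by apply: (@open_comp _ _ h [set y | h 0 / 2 < y]) => [x _|]; [exact: ch|exact: open_gt].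
have U0 : U 0 by rewrite /U /= ltr_pdivrMr// ltr_pMr// ltr1n.
have UK : U `<=` K.
  by move=> x; rewrite /U /= => hx; apply: contrapT => /sK hx0; move: hx; rewrite hx0 ltNge divr_ge0// ltW.
have mU : measurable (U : set (borel G)) by exact: open_borel.
have mh : measurable_fun [set: borel G] (h : borel G -> R) by exact: continuous_borel.
have tU : (0 < theta U)%E by apply: (haar_open_gt0 hG haar) => //; exists 0.
have low : ((h 0 / 2)%:E * theta U <= \int[theta]_x (h x)%:E)%E.
  rewrite -integral_cst//; apply: (@le_trans _ _ (\int[theta]_(x in (U : set (borel G))) (h x)%:E)%E).
    apply: ge0_le_integral => //.
    - by move=> x _; rewrite lee_fin divr_ge0// ltW.
    - by apply/measurable_EFinP; exact: measurable_funS mh.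
    - by move=> x Ux; rewrite lee_fin ltW.
  apply: ge0_subset_integral => //; first exact/measurable_EFinP.
  by move=> x _; rewrite lee_fin.
rewrite /Rintegral fine_gt0//; apply/andP; split.
  by apply: lt_le_trans low; rewrite mule_gt0// lte_fin divr_gt0.
have e1 : (\int[theta]_x (h x)%:E = \int[theta]_(x in (K : set (borel G))) (h x)%:E)%E.
  rewrite [RHS]integral_mkcond; apply: eq_integral => x _; rewrite /patch.
  by case: ifPn => //; rewrite notin_setE => /sK ->.
rewrite e1.
have [M hM] := ((Cc_buc (Cc_sub hG (cont_real ch) cK (fun x nx => congr1 (fun z => z%:C%C) (sK x nx)))).1).
apply: (@le_lt_trans _ _ (\int[theta]_(x in (K : set (borel G))) M%:E)%E).
  apply: ge0_le_integral => //.
  - by move=> x _; rewrite lee_fin.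
  - by apply/measurable_EFinP; exact: measurable_funS mh.
  - by move=> x Kx; rewrite lee_fin; have := hM x; rewrite cabsR ger0_norm.
rewrite integral_cst// lte_mul_pinfty ?lee_fin//.
  by rewrite (le_trans _ (hM 0))// cabs_ge0.
exact: radon_bounded_fin.
Qed.

Lemma small_bump (U : set G) : open U -> U 0 -> exists (e : G -> R) K,
  [/\ continuous e, forall x, 0 <= e x, compact K & forall x, ~ K x -> e x = 0] /\
  [/\ forall x, ~ U x -> e x = 0, e 0 = 1, Cc (fun x => (e x)%:C%C) &
   exists2 r : R, 0 < r & cintegral theta (fun x => (e x)%:C%C) = r%:C%C].
Proof.
move=> oU U0.
have [//|e [ce e01 e1 eU cK]] := @bump R G hG lcG [set 0] U (@compact_set1 _ 0) oU _.
  by move=> _ ->.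
have e0 x : 0 <= e x by have /andP[] := e01 x.
have eK x : ~ closure [set x | e x != 0] x -> e x = 0.
  by move=> nx; apply/eqP/negPn/negP => ex; apply: nx; exact: subset_closure.
exists e, (closure [set x | e x != 0]); split=> //; split=> //; first exact: e1.
  exact: real_Cc.
by apply: (integral_bump_gt0 ce e0 cK eK); rewrite e1.
Qed.

Lemma ift_nonzero chi : exists2 phi, Cc phi & ift phi chi != 0.
Proof.
have [e [K [[ce e0 cK sK] [_ e1 Ce [r r0 he]]]]] := small_bump openT I.
exists (fun x => (chi x)^*%C * (e x)%:C%C).
  apply: (@Cc_sub _ _ hG _ K) => //; last by move=> x /sK ->; rewrite mulr0.
  by apply: buc_cont; apply: bucM; [apply: bucJ; exact: dual_buc|exact: Cc_buc].
rewrite (_ : ift _ _ = r%:C%C); last first.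
  by rewrite -he; congr cintegral; apply/funext => t; rewrite mulrA mulJ_chi mul1r.
by apply/eqP => /(congr1 (@complex.Re R)) /= r00; rewrite r00 ltxx in r0.
Qed.

(* Uniqueness of Haar measure on an abelian group, specialised to the
   reflected measure: both sides of [I f * I g' = I f' * I g'] are double
   integrals of [f x * g (- x - y)]. *)
Lemma haar_reflect f : Cc f -> cintegral theta (fun x => f (- x)) = cintegral theta f.
Proof.
move=> cf; have bf := Cc_buc cf.
have [e [L [[ce e0 cL sL] [_ e1 Ce [r r0 he]]]]] := small_bump openT I.
pose g' := fun x => (e x)%:C%C : R[i]; have bg' : buc g' by exact: Cc_buc.
have [K cK sK] := Cc_supp cf.
have [S sS KLS] := sym_compact_ex (compactU cK cL).
have [cS S0 SN] := sS; have sSS := sym_compact_add sS sS; have [cSS SS0 SSN] := sSS.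
have bS := bounded_borel_compact hG cS; have bSS := bounded_borel_compact hG cSS.
have fS x : ~ S x -> f x = 0 by move=> nS; apply: sK => Kx; apply: nS; apply: KLS; left.
have gS x : ~ S x -> g' x = 0 by move=> nS; rewrite /g' sL// => Lx; apply: nS; apply: KLS; right.
pose g := fun x => g' (- x); have bg : buc g by exact: bucN.
have b1 : buc2 (fun x y => f x * g (- (x + y))).
  apply: buc2M; first exact: buc2_fst.
  have := buc2_add (bucN bg); exact.
have e1' : cintegral theta f * cintegral theta g' =
    cintegral theta (cut S (fun x => cintegral theta (cut (setadd S S) (fun y => f x * g (- (x + y)))))).
  have -> : cintegral theta f = cintegral theta (cut S f) by rewrite cut_id.
  rewrite mulrC -(locfun_cutZ Th bS); last exact: buc_bmeas.
  congr cintegral; apply: cut_eq => x Sx.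
  rewrite (locfun_cutZ Th bSS); last by apply: buc_bmeas; have := buc2_r x (buc2_add (bucN bg)).
  rewrite mulrC; congr (_ * _).
  rewrite -(haar_translate haar x (buc_bmeas bg')) cut_id.
    by congr cintegral; apply/funext => y; rewrite /g opprK.
  move=> y nSS; rewrite /g opprK gS// => Sxy; apply: nSS.
  by exists (x + y) => //; exists (- x); [exact: SN|rewrite addrC addKr].
have e2 : cintegral theta (fun x => f (- x)) * cintegral theta g' =
    cintegral theta (cut S (fun x => cintegral theta (cut (setadd S S) (fun y => f (x - y) * g (- x))))).
  have -> : cintegral theta g' = cintegral theta (cut S g') by rewrite cut_id.
  rewrite -(locfun_cutZ Th bS); last exact: buc_bmeas.
  congr cintegral; apply: cut_eq => x Sx.
  rewrite (_ : (fun y => f (x - y) * g (- x)) = (fun y => g' x * f (x - y))); last first.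
    by apply/funext => y; rewrite /g opprK mulrC.
  rewrite (locfun_cutZ Th bSS); last by apply: buc_bmeas; exact: buc_subl.
  rewrite mulrC; congr (_ * _).
  rewrite -(haar_translate haar (- x) (buc_bmeas (bucN bf))) cut_id.
    by congr cintegral; apply/funext => y; rewrite opprD opprK.
  move=> y nSS; rewrite fS// => Sxy; apply: nSS.
  exists x => //; exists (- (x - y)); first exact: SN.
  by rewrite opprB addrC subrK.
have b2 : buc2 (fun x y => f (x - y) * g (- x)).
  by apply: buc2M; [exact: buc2_sub|apply: buc2_fst; exact: bucN].
have : cintegral theta (fun x => f (- x)) * cintegral theta g' = cintegral theta f * cintegral theta g'.
  rewrite e1' e2 (fubini Th Th b1 bS bSS) (fubini Th Th b2 bS bSS).
  congr cintegral; apply: cut_eq => y SSy.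
  have bF : bmeas (fun x => f x * g (- (x + y))) by apply: buc_bmeas; exact: (buc2_l y b1).
  rewrite !cut_id.
  - rewrite -[RHS](haar_translate haar (- y) bF); congr cintegral; apply/funext => x.
    by rewrite (addrC (- y)) subrK.
  - by move=> x /fS ->; rewrite mul0r.
  - by move=> x /gS gx; rewrite /g opprK gx mulr0.
apply: mulIf; rewrite he; apply/eqP => /(congr1 (@complex.Re R)) /= r00.
by rewrite r00 ltxx in r0.
Qed.

End fourier_transform_of_test_functions.

Lemma cvg_cabs (R : realType) (u : nat -> R[i]) (l : R[i]) :
  u @ \oo --> l -> cabs (u n) @[n --> \oo] --> cabs l.
Proof.
move=> /cvgC_near ul; apply/cvgrPdist_lt => e e0.
apply: filterS (ul e e0) => n; rewrite distrC; exact: le_lt_trans (cabs_dist _ _).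
Qed.

(** * Recovering the atoms of a measure from its integrals of squared transforms *)

Section atoms.
Context (R : realType) (G : topologicalZmodType) (hG : hausdorff_space G).
Context (lcG : locally_compact [set: G]).
Context (theta : radon_measure R G) (haar : is_haar theta).
Context (A : nat -> set G) (hA : van_hove theta A).
Implicit Types (phi psi : G -> R[i]) (chi omega : dual R G) (K : set G).

Let Th := locfun_cintegral hG theta.
Local Notation ift := (inverse_fourier theta).

(* [inverse_fourier (modulated psi chi n)] tends to [inverse_fourier psi] times the
   indicator of [chi]: this isolates the atom at [chi]. *)
Definition modulated psi chi n : G -> R[i] :=
  fun t => avg theta (A n) (fun a => (chi a)^*%C * psi (t - a)).

Let mod2 psi chi : Cc psi -> buc2 (fun t a => (chi a)^*%C * psi (t - a)).
Proof.
move=> cpsi; apply: buc2M; last by apply: buc2_sub; exact: Cc_buc.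
by apply: buc2_snd; apply: bucJ; exact: dual_buc.
Qed.

Let mod_supp psi chi n : Cc psi -> exists2 E, compact E &
  (forall x, ~ E x -> modulated psi chi n x = 0) /\
  (forall x a, A n a -> ~ E x -> psi (x - a) = 0).
Proof.
move=> cpsi; have [oA pA bA A0] := vH_basic hG n hA.
have [L AL [cL _]] := pA; have [K cK sK] := Cc_supp cpsi.
have H x a : A n a -> ~ setadd L K x -> psi (x - a) = 0.
  move=> Aa nx; apply: sK => Kxa; apply: nx; exists a; first exact: AL.
  by exists (x - a) => //; rewrite addrC subrK.
exists (setadd L K); first exact: setadd_compact.
split=> // x nx; rewrite /modulated /avg (_ : cintegral _ _ = 0) ?mulr0//.
rewrite -[RHS](locfun_cut0 Th bA); congr cintegral.
by apply: cut_eq => a Aa; rewrite H// mulr0.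
Qed.

Lemma modulated_Cc psi chi n : Cc psi -> Cc (modulated psi chi n).
Proof.
move=> cpsi; have [oA pA bA A0] := vH_basic hG n hA.
have [E cE [sE _]] := mod_supp chi n cpsi.
apply: (@Cc_sub _ _ hG _ E) => //.
by apply: buc_cont; apply: bucZ; exact: (buc_locfun Th (mod2 chi cpsi) bA).
Qed.

Lemma ift_modulated psi chi omega n : Cc psi ->
  ift (modulated psi chi n) omega =
  avg theta (A n) (fun a => omega a * (chi a)^*%C) * ift psi omega.
Proof.
move=> cpsi; have [oA pA bA A0] := vH_basic hG n hA.
have [E cE [sE sE2]] := mod_supp chi n cpsi; have bE := bounded_borel_compact hG cE.
have bpsi := Cc_buc cpsi.
pose Phi t a := omega t * ((chi a)^*%C * psi (t - a)).
have bPhi : buc2 Phi by apply: buc2M; [apply: buc2_fst; exact: dual_buc|exact: mod2].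
have b1 t : bmeas (fun a => (chi a)^*%C * psi (t - a)).
  by apply: buc_bmeas; exact: (buc2_r t (mod2 chi cpsi)).
have bJ : bmeas (fun t => cintegral theta (cut (A n) (Phi t))).
  by apply: buc_bmeas; exact: (buc_locfun Th bPhi bA).
have -> : ift (modulated psi chi n) omega =
   ((vol theta (A n))^-1)%:C%C * cintegral theta (cut E (fun t => cintegral theta (cut (A n) (Phi t)))).
  rewrite -(locfun_cutZ Th bE)// /inverse_fourier -[LHS](congr1 (cintegral theta) (@cut_id _ _ E _ _)); last first.
    by move=> x /sE ->; rewrite mulr0.
  congr cintegral; apply: cut_eq => t Et.
  by rewrite /Phi (locfun_cutZ Th bA)// /modulated /avg mulrCA.
rewrite (fubini Th Th bPhi bE bA) /avg -mulrA; congr (_ * _).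
have bw : bmeas (fun a => omega a * (chi a)^*%C).
  by apply: buc_bmeas; apply: bucM; [|apply: bucJ]; exact: dual_buc.
rewrite mulrC -(locfun_cutZ Th bA)//; congr cintegral; apply: cut_eq => a Aa.
have b2 : bmeas (fun t => omega t * psi (t - a)).
  apply: buc_bmeas; apply: bucM; first exact: dual_buc.
  exact: (buc2_l a (buc2_sub bpsi)).
have -> : ift psi omega * (omega a * (chi a)^*%C) =
    (chi a)^*%C * (omega a * ift psi omega) by ring.
rewrite -(ift_translate hG haar)//.
rewrite (_ : cut E _ = cut E (fun t => (chi a)^*%C * (omega t * psi (t - a)))).
  rewrite (locfun_cutZ Th bE)// cut_id//.
  by move=> t nE; rewrite sE2// mulr0.
by congr cut; apply/funext => t; rewrite /Phi mulrCA.
Qed.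

Lemma ift_sqr_measurable phi : Cc phi ->
  measurable_fun [set: borel (dual R G)] (fun omega : borel (dual R G) => cabs (ift phi omega) ^+ 2).
Proof.
move=> cphi; apply: measurable_funX.
apply: (@continuous_borel R (dual R G)).
exact: (@ift_continuous R G hG theta phi cphi).
Qed.

Lemma atom_limit (m : radon_measure R (dual R G)) psi chi : Cc psi ->
  m.-integrable setT (fun omega => (cabs (ift psi omega) ^+ 2)%:E) ->
  (\int[m]_omega (cabs (ift (modulated psi chi n) omega) ^+ 2)%:E)%E @[n --> \oo] -->
  ((cabs (ift psi chi) ^+ 2)%:E * m [set chi])%E.
Proof.
move=> cpsi ipsi.
have hD := @dual_hausdorff R G.
have m1 : measurable ([set chi] : set (borel (dual R G))) by exact: borel_set1.
pose f (omega : borel (dual R G)) : \bar R :=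
  ((cabs (ift psi chi) ^+ 2) * \1_([set chi] : set (borel (dual R G))) omega)%:E.
have -> : ((cabs (ift psi chi) ^+ 2)%:E * m [set chi] = \int[m]_omega f omega)%E.
  rewrite /f; under eq_integral do rewrite EFinM.
  rewrite ge0_integralZl//.
  - by rewrite integral_indic// setIT.
  - by apply/measurable_EFinP; exact: measurable_indic.
  - by rewrite lee_fin sqr_ge0.
(* The value 2 is the loss of [cabs_avg]; its square is the constant in the dominating function
   [g]. *)
have cb n omega : cabs (avg theta (A n) (fun a => omega a * (chi a)^*%C)) <= 2.
  have [oA pA bA A0] := vH_basic hG n hA.
  have bw : bmeas (fun a => omega a * (chi a)^*%C).
    by apply: buc_bmeas; apply: bucM; [|apply: bucJ]; exact: dual_buc.
  rewrite (le_trans (cabs_avg hG bA A0 bw))// -[leRHS]mulr1 ler_pM2l//.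
  by apply: aavg_le_cst => // x _; rewrite cabsM cabsJ !cabs_chi mulr1.
pose u n (omega : borel (dual R G)) : \bar R := (cabs (ift (modulated psi chi n) omega) ^+ 2)%:E.
pose g (omega : borel (dual R G)) : \bar R := ((2 ^+ 2 : R) * cabs (ift psi omega) ^+ 2)%:E.
have mu n : measurable_fun setT (u n).
  by apply/measurable_EFinP; apply: ift_sqr_measurable; exact: modulated_Cc.
have mf : measurable_fun setT f.
  apply/measurable_EFinP; apply: measurable_funM; first exact: measurable_cst.
  exact: measurable_indic.
have uf : {ae m, forall omega, setT omega -> u n omega @[n --> \oo] --> f omega}.
  apply: aeW => omega _; rewrite /f /u indicE.
  apply: cvg_EFin; first exact: nearW.
  have hc := avg_chi_mul hG haar (chi:=omega) (omega:=chi) hA.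
  have hs : cabs (avg theta (A n) (fun t : G => (omega : dual R G) t * (chi t)^*%C)) ^+ 2 @[n --> \oo]
      --> cabs ((omega == chi)%:R : R[i]) ^+ 2.
    exact: (cvgM (cvg_cabs hc) (cvg_cabs hc)).
  have -> : cabs (ift psi chi) ^+ 2 * ((omega : borel (dual R G)) \in [set chi])%:R =
      cabs ((omega == chi)%:R : R[i]) ^+ 2 * cabs (ift psi omega) ^+ 2.
    have [->|oc] := eqVneq omega chi.
      by rewrite cabs1 expr1n mul1r mem_set// mulr1.
    by rewrite cabs0 expr0n/= mul0r memNset ?mulr0// => /eqP; exact/negP.
  rewrite (_ : fine \o _ = (fun n =>
      cabs (avg theta (A n) (fun t : G => (omega : dual R G) t * (chi t)^*%C)) ^+ 2 *
      cabs (ift psi omega) ^+ 2)).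
    exact: (cvgM hs (cvg_cst _)).
  by apply/funext => n; rewrite /= ift_modulated// cabsM exprMn.
have ig : m.-integrable setT g.
  rewrite (_ : g = fun omega => ((2 ^+ 2 : R)%:E * (cabs (ift psi omega) ^+ 2)%:E)%E).
    exact: integrableZl.
  by apply/funext => omega; rewrite /g EFinM.
have ug : {ae m, forall omega n, setT omega -> (`|u n omega| <= g omega)%E}.
  apply: aeW => omega n _; rewrite /u ift_modulated// cabsM exprMn gee0_abs ?lee_fin//; last first.
    by rewrite mulr_ge0// sqr_ge0.
  rewrite /g ?lee_fin ler_wpM2r ?sqr_ge0//.
  by rewrite lerXn2r ?nnegrE ?cabs_ge0.
by have [_ _] := dominated_convergence measurableT mu mf uf ig ug.
Qed.

Lemma atom_eq (m m' : radon_measure R (dual R G)) chi :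
  (forall phi, Cc phi ->
    [/\ m.-integrable setT (fun omega => (cabs (ift phi omega) ^+ 2)%:E),
        m'.-integrable setT (fun omega => (cabs (ift phi omega) ^+ 2)%:E) &
        (\int[m]_omega (cabs (ift phi omega) ^+ 2) =
         \int[m']_omega (cabs (ift phi omega) ^+ 2))%R]) ->
  m [set chi] = m' [set chi].
Proof.
move=> H.
have lim2 (u v : nat -> \bar R) (a b : \bar R) : u = v -> u @ \oo --> a -> v @ \oo --> b -> a = b.
  by move=> -> ua va; rewrite -(cvg_lim _ ua)// -(cvg_lim _ va).
have [psi cpsi psi0] := ift_nonzero hG lcG haar chi.
have [i1 i2 _] := H _ cpsi.
have E : (fun n => \int[m]_omega (cabs (ift (modulated psi chi n) omega) ^+ 2)%:E)%E =
         (fun n => \int[m']_omega (cabs (ift (modulated psi chi n) omega) ^+ 2)%:E)%E.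
  apply/funext => n; have [j1 j2 eqm] := H _ (modulated_Cc chi n cpsi).
  by rewrite -(fineK (integrable_fin_num measurableT j1)) -(fineK (integrable_fin_num measurableT j2));
    congr EFin.
have h := lim2 _ _ _ _ E (@atom_limit m psi chi cpsi i1) (@atom_limit m' psi chi cpsi i2).
have f1 := atom_fin (@dual_hausdorff R G) m chi.
have f2 := atom_fin (@dual_hausdorff R G) m' chi.
have p0 : 0 < cabs (ift psi chi) ^+ 2.
  by rewrite exprn_gt0// cabs_gt0.
by move: h; rewrite -(fineK f1) -(fineK f2) -!EFinM => -[/(mulfI (lt0r_neq0 p0)) ->].
Qed.

End atoms.

(** * The Riesz representation theorem *)

Section positive_riesz.
Context (R : realType) (G : topologicalZmodType) (hG : hausdorff_space G).
Context (lcG : locally_compact [set: G]).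
Implicit Types (f g h : G -> R) (K U V : set G).

Definition Ccp K f := [/\ compact K, continuous f, forall x, 0 <= f x &
  forall x, ~ K x -> f x = 0].

Lemma CcpD K f g : Ccp K f -> Ccp K g -> Ccp K (fun x => f x + g x).
Proof.
move=> [cK cf f0 fK] [_ cg g0 gK]; split=> //.
- by move=> x; apply: cvgD; [exact: cf|exact: cg].
- by move=> x; rewrite addr_ge0.
- by move=> x nK; rewrite fK// gK// addr0.
Qed.

Lemma Ccp_le K f g : Ccp K g -> continuous f -> (forall x, 0 <= f x <= g x) -> Ccp K f.
Proof.
move=> [cK cg g0 gK] cf fg; split=> //; first by move=> x; have /andP[] := fg x.
move=> x /gK gx; apply/eqP; rewrite eq_le; have := fg x; rewrite gx => /andP[-> ->//].
Qed.

Lemma Ccp_sub K f g : Ccp K g -> continuous f -> (forall x, 0 <= f x <= g x) ->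
  Ccp K (fun x => g x - f x).
Proof.
move=> kg cf fg; have [cK cg g0 gK] := kg; apply: (Ccp_le kg).
  by move=> x; apply: cvgB; [exact: cg|exact: cf].
by move=> x; have /andP[f0 fgx] := fg x; rewrite subr_ge0 fgx gerBl f0.
Qed.

Lemma CcpS K K' f : K `<=` K' -> compact K' -> Ccp K f -> Ccp K' f.
Proof.
move=> KK' cK' [cK cf f0 fK]; split=> // x nK'; apply: fK => Kx; exact/nK'/KK'.
Qed.

Lemma Ccp0 K : compact K -> Ccp K (fun=> 0).
Proof. by move=> cK; split=> // x; exact: cvg_cst. Qed.

Lemma Ccp_split K U V f : open U -> open V -> K `<=` U `|` V -> Ccp K f ->
  exists K1 K2 g h, [/\ Ccp K1 g, Ccp K2 h, K1 `<=` U, K2 `<=` V &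
    forall x, f x = g x + h x].
Proof.
move=> oU oV KUV [cK cf f0 fK].
have clK : closed K by exact: compact_closed.
have cKV : compact (K `\` V).
  by apply: (subclosed_compact _ cK); [apply: closedI => //; exact: open_closedC|move=> x []].
have KVU : K `\` V `<=` U by move=> x [/KUV[//|?]].
have [b [cb b01 b1 b0 _]] := bump R hG lcG cKV oU KVU.
(* [u] vanishes where [b] is below [1 / 3] and equals 1 where [b] is above [2 / 3]. This margin
   gives both pieces compact supports inside [U] and [V], which [b] and [1 - b] alone would not. *)
pose u x := Num.min 1 (Num.max 0 (3 * b x - 1)).
have cu : continuous u.
  move=> x; apply: (@continuous_comp _ _ _ b (fun y => Num.min 1 (Num.max 0 (3 * y - 1)))); first exact: cb.
  apply: continuous_min; first exact: cvg_cst.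
  apply: continuous_max; first exact: cvg_cst.
  by apply: cvgB; [apply: cvgM; [exact: cvg_cst|exact: cvg_id]|exact: cvg_cst].
have u01 x : 0 <= u x <= 1 by rewrite /u le_min ler01 le_max lexx ge_min lexx.
pose K1 := K `&` b @^-1` [set y | 1 / 3 <= y].
pose K2 := K `&` b @^-1` [set y | y <= 2 / 3].
have cK1 : compact K1.
  apply: (subclosed_compact _ cK); last by move=> x [].
  by apply: closedI => //; apply: closed_comp => [x _|]; [exact: cb|exact: closed_ge].
have cK2 : compact K2.
  apply: (subclosed_compact _ cK); last by move=> x [].
  by apply: closedI => //; apply: closed_comp => [x _|]; [exact: cb|exact: closed_le].
exists K1, K2, (fun x => u x * f x), (fun x => (1 - u x) * f x); split.
- split=> //.
  + by move=> x; apply: cvgM; [exact: cu|exact: cf].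
  + by move=> x; rewrite mulr_ge0//; have /andP[] := u01 x.
  + move=> x /not_andP[/fK->|/=]; first by rewrite mulr0.
    move=> /negP; rewrite -ltNge => bx.
    by rewrite /u max_l ?min_r ?mul0r//; lra.
- split=> //.
  + by move=> x; apply: cvgM; [apply: cvgB; [exact: cvg_cst|exact: cu]|exact: cf].
  + by move=> x; rewrite mulr_ge0// subr_ge0; have /andP[] := u01 x.
  + move=> x /not_andP[/fK->|/=]; first by rewrite mulr0.
    move=> /negP; rewrite -ltNge => bx.
    by rewrite /u min_l ?subrr ?mul0r// le_max; apply/orP; right; lra.
- move=> x [Kx /= bx]; apply: contrapT => /b0 b0x; move: bx; rewrite b0x; lra.
- move=> x [Kx /= bx]; apply: contrapT => nV; move: bx; rewrite b1//; lra.
- by move=> x; rewrite -mulrDl; ring.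
Qed.

Context (P : (G -> R) -> R).
Hypothesis P_ge0 : forall K f, Ccp K f -> 0 <= P f.
Hypothesis PD : forall K f g, Ccp K f -> Ccp K g -> P (fun x => f x + g x) = P f + P g.

Lemma P_zero : P (fun=> 0) = 0.
Proof.
have c0 := Ccp0 (@compact0 G).
have := PD c0 c0; rewrite (_ : (fun x => 0 + 0) = fun=> 0 :> R); first by move=> ?; lra.
by apply/funext => x; rewrite addr0.
Qed.

Lemma P_le K f g : Ccp K g -> continuous f -> (forall x, 0 <= f x <= g x) -> P f <= P g.
Proof.
move=> cg cf fg; have c1 := Ccp_le cg cf fg; have c2 := Ccp_sub cg cf fg.
have := PD c1 c2; rewrite (_ : (fun x => f x + (g x - f x)) = g).
  by have := P_ge0 c2; lra.
by apply/funext => x; rewrite addrC subrK.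
Qed.

(** Only additivity of [P] is assumed; homogeneity for natural factors follows, and the arguments
    below are arranged to use no other factors. *)
Lemma Ccp_natmul K f n : Ccp K f -> Ccp K (fun x => n%:R * f x) /\
  P (fun x => n%:R * f x) = n%:R * P f.
Proof.
move=> cf; elim: n => [|n [c1 IH]].
  have -> : (fun x => 0 * f x) = fun=> 0 by apply/funext => x; rewrite mul0r.
  by rewrite mul0r P_zero; split=> //; apply: Ccp0; have [] := cf.
have -> : (fun x => n.+1%:R * f x) = (fun x => n%:R * f x + f x).
  by apply/funext => x; rewrite -natr1 mulrDl mul1r.
by split; [exact: CcpD|rewrite (PD c1 cf) IH -natr1; ring].
Qed.

Local Open Scope ereal_scope.

Definition content U : \bar R := ereal_sup [set (P f)%:E | f in
  [set f | (forall x, f x <= 1)%R /\ exists2 K, K `<=` U & Ccp K f]].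

Lemma content_ge U K f : K `<=` U -> Ccp K f -> (forall x, f x <= 1)%R -> (P f)%:E <= content U.
Proof. by move=> KU cf f1; apply: ereal_sup_ubound; exists f => //; split=> //; exists K. Qed.

Lemma content_ge0 U : 0 <= content U.
Proof.
rewrite -[0]/(0%:E) -P_zero; apply: (content_ge (@sub0set _ _)) => //.
by apply: Ccp0; exact: compact0.
Qed.

Lemma content_le U V : U `<=` V -> content U <= content V.
Proof.
move=> UV; apply: ub_ereal_sup => _ [f [f1 [K KU cf]] <-].
exact: content_ge (subset_trans KU UV) cf f1.
Qed.

Lemma content0 : content set0 = 0.
Proof.
apply/eqP; rewrite eq_le content_ge0 andbT.
apply: ub_ereal_sup => _ [f [f1 [K K0 [_ _ _ fK]]] <-].
rewrite (_ : f = fun=> 0%R) ?P_zero//; apply/funext => x; apply: fK => /K0//.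
Qed.

Lemma content_finite_sub (U : nat -> set G) n K f : (forall i, open (U i)) ->
  K `<=` \bigcup_(i < n) U i -> Ccp K f -> (forall x, f x <= 1)%R ->
  (P f)%:E <= \sum_(0 <= i < n) content (U i).
Proof.
move=> oU; elim: n K f => [|n IH] K f KU cf f1.
  rewrite big_nil lee_fin (_ : f = fun=> 0%R) ?P_zero//.
  by have [_ _ _ fK] := cf; apply/funext => x; apply: fK => /KU[].
have [||K1 [K2 [g [h [c1 c2 K1U K2U fgh]]]]] :=
    @Ccp_split K (\bigcup_(i < n) U i) (U n) f _ (oU n) _ cf.
- by apply: bigcup_open => i _.
- move=> x /KU[i /=]; rewrite ltnS leq_eqVlt => /orP[/eqP->|iN]; first by right.
  by left; exists i.
have [cK1 _ g0 _] := c1; have [cK2 _ h0 _] := c2.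
have cU := compactU cK1 cK2.
have c1' : Ccp (K1 `|` K2) g by apply: CcpS c1 => //; left.
have c2' : Ccp (K1 `|` K2) h by apply: CcpS c2 => //; right.
have -> : f = fun x => (g x + h x)%R by apply/funext.
rewrite (PD c1' c2') EFinD big_nat_recr//=; apply: leeD.
  apply: IH K1U c1 _ => x; apply: le_trans (f1 x); rewrite fgh lerDl//.
by apply: content_ge K2U c2 _ => x; apply: le_trans (f1 x); rewrite fgh lerDr.
Qed.

Lemma content_sub (U : nat -> set G) : (forall n, open (U n)) ->
  content (\bigcup_n U n) <= \sum_(n <oo) content (U n).
Proof.
move=> oU; apply: ub_ereal_sup => _ [f [f1 [K KU cf]] <-].
have [cK _ _ _] := cf.
have [n Kn] : exists n, K `<=` \bigcup_(i < n) U i.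
  move: cK; rewrite compact_cover => /(_ nat setT U (fun i _ => oU i) KU) [D _ KD].
  exists (\max_(i <- finmap.enum_fset D) i).+1 => x /KD[i /= iD Uix]; exists i => //=.
  by rewrite ltnS; apply: (@leq_bigmax_seq _ _ xpredT id).
apply: le_trans (content_finite_sub oU Kn cf f1) _.
by apply: nneseries_lim_ge => i _ _; exact: content_ge0.
Qed.

(** For [f] supported in a compact [K] inside the intersection, every admissible [g] supported in
    [V] minus [K] can be added to [f] without exceeding 1, so [P f + P g] is at most the content of
    [V]. And [V] minus [K] is an open set containing [V] minus [U]. *)
Lemma content_split U V : open U -> open V ->
  outer_regular content (V `&` U) + outer_regular content (V `\` U) <= content V.
Proof.
move=> oU oV.
have [->|fV] := eqVneq (content V) +oo; first by rewrite leey.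
have fin : content V \is a fin_num by rewrite ge0_fin_numE ?content_ge0// ltey.
have s2 K f : K `<=` V `&` U -> Ccp K f -> (forall x, f x <= 1)%R ->
    outer_regular content (V `\` U) <= content V - (P f)%:E.
  move=> KVU cf f1; have [cK ctf f0 fK] := cf.
  have oVK : open (V `\` K).
    by apply: openI => //; apply: closed_openC; exact: compact_closed.
  apply: (@le_trans _ _ (content (V `\` K))).
    apply: ereal_inf_lbound; exists (V `\` K) => //; split=> // x [Vx nU].
    by split=> // /KVU[].
  apply: ub_ereal_sup => _ [g [g1 [K' K'V cg]] <-].
  have [cK' ctg g0 gK'] := cg; have cU := compactU cK cK'.
  rewrite leeBrDr// -EFinD.
  rewrite -(@PD (K `|` K')); last 2 first.
  - by apply: CcpS cg => //; right.
  - by apply: CcpS cf => //; left.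
  apply: (@content_ge _ (K `|` K')).
  - by move=> x [/KVU[]//|/K'V[]].
  - by apply: CcpD; [apply: CcpS cg => //; right|apply: CcpS cf => //; left].
  move=> x; have [Kx|nK] := pselect (K x); last by rewrite (fK x)// addr0.
  by rewrite (gK' x) ?add0r// => /K'V[].
have or0 : 0 <= outer_regular content (V `\` U).
  by apply: le_ereal_inf_tmp => _ [W _ <-]; exact: content_ge0.
have orf : outer_regular content (V `\` U) \is a fin_num.
  rewrite ge0_fin_numE// (@le_lt_trans _ _ (content V))// ?ltey//.
  by apply: ereal_inf_lbound; exists V => //; split=> // x [].
rewrite -leeBrDr// outer_regular_open; [|by move=> *; exact: content_le|exact: openI].
apply: ub_ereal_sup => _ [f [f1 [K KVU cf]] <-].
by rewrite leeBrDr// addeC -leeBrDr//; exact: s2 KVU cf f1.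
Qed.

Lemma positive_riesz_measure : exists m : {measure set (borel G) -> \bar R},
  (forall U, open U -> m U = content U) /\
  forall B, m B = ereal_inf [set content U | U in [set U : set G | open U /\ B `<=` U]].
Proof.
have [m hm] := outer_regular_measure content0 content_ge0
  (fun U V _ _ => @content_le U V) content_sub content_split.
exists m; split=> // U oU.
by rewrite hm outer_regular_open// => V W _ _; exact: content_le.
Qed.

Section representation.
Context (m : {measure set (borel G) -> \bar R}).
Hypothesis m_open : forall U, open U -> m U = content U.
Hypothesis m_outer : forall B,
  m B = ereal_inf [set content U | U in [set U : set G | open U /\ B `<=` U]].

Lemma P_le_compact K f : Ccp K f -> (forall x, f x <= 1)%R -> (P f)%:E <= m K.
Proof.
move=> cf f1; rewrite m_outer; apply: le_ereal_inf_tmp => _ [U [oU KU] <-].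
exact: content_ge KU cf f1.
Qed.

Lemma P_ge_compact K K' f : compact K -> Ccp K' f -> (forall x, K x -> 1 <= f x)%R ->
  m K <= (P f)%:E.
Proof.
move=> cK cf f1; have [cK' ctf f0 fK] := cf.
have key n : m K <= ((1 + n.+1%:R^-1) * P f)%:E.
  (* A function [g <= 1] supported in this neighbourhood of [K] satisfies
     [(n + 1) * g <= (n + 2) * f], a comparison that involves natural multiples only. *)
  pose U := f @^-1` [set y | n.+1%:R / n.+2%:R < y]%R.
  have oU : open U by apply: open_comp => [x _|]; [exact: ctf|exact: open_gt].
  apply: (@le_trans _ _ (content U)).
    rewrite m_outer; apply: ereal_inf_lbound; exists U => //; split=> // x /f1.
    by rewrite /U/=; apply: lt_le_trans; rewrite ltr_pdivrMr// mul1r ltr_nat.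
  apply: ub_ereal_sup => _ [g [g1 [K1 K1U cg]] <-]; rewrite lee_fin.
  have [cg' Eg] := Ccp_natmul n.+1 cg; have [cf' Ef] := Ccp_natmul n.+2 cf.
  have -> : ((1 + n.+1%:R^-1) * P f = n.+1%:R^-1 * (n.+2%:R * P f))%R.
    have n0 : (n.+1%:R != 0 :> R)%R by rewrite pnatr_eq0.
    rewrite (_ : n.+2%:R = n.+1%:R + 1)%R; last by rewrite natr1.
    by rewrite mulrA mulrDr mulVf// mulr1.
  rewrite -Ef ler_pdivlMl// -Eg.
  have [_ ctg' _ _] := cg'.
  apply: (P_le cf' ctg') => x; have [_ _ g0 gK] := cg.
  rewrite mulr_ge0//=; have [K1x|nK] := pselect (K1 x); last first.
    by rewrite gK// mulr0 mulr_ge0.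
  have := K1U x K1x; rewrite /U/= ltr_pdivrMr// (mulrC (f x)) => /ltW; apply: le_trans.
  by rewrite -[leRHS]mulr1 ler_pM2l.
have P0 : (0 <= P f)%R by exact: P_ge0 cf.
apply/lee_addgt0Pr => e e0.
have [n] : exists n, (P f / e < n.+1%:R)%R.
  exists (Num.truncn (P f / e)); exact: truncnS_gt.
rewrite ltr_pdivrMr// => hn; apply: (le_trans (key n)).
by rewrite -EFinD lee_fin mulrDl mul1r lerD2l ler_pdivrMl// ltW.
Qed.

Lemma riesz_radon : is_radon m.
Proof.
split.
- move=> K cK _; have [b [cb b01 b1 _ cs]] := bump R hG lcG cK openT (@subsetT _ K).
  have cb' : Ccp (closure [set x | b x != 0%R]) b.
    split=> // [x|x nx]; first by have /andP[] := b01 x.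
    by apply: contrapT => /eqP bx; apply: nx; exact: subset_closure.
  by apply: (le_lt_trans (P_ge_compact cK cb' _) (ltry _)) => x /b1->.
- move=> B mB; rewrite m_outer; congr ereal_inf; apply/seteqP.
  by split=> _ [U [oU BU] <-]; exists U => //; rewrite m_open.
- move=> U oU; apply/eqP; rewrite eq_le; apply/andP; split.
    rewrite m_open//; apply: ub_ereal_sup => _ [f [f1 [K KU cf]] <-].
    have [cK _ _ _] := cf.
    apply: (le_trans (P_le_compact cf f1)); apply: ereal_sup_ubound; exists K => //.
    by split=> //; apply: closed_borel; exact: compact_closed.
  apply: ub_ereal_sup => _ [K [cK mK KU] <-].
  apply: le_measure => //; rewrite inE//; exact: open_borel.
Qed.

End representation.

End positive_riesz.

(** * Additive functionals squeezed by the same set function coincide *)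

Section sandwich.
Context (R : realType) (G : topologicalZmodType) (hG : hausdorff_space G).
Implicit Types (f g h : G -> R) (K : set G).
Context (P Q : (G -> R) -> R) (M : set G -> R).
Hypothesis P_ge0 : forall K f, Ccp K f -> 0 <= P f.
Hypothesis Q_ge0 : forall K f, Ccp K f -> 0 <= Q f.
Hypothesis PD : forall K f g, Ccp K f -> Ccp K g -> P (fun x => f x + g x) = P f + P g.
Hypothesis QD : forall K f g, Ccp K f -> Ccp K g -> Q (fun x => f x + g x) = Q f + Q g.
Hypothesis PQ_le : forall K f, Ccp K f -> (forall x, f x <= 1) -> P f <= M K /\ Q f <= M K.
Hypothesis PQ_ge : forall K K' f, compact K -> Ccp K' f -> (forall x, K x -> 1 <= f x) ->
  M K <= P f /\ M K <= Q f.

(* Peeling off [min f 1] leaves a function supported in [K `&` [f >= 1]], so the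
   errors of the successive layers telescope. *)
Lemma sandwich_layers (N : nat) K f : Ccp K f -> (forall x, f x <= N%:R) ->
  `|P f - Q f| <= M K.
Proof.
elim: N K f => [|N IH] K f cf fN; have [cK ctf f0 fK] := cf.
  have f00 : f = fun=> 0 by apply/funext => x; apply/eqP; rewrite eq_le fN f0.
  have [h _] := PQ_le cf (fun x => le_trans (fN x) ler01).
  by rewrite f00 in h *; rewrite (P_zero PD) (P_zero QD) subrr normr0 -(P_zero PD).
pose f1 x := Num.min (f x) 1; pose f2 x := Num.max (f x - 1) 0.
have cf1 : continuous f1 by move=> x; apply: continuous_min; [exact: ctf|exact: cvg_cst].
have cf2 : continuous f2.
  move=> x; apply: (continuous_max (f := fun x => f x - 1) (g := fun=> 0)); last exact: cvg_cst.
  by apply: cvgB; [exact: ctf|exact: cvg_cst].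
pose K1 := K `&` f @^-1` [set y | 1 <= y].
have cK1 : compact K1.
  apply: (subclosed_compact _ cK); last by move=> x [].
  apply: closedI; first exact: compact_closed.
  by apply: closed_comp => [x _|]; [exact: ctf|exact: closed_ge].
have C1 : Ccp K f1.
  by apply: Ccp_le cf cf1 _ => x; rewrite /f1 le_min f0 ler01 ge_min lexx.
have C2 : Ccp K1 f2.
  split=> //; first by move=> x; rewrite /f2 le_max lexx orbT.
  move=> x nK; rewrite /f2 max_r// subr_le0; apply/ltW.
  have [Kx|/fK->//] := pselect (K x).
  by rewrite ltNge; apply/negP => fx; apply: nK.
have C2' : Ccp K f2 by apply: CcpS C2 => // x [].
have E : f = fun x => f1 x + f2 x.
  by apply/funext => x; rewrite /f1 /f2; case: (lerP (f x) 1) => h;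
    [rewrite max_r ?addr0// subr_le0|rewrite max_l ?subr_ge0 ?ltW// addrC subrK].
have [a1 a2] : P f1 <= M K /\ Q f1 <= M K by apply: PQ_le => // x; rewrite /f1 ge_min lexx orbT.
have [b1 b2] : M K1 <= P f1 /\ M K1 <= Q f1.
  by apply: PQ_ge C1 _ => // x [_ h]; rewrite /f1 le_min lexx andbT.
have := IH _ _ C2 _.
rewrite E (PD C1 C2') (QD C1 C2') => h.
have {}h : `|P f2 - Q f2| <= M K1.
  apply: h => x; rewrite /f2 ge_max ler0n andbT lerBlDr natr1; exact: fN.
rewrite opprD addrACA; apply: le_trans (ler_normD _ _) _.
have : `|P f1 - Q f1| <= M K - M K1 by rewrite ler_norml; apply/andP; split; lra.
lra.
Qed.

(** The bound of [sandwich_layers] does not depend on the height of the function. Applied to [n * f]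
    it bounds [n] times the difference by [M K] for every [n]. *)
Lemma sandwich_eq K f : Ccp K f -> P f = Q f.
Proof.
move=> cf; have [cK ctf f0 fK] := cf.
have [B fB] : exists B : nat, forall x, f x <= B%:R.
  have [/= B fB] : exists B, forall x, f x <= B.
    have : compact (f @` K) by apply: continuous_compact => //; exact: continuous_subspaceT.
    move=> /compact_bounded[B [_ hB]]; exists (Num.max 0 (B + 1)) => x.
    have [Kx|/fK->] := pselect (K x); last by rewrite le_max lexx.
    by rewrite le_max (le_trans (ler_norm _) (hB (B + 1) _ _ _)) ?orbT ?ltrDl//; exists x.
  exists (Num.truncn B).+1 => x; apply: le_trans (fB x) _; apply/ltW; exact: truncnS_gt.
have key n : n%:R * `|P f - Q f| <= M K.
  have [c1 e1] := Ccp_natmul PD n cf; have [_ e2] := Ccp_natmul QD n cf.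
  have := @sandwich_layers (n * B)%N K _ c1.
  rewrite e1 e2 -mulrBr normrM normr_nat; apply => x; rewrite natrM.
  by rewrite ler_wpM2l.
apply/eqP; rewrite -subr_eq0 -normr_eq0; apply/negPn/negP => n0.
have p0 : 0 < `|P f - Q f| by rewrite lt_neqAle eq_sym n0 normr_ge0.
have := key (Num.truncn (M K / `|P f - Q f|)).+1.
by rewrite leNgt -ltr_pdivrMr// truncnS_gt.
Qed.

End sandwich.

Section positive_integral.
Context (R : realType) (G : topologicalZmodType) (hG : hausdorff_space G).
Context (m : radon_measure R G).
Implicit Types (f g h : G -> R) (K : set G).

Lemma Ccp_bounded K f : Ccp K f -> exists2 B : R, 0 <= B & forall x, f x <= B.
Proof.
move=> [cK ctf f0 fK].
have : compact (f @` K) by apply: continuous_compact => //; exact: continuous_subspaceT.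
move=> /compact_bounded[B [_ hB]]; exists (Num.max 0 (B + 1)); first by rewrite le_max lexx.
move=> x; have [Kx|/fK->] := pselect (K x); last by rewrite le_max lexx.
by rewrite le_max (le_trans (ler_norm _) (hB (B + 1) _ _ _)) ?orbT ?ltrDl//; exists x.
Qed.

Lemma Ccp_integral_le K f (B : R) : Ccp K f -> 0 <= B -> (forall x, f x <= B) ->
  (\int[m]_x (f x)%:E <= B%:E * m K)%E.
Proof.
move=> [cK ctf f0 fK] B0 fB.
have mK : measurable (K : set (borel G)) by apply: closed_borel; exact: compact_closed.
rewrite -(setIT (K : set (borel G))) -integral_indic// -ge0_integralZl//; last first.
  by apply/measurable_EFinP; exact: measurable_indic.
apply: ge0_le_integral => //.
- by move=> x _; rewrite lee_fin.
- by apply/measurable_EFinP; exact: continuous_borel.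
- by apply/measurable_EFinP; apply: measurable_funM; [exact: measurable_cst|exact: measurable_indic].
move=> x _; rewrite -EFinM lee_fin indicE; have [Kx|nK] := pselect (K x).
  by rewrite mem_set// mulr1.
by rewrite fK// memNset// mulr0.
Qed.

Lemma Ccp_integral_fin K f : Ccp K f -> (\int[m]_x (f x)%:E)%E \is a fin_num.
Proof.
move=> cf; have [B B0 fB] := Ccp_bounded cf; have [cK _ f0 _] := cf.
rewrite ge0_fin_numE; last by apply: integral_ge0 => x _; rewrite lee_fin.
apply: le_lt_trans (Ccp_integral_le cf B0 fB) _.
have := radon_bounded_fin m hG (bounded_borel_compact hG cK).
by move=> h; rewrite -(@fineK _ (m K)) ?ge0_fin_numE// -EFinM ltry.
Qed.

Lemma Ccp_RintegralD K f g : Ccp K f -> Ccp K g ->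
  \int[m]_x (f x + g x) = \int[m]_x f x + \int[m]_x g x.
Proof.
move=> cf cg; have [cK ctf f0 fK] := cf; have [_ ctg g0 gK] := cg.
rewrite /Rintegral -fineD; [|exact: Ccp_integral_fin cf|exact: Ccp_integral_fin cg].
rewrite -ge0_integralD//; last 4 first.
- by move=> x _; rewrite lee_fin.
- by apply/measurable_EFinP; exact: continuous_borel.
- by move=> x _; rewrite lee_fin.
- by apply/measurable_EFinP; exact: continuous_borel.
Qed.

End positive_integral.

Section positive_riesz_theorem.
Context (R : realType) (G : topologicalZmodType) (hG : hausdorff_space G).
Context (lcG : locally_compact [set: G]).
Implicit Types (f g h : G -> R) (K : set G).
Context (P : (G -> R) -> R).
Hypothesis P_ge0 : forall K f, Ccp K f -> 0 <= P f.
Hypothesis PD : forall K f g, Ccp K f -> Ccp K g -> P (fun x => f x + g x) = P f + P g.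

(** Both [P] and integration against [m] are squeezed by the measure of compact sets, so
    [sandwich_eq] identifies them. *)
Lemma positive_riesz : exists m : radon_measure R G,
  forall K f, Ccp K f -> P f = \int[m]_x f x.
Proof.
have [m0 [m_open m_outer]] := positive_riesz_measure hG lcG PD.
pose m := RadonMeasure (riesz_radon hG lcG P_ge0 PD m_open m_outer).
exists m.
have fK K : compact K -> m K \is a fin_num.
  move=> cK; rewrite ge0_fin_numE//.
  exact: (radon_bounded_fin m hG (bounded_borel_compact hG cK)).
have EI K f : Ccp K f -> (\int[m]_x f x)%:E = (\int[m]_x (f x)%:E)%E.
  by move=> cf; rewrite /Rintegral fineK//; exact: (Ccp_integral_fin hG m cf).
apply: (@sandwich_eq R G hG P (fun f => \int[m]_x f x) (fun K => fine (m K))) => //.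
- by move=> K f g; exact: Ccp_RintegralD.
- move=> K f cf f1; have [cK _ _ _] := cf; split.
    by rewrite -lee_fin (fineK (fK _ cK)); exact: (P_le_compact m_outer cf).
  rewrite -lee_fin (EI _ _ cf) (fineK (fK _ cK)).
  by have := Ccp_integral_le hG m cf ler01 f1; rewrite mul1e.
- move=> K K' f cK cf f1; split.
    by rewrite -lee_fin (fineK (fK _ cK)); exact: (P_ge_compact P_ge0 PD m_outer cK cf).
  rewrite -lee_fin (EI _ _ cf) (fineK (fK _ cK)).
  have [_ ctf f0 _] := cf.
  have mK : measurable (K : set (borel G)) by apply: closed_borel; exact: compact_closed.
  have -> : m K = (\int[m]_x (\1_(K : set (borel G)) x)%:E)%E by rewrite integral_indic// setIT.
  apply: ge0_le_integral => //.
  + by apply/measurable_EFinP; exact: measurable_indic.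
  + by apply/measurable_EFinP; exact: continuous_borel.
  move=> x _; rewrite lee_fin indicE; have [Kx|nK] := pselect (K x).
    by rewrite mem_set// f1.
  by rewrite memNset.
Qed.

End positive_riesz_theorem.

(** * Jordan decomposition of a locally bounded real functional *)

Section real_riesz.
Context (R : realType) (G : topologicalZmodType) (hG : hausdorff_space G).
Context (lcG : locally_compact [set: G]).
Implicit Types (f g h : G -> R) (K : set G).

Definition sCc K f := [/\ compact K, continuous f & forall x, ~ K x -> f x = 0].

Lemma Ccp_sCc K f : Ccp K f -> sCc K f.
Proof. by case. Qed.

Context (L : (G -> R) -> R).
Hypothesis LD : forall K f g, sCc K f -> sCc K g -> L (fun x => f x + g x) = L f + L g.
Hypothesis L_bound : forall K, compact K -> exists C : R, forall f (M : R), sCc K f ->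
  (forall x, `|f x| <= M) -> L f <= C * M.

Let minorants f := [set L g | g in [set g : G -> R | continuous g /\ forall x, 0 <= g x <= f x]].

Definition positive_part f := sup (minorants f).

Let L0 : L (fun=> 0) = 0.
Proof.
have c0 : sCc set0 (fun=> 0 : R).
  by split=> //; [exact: compact0|move=> x; exact: cvg_cst].
have := LD c0 c0; rewrite (_ : (fun x => 0 + 0) = fun=> 0 :> R); first by move=> ?; lra.
by apply/funext => x; rewrite addr0.
Qed.

Let minorants_has_sup K f : Ccp K f -> has_sup (minorants f).
Proof.
move=> cf; split.
  exists (L (fun=> 0)), (fun=> 0) => //; split; first by move=> x; exact: cvg_cst.
  by move=> x; rewrite lexx; have [_ _ ->] := cf.
have [B B0 fB] := Ccp_bounded cf; have [cK _ _ _] := cf.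
have [C hC] := L_bound cK; exists (C * B) => _ [g [cg gf] <-].
apply: hC; first exact: Ccp_sCc (Ccp_le cf cg gf).
by move=> x; have /andP[g0 gx] := gf x; rewrite ger0_norm// (le_trans gx).
Qed.

Lemma positive_part_ge K f g : Ccp K f -> continuous g -> (forall x, 0 <= g x <= f x) ->
  L g <= positive_part f.
Proof.
move=> cf cg gf; apply: sup_upper_bound; first exact: minorants_has_sup cf.
by exists g.
Qed.

Lemma positive_part_le K f (M : R) : Ccp K f ->
  (forall g : G -> R, continuous g -> (forall x, 0 <= g x <= f x) -> L g <= M) -> positive_part f <= M.
Proof.
move=> cf H; apply: ge_sup; first by have [] := minorants_has_sup cf.
by move=> _ [g [cg gf] <-]; exact: H.
Qed.

Lemma positive_part_ge0 K f : Ccp K f -> 0 <= positive_part f.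
Proof.
move=> cf; rewrite -L0; apply: (positive_part_ge cf); first by move=> x; exact: cvg_cst.
by move=> x; rewrite lexx; have [_ _ ->] := cf.
Qed.

(** Riesz decomposition: a minorant [h] of [f + g] is the sum of [min h f], a minorant of [f], and a
    remainder that is a minorant of [g]. *)
Lemma positive_partD K f g : Ccp K f -> Ccp K g ->
  positive_part (fun x => f x + g x) = positive_part f + positive_part g.
Proof.
move=> cf cg; have cfg := CcpD cf cg; have [cK ctf f0 fK] := cf; have [_ ctg g0 gK] := cg.
apply/eqP; rewrite eq_le; apply/andP; split.
  apply: (positive_part_le cfg) => h ch hfg.
  pose h1 x := Num.min (h x) (f x).
  have ch1 : continuous h1 by move=> x; apply: continuous_min; [exact: ch|exact: ctf].
  have h1f x : 0 <= h1 x <= f x.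
    by rewrite /h1 le_min f0 ge_min lexx orbT !andbT; have /andP[] := hfg x.
  have h1h x : 0 <= h1 x <= h x.
    by have /andP[-> _] := h1f x; rewrite /h1 ge_min lexx.
  have ch2 := Ccp_sub (Ccp_le cfg ch hfg) ch1 h1h.
  have h2g x : 0 <= h x - h1 x <= g x.
    have /andP[_ h1x] := h1h x; rewrite subr_ge0 h1x/= /h1.
    by have /andP[a b] := hfg x; case: (leP (h x) (f x)) => h3; rewrite ?subrr ?g0//; lra.
  have -> : h = fun x => h1 x + (h x - h1 x) by apply/funext => x; rewrite addrC subrK.
  rewrite (LD (Ccp_sCc (Ccp_le cf ch1 h1f)) (Ccp_sCc ch2)).
  apply: lerD; first exact: positive_part_ge cf ch1 h1f.
  by apply: positive_part_ge cg _ h2g; have [] := ch2.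
rewrite -lerBrDr; apply: (positive_part_le cf) => h ch hf.
rewrite lerBrDr addrC -lerBrDr; apply: (positive_part_le cg) => k ck kg.
rewrite lerBrDr -(LD (Ccp_sCc (Ccp_le cg ck kg)) (Ccp_sCc (Ccp_le cf ch hf))).
apply: (positive_part_ge cfg); first by move=> x; apply: cvgD; [exact: ck|exact: ch].
by move=> x; have := hf x; have := kg x; lra.
Qed.

Lemma Ccp_integrable (m : radon_measure R G) K f : Ccp K f ->
  m.-integrable [set: borel G] (fun x => (f x)%:E).
Proof.
move=> cf; have [_ ctf f0 _] := cf; apply/integrableP; split.
  by apply/measurable_EFinP; exact: continuous_borel.
under eq_integral do rewrite gee0_abs ?lee_fin//.
rewrite -ge0_fin_numE; first exact: (Ccp_integral_fin hG m cf).
by apply: integral_ge0 => x _; rewrite lee_fin.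
Qed.

(** On nonnegative functions both [positive_part] and [positive_part - L] are positive and additive,
    and their difference is [L]. *)
Lemma real_riesz : exists m m' : radon_measure R G, forall K f, sCc K f ->
  L f = \int[m]_x f x - \int[m']_x f x.
Proof.
have [m hm] := positive_riesz hG lcG positive_part_ge0 positive_partD.
have [||m' hm'] := @positive_riesz R G hG lcG (fun f => positive_part f - L f).
- move=> K f cf; rewrite subr_ge0; have [_ ctf f0 _] := cf.
  by apply: positive_part_ge cf ctf _ => x; rewrite f0 lexx.
- move=> K f g cf cg.
  by rewrite (positive_partD cf cg) (LD (Ccp_sCc cf) (Ccp_sCc cg)); ring.
exists m, m' => K f [cK ctf fK].
pose p x := Num.max (f x) 0; pose q x := Num.max (- f x) 0.
have cp : Ccp K p.
  split=> // [x|x|x nK]; last by rewrite /p fK// maxxx.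
    by apply: (continuous_max (f := f) (g := fun=> 0)); [exact: ctf|exact: cvg_cst].
  by rewrite /p le_max lexx orbT.
have cq : Ccp K q.
  split=> // [x|x|x nK]; last by rewrite /q fK// oppr0 maxxx.
    by apply: (continuous_max (f := fun x => - f x) (g := fun=> 0));
      [apply: cvgN; exact: ctf|exact: cvg_cst].
  by rewrite /q le_max lexx orbT.
have pq x : p x = f x + q x.
  rewrite /p /q; have [h|/ltW h] := leP (f x) 0; first by rewrite max_l ?subrr//; lra.
  by rewrite max_r ?addr0//; lra.
have fE : f = fun x => p x - q x by apply/funext => x; rewrite pq addrK.
have E (n : radon_measure R G) : \int[n]_x f x = \int[n]_x p x - \int[n]_x q x.
  rewrite {1}fE RintegralB//; [exact: (Ccp_integrable n cp)|exact: (Ccp_integrable n cq)].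
have -> : L f = L p - L q.
  apply/eqP; rewrite -subr_eq opprK eq_sym; apply/eqP.
  by rewrite -(LD _ (Ccp_sCc cq)); [congr L; apply/funext|split].
rewrite !E -(hm _ _ cp) -(hm _ _ cq) -(hm' _ _ cp) -(hm' _ _ cq); ring.
Qed.

End real_riesz.

Section complex_riesz.
Context (R : realType) (G : topologicalZmodType) (hG : hausdorff_space G).
Context (lcG : locally_compact [set: G]).
Implicit Types (f g : G -> R[i]) (K : set G).
Context (L : (G -> R[i]) -> R[i]).
Hypothesis LD : forall f g, Cc f -> Cc g -> L (fun x => f x + g x) = L f + L g.
Hypothesis LZ : forall a f, Cc f -> L (fun x => a * f x) = a * L f.
Hypothesis L_bound : forall K, compact K -> exists C : R, forall f (M : R), Cc f ->
  (forall x, ~ K x -> f x = 0) -> (forall x, cabs (f x) <= M) -> cabs (L f) <= C * M.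

Let sCc_Cc K (f : G -> R) : sCc K f -> Cc (fun x => (f x)%:C%C).
Proof.
move=> [cK cf fK]; apply: (@Cc_sub _ _ hG _ K) => //; first exact: cont_real.
by move=> x /fK ->.
Qed.

Lemma complex_riesz : exists gamma : cmeasure R G,
  forall phi, Cc phi -> cm_integral gamma phi = L phi.
Proof.
have rD K (f g : G -> R) : sCc K f -> sCc K g ->
    L (fun x => (f x + g x)%:C%C) = L (fun x => (f x)%:C%C) + L (fun x => (g x)%:C%C).
  move=> cf cg; rewrite -(LD (sCc_Cc cf) (sCc_Cc cg)); congr L.
  by apply/funext => x; rewrite rmorphD.
have rB K : compact K -> exists C : R, forall (f : G -> R) (M : R), sCc K f ->
    (forall x, `|f x| <= M) -> cabs (L (fun x => (f x)%:C%C)) <= C * M.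
  move=> /L_bound[C hC]; exists C => f M cf fM; apply: hC; first exact: sCc_Cc cf.
    by move=> x; have [_ _ h] := cf => /h ->.
  by move=> x; rewrite cabsR.
have [||rp [rm hr]] := @real_riesz R G hG lcG (fun f : G -> R => complex.Re (L (fun x => (f x)%:C%C))).
- by move=> K f g cf cg; rewrite (rD K f g cf cg) cReD.
- move=> K /rB[C hC]; exists C => f M cf fM; apply: le_trans (hC f M cf fM).
  exact: le_trans (ler_norm _) (Re_cabs _).
have [||ip [im hi]] := @real_riesz R G hG lcG (fun f : G -> R => complex.Im (L (fun x => (f x)%:C%C))).
- by move=> K f g cf cg; rewrite (rD K f g cf cg) cImD.
- move=> K /rB[C hC]; exists C => f M cf fM; apply: le_trans (hC f M cf fM).
  exact: le_trans (ler_norm _) (Im_cabs _).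
exists (CMeasure rp rm ip im) => phi cphi; have [K cK sK] := Cc_supp cphi.
have [ctphi _] := cphi.
have c1 : sCc K (fun x => complex.Re (phi x)).
  by split=> //; [exact: cont_Re|move=> x /sK ->].
have c2 : sCc K (fun x => complex.Im (phi x)).
  by split=> //; [exact: cont_Im|move=> x /sK ->].
have -> : L phi = L (fun x => (complex.Re (phi x))%:C%C) + 'i%C * L (fun x => (complex.Im (phi x))%:C%C).
  rewrite -(LZ _ (sCc_Cc c2)) -LD; [|exact: sCc_Cc c1|].
    by congr L; apply/funext => x; apply: complex_eq; rewrite ?cReD ?cImD ?cReM ?cImM /=; ring.
  apply: (@Cc_sub _ _ hG _ K).
  - exact: (buc_cont (bucZ _ (Cc_buc (sCc_Cc c2)))).
  - exact: cK.
  - by move=> x /sK ->; rewrite /= mulr0.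
have h1 := hr _ _ c1; have h2 := hi _ _ c1; have h3 := hr _ _ c2; have h4 := hi _ _ c2.
apply: complex_eq; rewrite /cm_integral /= !(cReD, cImD, cReM, cImM, cReN, cImN)/= ?h1 ?h2 ?h3 ?h4; ring.
Qed.

End complex_riesz.

(** * Weyl almost periodicity and consistent phase *)

Lemma cvgC_ext (R : realType) (u v : nat -> R[i]) (l : R[i]) :
  u = v -> u @ \oo --> l -> v @ \oo --> l.
Proof. by move=> ->. Qed.

Section convolution_of_test_functions.
Context (R : realType) (G : topologicalZmodType) (hG : hausdorff_space G).
Context (theta : radon_measure R G).
Implicit Types (f g phi psi : G -> R[i]).

Lemma tilde_Cc psi : Cc psi -> Cc (tilde psi).
Proof.
move=> cpsi; have [E cE sE] := Cc_supp cpsi.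
apply: (@Cc_sub _ _ hG _ (-%R @` E)).
- exact: (buc_cont (bucJ (bucN (Cc_buc cpsi)))).
- by apply: continuous_compact => //; apply: continuous_subspaceT; exact: opp_continuous.
- move=> s nE; rewrite /tilde sE ?conjc0// => Es; apply: nE.
  by exists (- s) => //; rewrite opprK.
Qed.

Lemma conv_Cc phi g : Cc phi -> Cc g -> Cc (Defs.conv theta phi g).
Proof.
move=> cphi cg; have [K cK sK] := Cc_supp cphi; have [E cE sE] := Cc_supp cg.
have bE := bounded_borel_compact hG cE; have Th := locfun_cintegral hG theta.
have convE t : Defs.conv theta phi g t = cintegral theta (cut E (fun s : G => phi (t - s) * g s)).
  by rewrite cut_id// => s ns; rewrite (sE s ns) mulr0.
have b : buc (Defs.conv theta phi g).
  rewrite (_ : Defs.conv _ _ _ =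
    fun t : G => cintegral theta (cut E (fun s : G => phi (t - s) * g s))).
    apply: (buc_locfun Th) => //; apply: buc2M; [apply: buc2_sub|apply: buc2_snd]; exact: Cc_buc.
  by apply/funext => t; exact: convE.
apply: (@Cc_sub _ _ hG _ (setadd K E)).
- exact: (buc_cont b).
- exact: setadd_compact.
move=> t nK; rewrite convE (_ : (fun s : G => _) = fun=> 0) ?(locfun_cut0 Th bE)//.
apply/funext => s; have [Es|/sE->] := pselect (E s); last by rewrite mulr0.
by rewrite sK ?mul0r// => Ks; apply: nK; exists (t - s) => //; exists s; rewrite ?subrK.
Qed.

End convolution_of_test_functions.

(** * Mean values of the measure and of its convolutions *)

Section averages_of_a_measure.
Context (R : realType) (G : topologicalZmodType) (hG : hausdorff_space G).
Context (lcG : locally_compact [set: G]).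
Context (theta : radon_measure R G) (haar : is_haar theta).
Context (mu : cmeasure R G) (mu_tb : translation_bounded mu).
Implicit Types (f g phi psi : G -> R[i]) (chi : dual R G) (K : set G).
Implicit Types (B : nat -> set G) (e : R).

Let Th := locfun_cintegral hG theta.
Local Notation ift := (inverse_fourier theta).

Definition gamma_avg (B : set G) g : R[i] := ((vol theta B)^-1)%:C%C * gamma_on mu B g.

Definition bohr_avg chi (B : set G) : R[i] :=
  ((vol theta B)^-1)%:C%C * cm_integral mu (cut B (fun t => (chi t)^*%C)).

Lemma autocorrelationE B gamma : autocorrelation theta mu B gamma <->
  forall phi, Cc phi -> gamma_avg (B n) phi @[n --> \oo] --> cm_integral gamma phi.
Proof.
have E phi : (fun n => ((vol theta (B n))^-1)%:C%C *
      fun_conv (fun_restrict (cm_integral mu) (B n))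
               (fun_restrict (fun_tilde (cm_integral mu)) (-%R @` B n)) phi) =
    (fun n => gamma_avg (B n) phi).
  by apply/funext => n; rewrite fun_convE.
split=> H phi cphi; first exact: (cvgC_ext (E phi) (H phi cphi)).
exact: (cvgC_ext (esym (E phi)) (H phi cphi)).
Qed.

Lemma boundary_small B K (C : R) e : van_hove theta B -> compact K -> 0 <= C -> 0 < e ->
  \forall n \near \oo, (vol theta (B n))^-1 * (C * vol theta (vh_boundary K (B n))) < e.
Proof.
move=> hB cK C0 e0.
have h : 0 < e / (C + 1) by rewrite divr_gt0// ltr_wpDl.
apply: filterS (vH_boundary hB cK h) => n; rewrite ltr_pdivlMr ?ltr_wpDl//.
apply: le_lt_trans; rewrite mulrCA (mulrC _^-1) [leRHS]mulrC.
by apply: ler_wpM2r; [exact: boundary_ratio_ge0|rewrite lerDl].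
Qed.

Lemma cabs_volV_le (B : set G) (z w : R[i]) (M : R) : 0 < vol theta B -> cabs (z - w) <= M ->
  cabs (((vol theta B)^-1)%:C%C * z - ((vol theta B)^-1)%:C%C * w) <= (vol theta B)^-1 * M.
Proof.
move=> B0 zw; have v0 : 0 <= (vol theta B)^-1 by rewrite invr_ge0 ltW.
by rewrite -mulrBr cabsM cabsR ger0_norm// ler_wpM2l.
Qed.

Lemma gamma_avg_conv B phi psi : van_hove theta B -> Cc phi -> Cc psi ->
  forall e, 0 < e -> \forall n \near \oo,
  cabs (gamma_avg (B n) (Defs.conv theta phi (tilde psi)) -
    avg theta (B n) (fun y => conv_meas mu (reflect phi) y *
       (conv_meas mu (reflect psi) y)^*%C)) < e.
Proof.
move=> hB cphi cpsi e e0.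
have [C [K [C0 cK H]]] := gamma_conv hG lcG haar mu_tb cphi cpsi.
apply: filterS (boundary_small hB cK C0 e0) => n; apply: le_lt_trans.
have [oB pB bB B0] := vH_basic hG n hB.
by apply: cabs_volV_le => //; exact: H.
Qed.

Lemma ft_reflect phi chi : Cc phi -> ft theta (reflect phi) chi = ift phi chi.
Proof.
move=> cphi; have [_ cD c1] := dual_character chi; have [K cK sK] := Cc_supp cphi.
rewrite /inverse_fourier -(haar_reflect hG lcG haar).
  congr cintegral; apply/funext => x; rewrite /reflect; congr (_ * _).
  have c0 : chi 0 = 1.
    have := cD 0 0; rewrite addr0 -[LHS]mulr1 => /mulfI <- //.
    by rewrite -normr_eq0 c1 oner_eq0.
  have h : chi x * chi (- x) = 1 by rewrite -cD subrr.
  rewrite -[LHS]mulr1 -h mulrA (mulrC _ (chi x)) mulJ_chi mul1r//.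
apply: (@Cc_sub _ _ hG _ K).
- exact: (buc_cont (bucM (dual_buc chi) (Cc_buc cphi))).
- exact: cK.
- by move=> x /sK ->; rewrite mulr0.
Qed.

Lemma bohr_avg_conv B phi chi : van_hove theta B -> Cc phi ->
  forall e, 0 < e -> \forall n \near \oo,
  cabs (avg theta (B n) (fun t => (chi t)^*%C * conv_meas mu (reflect phi) t) -
    ift phi chi * bohr_avg chi (B n)) < e.
Proof.
move=> hB cphi e e0.
have [C [K [C0 cK H]]] :=
  fourier_bohr_conv hG haar mu_tb (reflect_Cc hG cphi) (dual_character chi).
apply: filterS (boundary_small hB cK C0 e0) => n; apply: le_lt_trans.
have [oB pB bB B0] := vH_basic hG n hB.
rewrite mulrCA; apply: cabs_volV_le => //; rewrite -(ft_reflect chi cphi).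
exact: H.
Qed.

Lemma fourier_bohr_coef B phi chi a : van_hove theta B -> Cc phi ->
  fourier_bohr theta mu B chi a ->
  cvg_avg theta B (fun t => (chi t)^*%C * conv_meas mu (reflect phi) t) (ift phi chi * a).
Proof.
move=> hB cphi ha.
apply: (@cvgC_close _ (fun n => ift phi chi * bohr_avg chi (B n))).
  move=> e e0; apply: filterS (bohr_avg_conv chi hB cphi e0) => n.
  by rewrite cabsC.
exact: (@cvgCZ R (ift phi chi) _ a (ha : bohr_avg chi (B n) @[n --> \oo] --> a)).
Qed.

Lemma coef_fourier_bohr B phi chi a : van_hove theta B -> Cc phi -> ift phi chi != 0 ->
  cvg_avg theta B (fun t => (chi t)^*%C * conv_meas mu (reflect phi) t) a ->
  fourier_bohr theta mu B chi ((ift phi chi)^-1 * a).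
Proof.
move=> hB cphi i0 ha.
have h : (ift phi chi * bohr_avg chi (B n)) @[n --> \oo] --> a.
  exact: (cvgC_close (bohr_avg_conv chi hB cphi) ha).
have E : (fun n => (ift phi chi)^-1 * (ift phi chi * bohr_avg chi (B n))) =
    (fun n => bohr_avg chi (B n)) by apply/funext => n; rewrite mulrA mulVf// mul1r.
have h' : bohr_avg chi (B n) @[n --> \oo] --> (ift phi chi)^-1 * a.
  exact: (cvgC_ext E (@cvgCZ R (ift phi chi)^-1 _ a h)).
exact: h'.
Qed.

(** [psi] is [tilde g] for a normalised bump [g] near 0, so the convolution is that of [phi] with
    [g]. The compact set is fixed before [e], because the constant in the bound on the
    autocorrelation depends on it. *)
Lemma approximate_identity phi : Cc phi -> exists2 K, compact K &
  forall e, 0 < e -> exists2 psi, Cc psi &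
    [/\ buc (Defs.conv theta phi (tilde psi)),
        forall x, cabs (Defs.conv theta phi (tilde psi) x - phi x) <= e &
        forall x, ~ K x -> Defs.conv theta phi (tilde psi) x = 0 /\ phi x = 0].
Proof.
move=> cphi; have bphi := Cc_buc cphi; have [_ uphi] := bphi.
have [V [oV V0] [L VL [cL clL]]] := nbhs0_precompact lcG.
have [K0 cK0 sK0] := Cc_supp cphi.
exists (setadd K0 L `|` K0); first by apply: compactU => //; exact: setadd_compact.
(* Half of [d], since the passage through [cabs_avg] costs a factor 2. *)
move=> d d0; have d2 : 0 < d / 2 by rewrite divr_gt0.
have [U [U0 HU]] := uphi _ d2.
have : nbhs (0 : G) (V `&` [set s | U (- s)]).
  by apply: filterI; [exact: open_nbhs_nbhs|exact: nbhs0N].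
rewrite nbhsE => -[W [oW W0] WU].
have [e [E [[ce e0 cE sE] [eW _ Ce [r r0 he]]]]] := small_bump hG lcG haar oW W0.
have bE := bounded_borel_compact hG cE.
pose g s : R[i] := (r^-1)%:C%C * (e s)%:C%C.
have bg : buc g by apply: bucZ; exact: Cc_buc.
have sg s : ~ E s -> g s = 0 by move=> nE; rewrite /g sE// mulr0.
have gW s : ~ W s -> g s = 0 by move=> nW; rewrite /g eW// mulr0.
have gr s : g s = (cabs (g s))%:C%C.
  have r1 : 0 <= r^-1 by rewrite invr_ge0 ltW.
  by rewrite /g cabsM !cabsR !ger0_norm// rmorphM.
have Ig : cintegral theta (cut E g) = 1.
  rewrite (locfun_cutZ Th bE); last exact: (buc_bmeas (Cc_buc Ce)).
  rewrite cut_id; last by move=> s nE; rewrite sE.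
  by rewrite he -rmorphM mulVf// gt_eqF.
have volE : 0 < vol theta E.
  rewrite lt_neqAle vol_ge0 andbT eq_sym; apply/negP => /eqP v0.
  have [[M gM] _] := bg.
  have M0 : 0 <= M by rewrite (le_trans _ (gM 0))// cabs_ge0.
  have := cintegral_bound hG theta bE (buc_bmeas bg) M0 (fun x _ => gM x).
  by rewrite Ig cabs1 -[fine _]/(vol theta E) v0 mulr0 mul0r ler10.
have tg : tilde (tilde g) = g by apply/funext => s; rewrite /tilde opprK conjcK.
have convE t : Defs.conv theta phi g t = cintegral theta (cut E (fun s => phi (t - s) * g s)).
  by rewrite cut_id// => s ns; rewrite (sg s ns) mulr0.
have cg : Cc g by apply: (@Cc_sub _ _ hG _ E); [exact: (buc_cont bg)|exact: cE|exact: sg].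
exists (tilde g); first exact: tilde_Cc.
rewrite tg; have bF (t : G) : bmeas (fun s : G => phi (t - s) * g s).
  by apply: buc_bmeas; apply: bucM => //; exact: (buc2_r t (buc2_sub bphi)).
split.
- exact: (Cc_buc (conv_Cc hG theta cphi cg)).
- move=> t; rewrite convE -[X in _ - X]mulr1 -Ig -(locfun_cutZ Th bE); last exact: buc_bmeas.
  rewrite -(locfun_cutB Th bE)//; last by apply: buc_bmeas; exact: bucZ.
  set F := (fun s => _ - _).
  have bFF : bmeas F by apply: bmeasB => //; apply: buc_bmeas; exact: bucZ.
  have := cabs_avg hG bE volE bFF.
  rewrite /avg cabsM cabsR ger0_norm ?invr_ge0 ?vol_ge0// ler_pdivrMl// => /le_trans; apply.
  have : aavg theta E F <= aavg theta E (fun s => (d / 2)%:C%C * g s).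
    apply: aavg_le => //; first by apply: buc_bmeas; exact: bucZ.
    move=> s Es; rewrite /F -mulrBl !(cabsM _ (g s)) (cabsR (d / 2)) (ger0_norm (ltW d2)).
    have [/WU[_ Us]|/gW ->] := pselect (W s); last by rewrite cabs0 !mulr0.
    by rewrite ler_wpM2r ?cabs_ge0// cabsC ltW// HU// addrC addKr.
  move=> h; apply: (@le_trans _ _ (vol theta E * (2 * ((vol theta E)^-1 * (d / 2))))).
    rewrite ler_pM2l// ler_pM2l//; apply: (le_trans h).
    rewrite le_eqVlt; apply/orP; left; apply/eqP.
    apply: (@complexI R); rewrite -avg_abs /avg.
    rewrite (_ : (fun x : G => _) = fun s : G => (d / 2)%:C%C * g s); last first.
      apply/funext => s; rewrite cabsM (cabsR (d / 2)) (ger0_norm (ltW d2)) rmorphM /=.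
      by rewrite -gr.
    by rewrite (locfun_cutZ Th bE) ?Ig ?mulr1 -?rmorphM//; exact: buc_bmeas.
  rewrite le_eqVlt; apply/orP; left; apply/eqP; field.
  by rewrite gt_eqF.
- move=> t nK; split; last by apply: sK0 => Kt; apply: nK; right.
  rewrite convE (_ : (fun s : G => _) = fun=> 0) ?(locfun_cut0 Th bE)//.
  apply/funext => s; have [Ws|/gW->] := pselect (W s); last by rewrite mulr0.
  rewrite sK0 ?mul0r// => Ks; apply: nK; left; exists (t - s) => //.
  by exists s; rewrite ?subrK//; apply: VL; have [] := WU _ Ws.
Qed.

End averages_of_a_measure.

Section weyl_norm_bound.
Context (R : realType) (G : topologicalZmodType) (hG : hausdorff_space G).
Context (theta : radon_measure R G) (haar : is_haar theta).
Implicit Types (f h : G -> R[i]) (A B : nat -> set G).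

Lemma van_hove_common_lim A (u : set G -> R[i]) : van_hove theta A ->
  (forall B, van_hove theta B -> exists l : R[i], u (B n) @[n --> \oo] --> l) ->
  exists l : R[i], forall B, van_hove theta B -> u (B n) @[n --> \oo] --> l.
Proof.
move=> hA H; have [l hl] := H A hA; exists l => B hB; have [l' hl'] := H B hB.
by rewrite (van_hove_lim_unique H hA hB hl hl').
Qed.

(* If the averages over [x + A n] were large for infinitely many [n], a choice
   of bad centres [x n] would give a van Hove sequence violating [H]. *)
Lemma weyl_norm_le A h (d : R) : van_hove theta A -> buc h ->
  (forall B, van_hove theta B -> \forall n \near \oo, aavg theta (B n) h <= d) ->
  (weyl_norm theta A h <= d%:E)%E.
Proof.
move=> hA bh H.
have /choice[x hx] : forall n, exists x : G, forall y,
    aavg theta (translate x (A n)) h <= d -> aavg theta (translate y (A n)) h <= d.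
  move=> n.
  have [[x nx]|nex] := pselect (exists x, ~~ (aavg theta (translate x (A n)) h <= d)).
    by exists x => y hx; rewrite hx in nx.
  by exists 0 => y _; apply: contrapT => /negP ny; apply: nex; exists y.
have hB := van_hove_translate hG haar x hA.
have hn := H _ hB.
rewrite /weyl_norm /limn_esup limf_esupE.
apply: (@le_trans _ _ (ereal_sup ((fun n => ereal_sup (range (fun x : G =>
    (((vol theta (A n))^-1)%:E *
     \int[theta]_(t in (translate x (A n) : set (borel G))) (cabs (h t))%:E)%E)))
    @` [set n | aavg theta (translate (x n) (A n)) h <= d]))).
  by apply: ereal_inf_lbound; exists [set n | aavg theta (translate (x n) (A n)) h <= d].
apply: ub_ereal_sup => _ [n /= hd <-]; apply: ub_ereal_sup => _ [y _ <-].
have [oA pA _ _] := vH_basic hG n hA.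
rewrite (weyl_termE hG haar)//; last exact: buc_bmeas.
by rewrite lee_fin; exact: hx hd.
Qed.

Lemma buc_L1_loc f : buc f -> L1_loc theta f.
Proof.
move=> bf; have [[M fM] _] := bf; split.
- apply: continuous_borel; exact: cont_Re (buc_cont bf).
- apply: continuous_borel; exact: cont_Im (buc_cont bf).
move=> K cK; have bK := bounded_borel_compact hG cK.
have /integrableP[_] := cabs_integrable hG theta bK (buc_bmeas bf).
by under eq_integral do rewrite gee0_abs ?lee_fin ?cabs_ge0//.
Qed.

End weyl_norm_bound.

(** * From consistent phase to Weyl almost periodicity *)

Section sufficiency.
Context (R : realType) (G : topologicalZmodType) (hG : hausdorff_space G).
Context (lcG : locally_compact [set: G]).
Context (theta : radon_measure R G) (haar : is_haar theta).
Context (mu : cmeasure R G) (mu_tb : translation_bounded mu).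
Context (A : nat -> set G) (hA : van_hove theta A).

Local Notation ift := (inverse_fourier theta).

Lemma reflectK (phi : G -> R[i]) : reflect (reflect phi) = phi.
Proof. by apply/funext => x; rewrite /reflect opprK. Qed.

Lemma weyl_ap_of_consistent_phase :
  (forall B, van_hove theta B ->
    exists gamma : cmeasure R G, autocorrelation theta mu B gamma /\
      exists gammahat : radon_measure R (dual R G),
        fourier_transform theta gamma gammahat /\ pure_point gammahat) ->
  (forall (chi : dual R G) B, van_hove theta B ->
    exists a : R[i], fourier_bohr theta mu B chi a) ->
  (forall (chi : dual R G) gamma (gammahat : radon_measure R (dual R G)) (a : R[i]),
    autocorrelation theta mu A gamma -> fourier_transform theta gamma gammahat ->
    fourier_bohr theta mu A chi a -> gammahat [set chi] = (cabs a ^+ 2)%:E) ->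
  weyl_ap theta A mu.
Proof.
move=> Ha Hb Hc phi0 cphi0; rewrite -(reflectK phi0).
set phi := reflect phi0; have cphi : Cc phi := reflect_Cc hG cphi0.
set f := conv_meas mu (reflect phi).
have bf : buc f := conv_buc hG lcG haar mu_tb (reflect_Cc hG cphi).
split; first exact: buc_L1_loc.
move=> eps eps0.
have [gamma [Hg [nu [Hft ppnu]]]] := Ha A hA.
pose g := Defs.conv theta phi (tilde phi).
have cg : Cc g by apply: conv_Cc => //; exact: tilde_Cc.
(* The hypothesis gives some autocorrelation for each sequence; interleaving identifies their values
   at [g]. *)
have ug B : van_hove theta B -> gamma_avg theta mu (B n) g @[n --> \oo] --> cm_integral gamma g.
  have [|l hl] := @van_hove_common_lim R G theta A (fun E => gamma_avg theta mu E g) hA.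
    move=> C /Ha[gm [/autocorrelationE hgm _]]; exists (cm_integral gm g).
    exact: (hgm g cg).
  have -> : cm_integral gamma g = l.
    by apply: (cvgC_unique _ (hl A hA)); move/autocorrelationE: Hg => Hg; exact: (Hg g cg).
  by move=> hB; exact: (hl B hB).
have [_ sigE] := Hft phi cphi; set sigma := (\int[nu]_chi _)%R in sigE.
have fsig B : van_hove theta B -> cvg_avg theta B (sqabs f) sigma%:C%C.
  move=> hB; rewrite sigE; apply: (@cvgC_close _ (fun n => gamma_avg theta mu (B n) g)).
    exact: (gamma_avg_conv hG lcG haar mu_tb hB cphi cphi).
  exact: (ug B hB).
have exa chi : exists a : R[i], forall B, van_hove theta B -> fourier_bohr theta mu B chi a.
  have [C hC|a ha] := @van_hove_common_lim R G theta A (bohr_avg theta mu chi) hA.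
    by have [a ha] := Hb chi C hC; exists a; exact: ha.
  by exists a => B hB; exact: (ha B hB).
have [a ha] := choice exa.
have atom chi : nu [set chi] = (cabs (a chi) ^+ 2)%:E by exact: Hc Hg Hft (ha chi A hA).
pose c chi := ift phi chi * a chi.
have fa B (chi : dual R G) : van_hove theta B -> cvg_avg theta B (fun t => (chi t)^*%C * f t) (c chi).
  by move=> hB; exact: (fourier_bohr_coef hG lcG haar mu_tb hB cphi (ha chi B hB)).
(* By Cauchy-Schwarz a mean square of at most [e] gives a mean of at most [eps / 2]. Half of [e] is
   spent on the omitted point masses, half on the convergence along [B]. *)
pose e := (eps / 2) ^+ 2; have e0 : 0 < e / 2 by rewrite divr_gt0// exprn_gt0// divr_gt0.
have [s us hs] : exists2 s, uniq s & sigma <= \sum_(chi <- s) cabs (c chi) ^+ 2 + e / 2.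
  (* If all finite sums over atoms stayed below [sigma - e / 2], pure pointness would give the same
     bound for the whole integral, which is [sigma]. *)
  apply: contrapT => nex.
  have : (\int[nu]_chi (cabs (ift phi chi) ^+ 2)%:E <= (sigma - e / 2)%:E)%E.
    apply: pure_point_integral_le => //.
    - exact: dual_hausdorff.
    - move=> chi; apply: (@continuousM _ _ (fun chi : dual R G => cabs _) (fun chi => cabs _));
        exact: ift_continuous.
    - by move=> chi; exact: sqr_ge0.
    - by move=> d d0; exact: ift_precompact.
    move=> s us; under eq_bigr do rewrite atom -EFinM -exprMn -cabsM.
    rewrite sumEFin lee_fin lerBrDr leNgt; apply/negP => /ltW h.
    by apply: nex; exists s.
  have [ig _] := Hft phi cphi.
  rewrite -(fineK (integrable_fin_num measurableT ig)) lee_fin -/(Rintegral _ _ _) -/sigma.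
  by lra.
exists (trig_sum c s); split; first exact: trig_sum_trig_poly.
have bP : buc (fun t => f t - trig_sum c s t).
  by apply: bucB => //; apply: trig_poly_buc; exact: trig_sum_trig_poly.
apply: (@le_lt_trans _ _ (eps / 2)%:E); last by rewrite lte_fin ltr_pdivrMr// ltr_pMr// ltr1n.
apply: weyl_norm_le => // B hB.
have := mean_square_trig_sum hG haar hB bf (fun chi => fa B chi hB) (fsig B hB) (c:=c) us.
move=> /cvgC_near/(_ _ e0); apply: filterS => n.
have [oB pB bB B0] := vH_basic hG n hB.
rewrite avg_sqabs -rmorphB /= cabsR => /(le_lt_trans (ler_norm _)) h.
have {}h : aavg theta (B n) (sqabs (fun x => f x - trig_sum c s x)) < e.
  have E : \sum_(chi <- s) (cabs (c chi - c chi) ^+ 2 - cabs (c chi) ^+ 2) =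
      - \sum_(chi <- s) cabs (c chi) ^+ 2.
    by rewrite -sumrN; apply: eq_bigr => chi _; rewrite subrr cabs0 expr0n/= sub0r.
  rewrite E in h; lra.
have := le_trans (aavg_CS hG bB B0 (buc_bmeas bP)) (ltW h).
rewrite /e ler_pXn2r ?nnegrE ?aavg_ge0//.
by rewrite divr_ge0// ltW.
Qed.

End sufficiency.

Lemma cabs_lt_third (R : realType) (x y z l : R[i]) (e : R) :
  cabs (x - y) < e / 3 -> cabs (y - z) < e / 3 -> cabs (z - l) < e / 3 -> cabs (x - l) < e.
Proof. by have := cabs_tri y x l; have := cabs_tri z y l; lra. Qed.

(** * Existence of means for a Weyl almost periodic measure *)

Section necessity.
Context (R : realType) (G : topologicalZmodType) (hG : hausdorff_space G).
Context (lcG : locally_compact [set: G]).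
Context (theta : radon_measure R G) (haar : is_haar theta).
Context (mu : cmeasure R G) (mu_tb : translation_bounded mu).
Context (A : nat -> set G) (hA : van_hove theta A).
Implicit Types (f g phi psi : G -> R[i]) (chi : dual R G) (K : set G) (B : nat -> set G).

Local Notation ift := (inverse_fourier theta).

Lemma cvgC_real (u : nat -> R) (l : R[i]) :
  (u n)%:C%C @[n --> \oo] --> l -> l = (complex.Re l)%:C%C.
Proof.
move=> ul; have ul' := cvgCJ ul.
have E : (fun n => ((u n)%:C%C)^*%C) = (fun n => (u n)%:C%C) :> (nat -> R[i]).
  by apply/funext => n; rewrite cJR.
have h := cvgC_unique (cvgC_ext E ul') ul.
apply: complex_eq => //=.
have : complex.Im (l^*%C) = complex.Im l by rewrite h.
rewrite cImJ; lra.
Qed.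

Lemma gamma_avg_linear B n a f g : van_hove theta B -> buc f -> buc g ->
  gamma_avg theta mu (B n) (fun x => a * f x + g x) =
  a * gamma_avg theta mu (B n) f + gamma_avg theta mu (B n) g.
Proof.
move=> hB bf bg; have [oB pB _ _] := vH_basic hG n hB.
by rewrite /gamma_avg (gamma_linear hG)// mulrDr mulrCA.
Qed.

(** The index from which the bound holds depends on [K] and [B] but not on [g]. The factor 2 arises
    because the boundary is eventually no larger than the set. *)
Lemma gamma_avg_bound K : compact K -> exists2 C : R, 0 <= C &
  forall B, van_hove theta B -> \forall n \near \oo,
  forall g (M : R), buc g -> 0 <= M -> (forall x, cabs (g x) <= M) ->
    (forall x, ~ K x -> g x = 0) -> cabs (gamma_avg theta mu (B n) g) <= C * M.
Proof.
move=> cK; have [C [K' [C0 cK' H]]] := gamma_bound hG haar mu_tb cK.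
exists (C * 2); first by rewrite mulr_ge0.
move=> B hB; apply: filterS (vH_boundary hB cK' ltr01) => n hn g M bg M0 gM gK.
have [oB pB bB B0] := vH_basic hG n hB.
have v0 : 0 <= (vol theta (B n))^-1 by rewrite invr_ge0 ltW.
rewrite /gamma_avg cabsM cabsR ger0_norm// ler_pdivrMl//.
apply: le_trans (H g M (B n) oB pB bg M0 gM gK) _.
have hb : vol theta (vh_boundary K' (B n)) <= vol theta (B n).
  by apply/ltW; move: hn; rewrite /boundary_ratio ltr_pdivrMr// mul1r.
rewrite (_ : vol theta (B n) * (C * 2 * M) = C * M * (vol theta (B n) + vol theta (B n))); last by ring.
by apply: ler_wpM2l; [exact: mulr_ge0|rewrite lerD2l].
Qed.

(** The mean values of products settle only test functions of the form [g * psi~]. An approximate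
    identity brings such a function within [d] of [g] on a fixed compact set, and [gamma_avg_bound]
    makes the change in the averages at most [C * d]. *)
Lemma gamma_avg_cvg :
  (forall phi psi, Cc phi -> Cc psi -> forall B, van_hove theta B -> exists l,
    cvg_avg theta B (fun x => conv_meas mu (reflect phi) x *
       (conv_meas mu (reflect psi) x)^*%C) l) ->
  forall g, Cc g -> exists l : R[i], forall B, van_hove theta B ->
    gamma_avg theta mu (B n) g @[n --> \oo] --> l.
Proof.
move=> Hprod g cg; apply: (van_hove_common_lim (u := fun E => gamma_avg theta mu E g) hA).
move=> B hB; apply: complex_cauchy => e e0.
have [K cK Happ] := approximate_identity hG lcG haar cg.
have [C C0 HC] := gamma_avg_bound cK.
have e3 : 0 < e / 3 by rewrite divr_gt0.
have C1 : 0 < C + 1 by rewrite ltr_wpDl.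
pose d := e / 3 / (C + 1); have d0 : 0 < d by rewrite divr_gt0.
have [psi cpsi [bc cd cK0]] := Happ d d0.
have [l hl] := Hprod g psi cg cpsi B hB; exists l.
have bg := Cc_buc cg.
pose h x := -1 * Defs.conv theta g (tilde psi) x + g x.
have bh : buc h by apply: bucD => //; exact: bucZ.
have hd x : cabs (h x) <= d by rewrite /h mulN1r addrC cabsC; exact: cd.
have hK x : ~ K x -> h x = 0 by move=> /cK0[h1 h2]; rewrite /h h1 h2 mulr0 addr0.
have n1 := gamma_avg_conv hG lcG haar mu_tb hB cg cpsi e3.
have /cvgC_near/(_ _ e3) n2 := hl.
apply: (filterS3 _ _ (HC B hB) n1 n2) => n b1 b2 b3.
have {}b1 : cabs (gamma_avg theta mu (B n) g -
    gamma_avg theta mu (B n) (Defs.conv theta g (tilde psi))) < e / 3.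
  have := b1 h d bh (ltW d0) hd hK; rewrite /h gamma_avg_linear// mulN1r addrC => /le_lt_trans; apply.
  by rewrite /d mulrCA gtr_pMr// ltr_pdivrMr// mul1r ltrDl.
exact: (cabs_lt_third b1 b2 b3).
Qed.

Context (mu_wap : weyl_ap theta A mu).

Let bf phi : Cc phi -> buc (conv_meas mu (reflect phi)).
Proof. by move=> cphi; exact: (conv_buc hG lcG haar mu_tb (reflect_Cc hG cphi)). Qed.

Let mf phi : Cc phi -> mean_approx theta (conv_meas mu (reflect phi)).
Proof.
by move=> cphi; exact: (weyl_mean_approx hG haar hA (bf cphi) (mu_wap (reflect_Cc hG cphi))).
Qed.

Lemma fourier_bohr_exists chi : exists a : R[i], forall B, van_hove theta B ->
  fourier_bohr theta mu B chi a.
Proof.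
have [phi cphi i0] := ift_nonzero hG lcG haar chi.
have [|l hl] := van_hove_common_lim
    (u := fun E => avg theta E (fun t => (chi t)^*%C * conv_meas mu (reflect phi) t)) hA.
  move=> B hB.
  have [l hl] := mean2_product hG haar (bf cphi) (dual_buc chi) (mf cphi)
    (trig_poly_mean_approx hG theta (trig_poly_chi chi)) hB.
  exists l; apply: (cvgC_ext _ hl); apply/funext => n; congr avg.
  by apply/funext => t; rewrite mulrC.
exists ((ift phi chi)^-1 * l) => B hB.
exact: (coef_fourier_bohr hG lcG haar mu_tb hB cphi i0 (hl B hB)).
Qed.

Lemma autocorrelation_exists : exists gamma : cmeasure R G,
  forall B, van_hove theta B -> autocorrelation theta mu B gamma.
Proof.
have H := gamma_avg_cvg (fun phi psi cphi cpsi B hB =>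
  mean2_product hG haar (bf cphi) (bf cpsi) (mf cphi) (mf cpsi) hB).
(* Limits are chosen for all functions at once, with the default value 0 outside the test
   functions. *)
have /choice[L hL] : forall g, exists l : R[i], Cc g -> forall B, van_hove theta B ->
    gamma_avg theta mu (B n) g @[n --> \oo] --> l.
  move=> g; have [cg|ncg] := pselect (Cc g); last by exists 0.
  by have [l hl] := H g cg; exists l => _; exact: hl.
have lin a f g : Cc f -> Cc g -> Cc (fun x => a * f x + g x) ->
    L (fun x => a * f x + g x) = a * L f + L g.
  move=> cf cg cfg.
  have h := cvgCD (@cvgCZ R a _ _ (hL f cf A hA)) (hL g cg A hA).
  apply: (cvgC_unique (hL _ cfg A hA)); apply: (cvgC_ext _ h).
  by apply/funext => n; rewrite (gamma_avg_linear n a hA (Cc_buc cf) (Cc_buc cg)).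
have Cclin a f g : Cc f -> Cc g -> Cc (fun x => a * f x + g x).
  move=> cf cg; have [K cK sK] := Cc_supp cf; have [K' cK' sK'] := Cc_supp cg.
  apply: (@Cc_sub _ _ hG _ (K `|` K')).
  - exact: (buc_cont (bucD (bucZ a (Cc_buc cf)) (Cc_buc cg))).
  - exact: compactU.
  - move=> x nK; rewrite sK ?sK' ?mulr0 ?addr0// => Kx; apply: nK; [right|left] => //.
have [|||gamma hgamma] := @complex_riesz R G hG lcG L.
- move=> f g cf cg; have := lin 1 f g cf cg (Cclin 1 f g cf cg).
  by rewrite mul1r => <-; congr L; apply/funext => x; rewrite mul1r.
- move=> a f cf; have := lin (a - 1) f f cf cf (Cclin (a - 1) f f cf cf).
  have -> : (a - 1) * L f + L f = a * L f by ring.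
  by move=> <-; congr L; apply/funext => x; ring.
- move=> K cK; have [C C1 HC] := gamma_avg_bound cK; exists C => f M cf fK fM.
  have M0 : 0 <= M by rewrite (le_trans _ (fM 0))// cabs_ge0.
  apply: (cvgC_cabs_le (hL f cf A hA)); apply: filterS (HC A hA) => n hn.
  exact: hn (Cc_buc cf) M0 fM fK.
exists gamma => B hB; apply/autocorrelationE => phi cphi.
by rewrite hgamma//; exact: (hL phi cphi B hB).
Qed.

End necessity.

(** * The diffraction measure as the sum of the squared Fourier-Bohr coefficients *)

Section spectral_measure.
Context (R : realType) (G : topologicalZmodType) (hG : hausdorff_space G).
Context (lcG : locally_compact [set: G]).
Context (theta : radon_measure R G) (haar : is_haar theta).
Context (mu : cmeasure R G) (mu_tb : translation_bounded mu).
Context (A : nat -> set G) (hA : van_hove theta A).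
Implicit Types (f g phi psi : G -> R[i]) (chi : dual R G).
Context (mu_wap : weyl_ap theta A mu).
Context (gamma : cmeasure R G) (a : dual R G -> R[i]).
Hypothesis Hg : autocorrelation theta mu A gamma.
Hypothesis Ha : forall chi, fourier_bohr theta mu A chi (a chi).

Local Notation ift := (inverse_fourier theta).

(** Taking the real part loses nothing for a test function: the value is a limit of means of
    squares, hence real, as [sigma_cvg] shows. *)
Let sigma phi : R := complex.Re (cm_integral gamma (Defs.conv theta phi (tilde phi))).

Let sigma_cvg phi : Cc phi ->
  cvg_avg theta A (sqabs (conv_meas mu (reflect phi))) (sigma phi)%:C%C /\
  (sigma phi)%:C%C = cm_integral gamma (Defs.conv theta phi (tilde phi)).
Proof.
move=> cphi.
have cg : Cc (Defs.conv theta phi (tilde phi)) := conv_Cc hG theta cphi (tilde_Cc hG cphi).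
move/autocorrelationE : Hg => /(_ _ cg) hg.
have h : avg theta (A n) (sqabs (conv_meas mu (reflect phi))) @[n --> \oo] -->
    cm_integral gamma (Defs.conv theta phi (tilde phi)).
  apply: (cvgC_close _ hg).
  exact: (gamma_avg_conv hG lcG haar mu_tb hA cphi cphi).
have E : (fun n => avg theta (A n) (sqabs (conv_meas mu (reflect phi)))) =
    (fun n => (aavg theta (A n) (sqabs (conv_meas mu (reflect phi))))%:C%C).
  by apply/funext => n; exact: avg_sqabs.
have hr := cvgC_real (cvgC_ext E h).
by split; [rewrite /cvg_avg /sigma -hr; exact: h|rewrite /sigma -hr].
Qed.

Let bf phi : Cc phi -> buc (conv_meas mu (reflect phi)).
Proof. by move=> cphi; exact: (conv_buc hG lcG haar mu_tb (reflect_Cc hG cphi)). Qed.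

Let coef phi chi : Cc phi ->
  cvg_avg theta A (fun t => (chi t)^*%C * conv_meas mu (reflect phi) t) (ift phi chi * a chi).
Proof. by move=> cphi; exact: (fourier_bohr_coef hG lcG haar mu_tb hA cphi (@Ha chi)). Qed.

Let w chi : R := cabs (a chi) ^+ 2.

Let bessel_ift phi s : Cc phi -> uniq s ->
  \sum_(chi <- s) cabs (ift phi chi) ^+ 2 * w chi <= sigma phi.
Proof.
move=> cphi us; have [hs _] := sigma_cvg cphi.
have := bessel hG haar hA (bf cphi) (fun chi => @coef phi chi cphi) hs us.
apply: le_trans.
by apply: ler_sum => chi _; rewrite /w -exprMn -cabsM.
Qed.

(** Near [chi] a suitable transform stays above [c], so Bessel's inequality bounds the sum of the
    weights there by [sigma phi / c ^+ 2]. *)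
Let w_loc chi : exists U, [/\ open U, U chi & (\esum_(x in U) (w x)%:E < +oo)%E].
Proof.
have [phi cphi i0] := ift_nonzero hG lcG haar chi.
pose c := cabs (ift phi chi) / 2; have c0 : 0 < c by rewrite divr_gt0// cabs_gt0.
exists [set omega | c < cabs (ift phi omega)]; split.
- apply: (@open_comp _ _ (fun omega : dual R G => cabs (ift phi omega)) [set y | c < y]).
    by move=> omega _; exact: (@ift_continuous R G hG theta phi cphi).
  exact: open_gt.
- by rewrite /= /c ltr_pdivrMr// ltr_pMr ?cabs_gt0// ltr1n.
apply: (@le_lt_trans _ _ (sigma phi / c ^+ 2)%:E); last exact: ltry.
apply: ub_ereal_sup => _ [F [fF FU] <-].
rewrite fsbig_finite//= sumEFin lee_fin ler_pdivlMr ?exprn_gt0// mulr_suml.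
apply: le_trans (bessel_ift cphi (finmap.fset_uniq (fset_set F))).
rewrite big_seq [leRHS]big_seq; apply: ler_sum => omega.
rewrite (in_fset_set fF) inE => /FU /= h.
by rewrite mulrC ler_wpM2r ?sqr_ge0// lerXn2r ?nnegrE ?cabs_ge0// ltW.
Qed.

(** Bessel's inequality bounds every finite sum over atoms, hence the integral, by [sigma phi];
    approximation in mean square gives the reverse inequality. *)
Lemma spectral_measure_exists : exists nu : radon_measure R (dual R G),
  [/\ fourier_transform theta gamma nu, pure_point nu &
      forall chi, nu [set chi] = (cabs (a chi) ^+ 2)%:E].
Proof.
have [nu [pp atom]] := atomic_measure_exists (@dual_hausdorff R G)
  (fun chi => sqr_ge0 (cabs (a chi)) : 0 <= w chi) w_loc.
exists nu; split=> // phi cphi.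
have [hs sE] := sigma_cvg cphi.
have h0 (chi : dual R G) : 0 <= cabs (ift phi chi) ^+ 2 by exact: sqr_ge0.
have hc : continuous (fun chi : dual R G => cabs (ift phi chi) ^+ 2).
  move=> chi; apply: (@continuousM _ _ (fun chi : dual R G => cabs _) (fun chi => cabs _));
    exact: (@ift_continuous R G hG theta phi cphi).
have sumE (s : seq (dual R G)) :
    (\sum_(chi <- s) ((cabs (ift phi chi) ^+ 2)%:E * nu [set chi]) =
     (\sum_(chi <- s) cabs (ift phi chi) ^+ 2 * w chi)%:E)%E.
  by rewrite -sumEFin; apply: eq_bigr => chi _; rewrite atom EFinM.
have I : (\int[nu]_chi (cabs (ift phi chi) ^+ 2)%:E = (sigma phi)%:E)%E.
  apply/eqP; rewrite eq_le; apply/andP; split.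
    apply: (pure_point_integral_le (@dual_hausdorff R G) pp hc h0).
      by move=> d d0; exact: (ift_precompact hG lcG haar cphi d0).
    by move=> s us; rewrite sumE lee_fin; exact: bessel_ift.
  apply/lee_addgt0Pr => e e0.
  have m2 := mean_approx_mean2 hG (bf cphi)
    (weyl_mean_approx hG haar hA (bf cphi) (mu_wap (reflect_Cc hG cphi))).
  have [s us hss] := parseval_approx hG haar hA (bf cphi) (fun chi => @coef phi chi cphi) hs m2 e0.
  apply: le_trans (leeD2r _ (le_sum_integral (@dual_hausdorff R G) nu hc h0 us)).
  rewrite sumE -EFinD lee_fin; apply: (le_trans hss); rewrite lerD2r.
  by apply: ler_sum => chi _; rewrite /w -exprMn -cabsM.
split.
  apply/integrableP; split.
    by apply/measurable_EFinP; exact: (ift_sqr_measurable hG theta cphi).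
  by under eq_integral do rewrite gee0_abs ?lee_fin ?sqr_ge0//; rewrite I ltry.
by rewrite /Rintegral I.
Qed.

End spectral_measure.

Theorem theorem5p21 (R : realType) (G : topologicalZmodType)
    (G_hausdorff : hausdorff_space G)
    (G_locally_compact : locally_compact [set: G])
    (G_sigma_compact : sigma_compact G)
    (theta : radon_measure R G) (theta_haar : is_haar theta)
    (mu : cmeasure R G) (mu_bounded : translation_bounded mu)
    (A : nat -> set G) (A_van_hove : van_hove theta A) :
  weyl_ap theta A mu <->
  [/\ forall B, van_hove theta B ->
        exists gamma : cmeasure R G,
          autocorrelation theta mu B gamma /\
          exists gammahat : radon_measure R (dual R G),
            fourier_transform theta gamma gammahat /\ pure_point gammahat,
      forall (chi : dual R G) B, van_hove theta B ->
        exists a : R[i], fourier_bohr theta mu B chi a &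
      forall (chi : dual R G) B B' gamma (gammahat : radon_measure R (dual R G))
          (a : R[i]),
        van_hove theta B -> van_hove theta B' ->
        autocorrelation theta mu B gamma ->
        fourier_transform theta gamma gammahat ->
        fourier_bohr theta mu B' chi a ->
        gammahat [set chi] = (cabs a ^+ 2)%:E].
Proof.
move: G_hausdorff G_locally_compact theta_haar mu_bounded A_van_hove => hG lcG haar tb hA.
split=> [wap|[Ha Hb Hc]]; last first.
  apply: (weyl_ap_of_consistent_phase hG lcG haar tb hA Ha Hb).
  by move=> chi gamma nu a h1 h2 h3; exact: (Hc _ _ _ _ _ _ hA hA h1 h2 h3).
have [gamma Hg] := autocorrelation_exists hG lcG haar tb hA wap.
have /choice[a Ha] := fourier_bohr_exists hG lcG haar tb hA wap.
have [nu [Hft pp atom]] := spectral_measure_exists hG lcG haar tb hA wap (Hg A hA)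
  (fun chi => Ha chi A hA).
split.
- by move=> B hB; exists gamma; split; [exact: Hg|exists nu].
- by move=> chi B hB; exists (a chi); exact: Ha.
(* Consistent phase is claimed for any autocorrelation and any transform of it, not just those
   constructed. All transforms have the same integrals of squared test transforms, hence by
   [atom_eq] the same atoms. *)
move=> chi B B' gamma' nu' a' hB hB' Hg' Hft' Ha'.
have -> : a' = a chi by exact: (cvgC_unique Ha' (Ha chi B' hB')).
rewrite -atom; apply: (atom_eq hG lcG haar hA) => phi cphi.
have [i1 e1] := Hft' phi cphi; have [i2 e2] := Hft phi cphi; split=> //.
apply: (@complexI R); rewrite e1 e2.
have cg : Cc (Defs.conv theta phi (tilde phi)) := conv_Cc hG theta cphi (tilde_Cc hG cphi).
exact: (cvgC_unique (Hg' _ cg) (Hg B hB _ cg)).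
Qed.
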